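(* Let $K$ be an ordinary differential field of characteristic $0$ with field of constants $C$ (not assumed algebraically closed), let $L|K$ be a Picard-Vessiot extension, and let $\operatorname{DGal}(L|K)$ be its differential Galois group. 1. The correspondences $$H\mapsto L^H, \qquad E\mapsto \operatorname{DGal}(L|E)$$ define inclusion-inverting, mutually inverse bijective maps between the set of $C$-defined closed subgroups $H$ of $\operatorname{DGal}(L|K)$ and the set of differential fields $E$ with $K\subset E\subset L$. 2. Let $E$ be an intermediate differential field, $K\subset E\subset L$. Then $E$ is a Picard-Vessiot extension of $K$ if and only if the subgroup $\operatorname{DGal}(L|E)$ is normal in $\operatorname{DGal}(L|K)$. In this case, the restriction morphism $$\operatorname{DGal}(L|K)\rightarrow \operatorname{DGal}(E|K),\qquad \sigma\mapsto \sigma_{|E},$$ induces an isomorphism $$\operatorname{DGal}(L|K)/\operatorname{DGal}(L|E)\simeq \operatorname{DGal}(E|K).$$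
   Context: All fields have characteristic $0$ and all differential fields are ordinary (one derivation). For a differential field $F$, $C_F$ denotes its field of constants. For a differential extension $L|K$ and elements $\eta_1,\dots,\eta_n\in L$, $K\langle \eta_1,\dots,\eta_n\rangle$ denotes the differential subfield of $L$ differentially generated by $\eta_1,\dots,\eta_n$ over $K$. **Picard-Vessiot extension.** Given a homogeneous linear differential equation $\mathcal{L}(Y):=Y^{(n)}+a_{n-1}Y^{(n-1)}+\dots+a_1Y'+a_0Y=0$ of order $n$ over a differential field $K$, a differential extension $L|K$ is a Picard-Vessiot extension for $\mathcal{L}$ if (i) $L=K\langle \eta_1,\dots,\eta_n\rangle$, where $\eta_1,\dots,\eta_n$ is a fundamental set of solutions of $\mathcal{L}(Y)=0$ in $L$ (i.e. $n$ solutions linearly independent over the constants), and (ii) every constant of $L$ lies in $K$, i.e. $C_K=C_L$. One says that $L|K$ is a Picard-Vessiot extension if it is one for some such $\mathcal{L}$ over $K$. **Conventions.** Let $C=C_K$. Fix a differential closure $\mathcal{K}$ of $K$, and let $\overline{C}$ be an algebraic closure of $C$ contained in $\mathcal{K}$. All differential field extensions of $K$ are assumed to be subfields of $\mathcal{K}$. For any such extension $F$ (including $F=K$), $\overline{F}$ denotes the composition field $F\cdot\overline{C}$ inside $\mathcal{K}$ (it is not the algebraic closure of $F$). Let $\{\alpha_i\}_{i\in I}$ be a $C$-basis of $\overline{C}$; if $C_F=C$, then $\{\alpha_i\}_{i\in I}$ is also an $F$-basis of $\overline{F}$. **Differential Galois group.** For a Picard-Vessiot extension $L|K$, $\operatorname{DGal}(L|K)$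 is the set $\operatorname{DHom}_K(L,\overline{L})$ of $K$-differential morphisms from $L$ into $\overline{L}$, with the group structure transferred from the group $\operatorname{DAut}_{\overline{K}}\overline{L}$ of $\overline{K}$-differential automorphisms of $\overline{L}$ via the mutually inverse bijections $\sigma\mapsto\widehat{\sigma}$, where $\widehat{\sigma}(\sum\lambda_i\alpha_i)=\sum\sigma(\lambda_i)\alpha_i$ for $\lambda_i\in L$, and $\tau\mapsto\tau_{|L}$. If $L=K\langle\eta_1,\dots,\eta_n\rangle$ with $\eta_1,\dots,\eta_n$ a fundamental set of solutions in $L$ (i.e. $n$ solutions linearly independent over $C$) of a homogeneous linear differential equation $\mathcal{L}(Y)=0$ of order $n$ over $K$ for which $L|K$ is a Picard-Vessiot extension, then for each $\sigma\in \operatorname{DGal}(L|K)$ one has $\sigma(\eta_j)=\sum_{i=1}^n c_{ij}\eta_i$, $1\le j\le n$, with $c_{ij}\in\overline{C}$, and $\sigma\mapsto(c_{ij})$ identifies $\operatorname{DGal}(L|K)$ with a $C$-defined Zariski closed subgroup of $\operatorname{GL}(n,\overline{C})$. Here a subgroup is ''$C$-defined closed'' if it is the set of matrices in $\operatorname{GL}(n,\overline{C})$ at which all polynomials of some set of polynomials in the matrix entries with coefficients in $C$ vanish. **Notation for the correspondence.** For a subset $S$ of $\operatorname{DGal}(L|K)$, $L^S:=\{a\in L:\sigma(a)=a\ \ \forall\sigma\in S\}$. If $E$ is an intermediate differential field, $K\subset E\subset L$, then $L|E$ is a Picard-Vessiot extension, and $\operatorname{DGal}(L|E)=\operatorname{DHom}_E(L,\overline{L})$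 (with $\overline{L}=L\cdot\overline{C}$ inside the same $\mathcal{K}$) is a $C$-defined closed subgroup of $\operatorname{DGal}(L|K)$, namely the subgroup of those $\sigma$ that fix $E$ pointwise. *)

(* Defs.v *)
From HB Require Import structures.
From mathcomp Require Import all_boot all_order all_algebra.
From mathcomp Require Import boolp classical_sets functions.
From mathcomp Require Import mpoly.

Set Implicit Arguments.
Unset Strict Implicit.
Unset Printing Implicit Defensive.

Import GRing.Theory.

Local Open Scope classical_set_scope.
Local Open Scope ring_scope.

(* Ordinary differential fields of characteristic 0. *)
HB.mixin Record Field_isDifferential U of GRing.Field U := {
  der : U -> U;
  derD : forall x y : U, der (x + y) = der x + der y;
  derM : forall x y : U, der (x * y) = der x * y + x * der y;
  diff_pchar0 : [pchar U] =i pred0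
}.

#[short(type="diffFieldType")]
HB.structure Definition DiffField := {U of Field_isDifferential U & GRing.Field U}.

(* Subfields are represented as Prop-valued subsets of an ambient differential
   field U, which will be the differential closure of the base field. *)

Record is_subfield (U : diffFieldType) (A : set U) : Prop := IsSubfield {
  subfield1 : A 1;
  subfieldB : forall x y, A x -> A y -> A (x - y);
  subfieldM : forall x y, A x -> A y -> A (x * y);
  subfieldV : forall x, A x -> A x^-1
}.

Definition is_dsubfield (U : diffFieldType) (A : set U) : Prop :=
  is_subfield A /\ (forall x, A x -> A (der x)).

Definition intermediate (U : diffFieldType) (K L : set U) : set (set U) :=
  [set E | [/\ is_dsubfield E, K `<=` E & E `<=` L]].

Definition constants (U : diffFieldType) (A : set U) : set U :=
  [set x | A x /\ der x = 0].

Definition compositum (U : diffFieldType) (A B : set U) : set U :=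
  smallest (@is_subfield U) (A `|` B).

Definition dgenerated (U : diffFieldType) (A S : set U) : set U :=
  smallest (@is_dsubfield U) (A `|` S).

(* The relative algebraic closure of A in U; it is an algebraic closure of A
   as soon as U is algebraically closed. *)
Definition alg_closure_in (U : diffFieldType) (A : set U) : set U :=
  [set x | exists p : {poly U}, [/\ p != 0, forall i, A p`_i & root p x]].

Definition is_basis (U : diffFieldType) (C B : set U) (I : eqType)
    (alpha : I -> U) : Prop :=
  [/\ forall i, B (alpha i),
      forall x, B x -> exists (s : seq I) (c : I -> U),
        [/\ uniq s, forall i, C (c i) & x = \sum_(i <- s) c i * alpha i] &
      forall (s : seq I) (c : I -> U), uniq s -> (forall i, C (c i)) ->
        \sum_(i <- s) c i * alpha i = 0 -> forall i, i \in s -> c i = 0].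

(* Differential morphisms A -> V; only the values of f on A matter. *)
Definition is_dhom (U V : diffFieldType) (A : set U) (f : U -> V) : Prop :=
  [/\ f 1 = 1,
      forall x y, A x -> A y -> f (x + y) = f x + f y,
      forall x y, A x -> A y -> f (x * y) = f x * f y &
      forall x, A x -> f (der x) = der (f x)].

(* Evaluation of a differential polynomial in Y, Y', ..., Y^(n-1), encoded as
   a polynomial in n variables ('X_i standing for Y^(i)). *)
Definition deval (U : diffFieldType) n (P : {mpoly U[n]}) (y : U) : U :=
  P.@[fun i : 'I_n => iter i der y].

(* Blum's axioms: if P has order exactly n and Q is nonzero of order < n, then
   P = 0, Q <> 0 is solvable. Nonzero constants have order < 0, so n = 0 says
   that U is algebraically closed. *)
Definition diff_closed (U : diffFieldType) : Prop :=
  forall n (P : {mpoly U[n.+1]}) (Q : {mpoly U[n]}),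
    (exists2 m : 'X_{1..n.+1}, m \in msupp P & (0 < m ord_max)%N) ->
    Q != 0 ->
    exists y : U, deval P y = 0 /\ deval Q y <> 0.

(* U is a differential closure of its differential subfield K. *)
Definition diff_closure (U : diffFieldType) (K : set U) : Prop :=
  diff_closed U /\
  forall (M : diffFieldType) (f : U -> M), diff_closed M -> is_dhom K f ->
    exists g : U -> M, is_dhom setT g /\ {in K, g =1 f}.

(* L|K is a Picard-Vessiot extension for
   Y^(n) + a_(n-1) Y^(n-1) + ... + a_0 Y = 0, with fundamental set eta. *)
Definition PV_for (U : diffFieldType) (K L : set U) n (a eta : 'I_n -> U)
    : Prop :=
  [/\ (0 < n)%N /\ (forall i, K (a i)),
      forall j, L (eta j) /\
        iter n der (eta j) + \sum_(i < n) a i * iter i der (eta j) = 0,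
      forall c : 'I_n -> U, (forall j, constants L (c j)) ->
        \sum_(j < n) c j * eta j = 0 -> forall j, c j = 0,
      L = dgenerated K (range eta) &
      constants L = constants K].

Definition picard_vessiot (U : diffFieldType) (K L : set U) : Prop :=
  exists n (a eta : 'I_n -> U), PV_for K L a eta.

(* A set of elements of T with a composition law and a distinguished element;
   in all uses below it is a group. *)
Record group_on (T : Type) := GroupOn {
  carrier : set T;
  gmul : T -> T -> T;
  gone : T
}.

Definition is_subgroup T (G : group_on T) (H : set T) : Prop :=
  [/\ H `<=` carrier G, H (gone G),
      forall s t, H s -> H t -> H (gmul G s t) &
      forall s, H s -> exists t,
        [/\ H t, gmul G s t = gone G & gmul G t s = gone G]].

Definition left_coset T (G : group_on T) (N : set T) (s : T) : set T :=
  [set gmul G s t | t in N].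

Definition right_coset T (G : group_on T) (N : set T) (s : T) : set T :=
  [set gmul G t s | t in N].

Definition is_normal T (G : group_on T) (N : set T) : Prop :=
  is_subgroup G N /\
  forall s, carrier G s -> left_coset G N s = right_coset G N s.

Definition quotient_group T (G : group_on T) (N : set T) : group_on (set T) :=
  {| carrier := left_coset G N @` carrier G;
     gmul := fun A B => [set gmul G s t | s in A & t in B];
     gone := N |}.

Definition is_ghom T T' (G : group_on T) (G' : group_on T') (phi : T -> T')
    : Prop :=
  (forall s, carrier G s -> carrier G' (phi s)) /\
  (forall s t, carrier G s -> carrier G t ->
     phi (gmul G s t) = gmul G' (phi s) (phi t)).

Definition is_giso T T' (G : group_on T) (G' : group_on T') (phi : T -> T')
    : Prop :=
  is_ghom G G' phi /\ set_bij (carrier G) (carrier G') phi.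

(* Maps with domain A are represented by the total function extending them by
   0, so that equality of maps is Leibniz equality. *)
Definition restr (U : diffFieldType) (A : set U) (f : U -> U) : U -> U :=
  patch (fun=> 0) A f.

(* DHom_K(L, B) *)
Definition DHom (U : diffFieldType) (K L B : set U) : set (U -> U) :=
  [set f | [/\ is_dhom L f, f @` L `<=` B, forall x, K x -> f x = x
             & f = restr L f]].

(* The map sum_i l_i alpha_i |-> sum_i f(l_i) alpha_i (l_i in L), extended
   by 0. *)
Definition hat (U : diffFieldType) (L : set U) (I : eqType) (alpha : I -> U)
    (f : U -> U) (x : U) : U :=
  xget 0 [set y | exists (s : seq I) (l : I -> U),
    [/\ uniq s, forall i, L (l i),
        x = \sum_(i <- s) l i * alpha i &
        y = \sum_(i <- s) f (l i) * alpha i]].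

(* DGal(L|K), where Cb is the algebraic closure of the constants and alpha a
   basis of it over them. *)
Definition DGal (U : diffFieldType) (Cb : set U) (I : eqType) (alpha : I -> U)
    (L K : set U) : group_on (U -> U) :=
  {| carrier := DHom K L (compositum L Cb);
     gmul := fun s t => restr L (hat L alpha s \o hat L alpha t);
     gone := restr L id |}.

Definition fixed (U : diffFieldType) (L : set U) (S : set (U -> U)) : set U :=
  [set x | L x /\ forall s, S s -> s x = x].

Definition GL_over (U : diffFieldType) (Cb : set U) n : set 'M[U]_n :=
  [set M | M \in unitmx /\ forall i j, Cb (M i j)].

Definition matrices_of (U : diffFieldType) (Cb : set U) n (eta : 'I_n -> U)
    (H : set (U -> U)) : set 'M[U]_n :=
  [set M | GL_over Cb M /\ exists2 s, H s &
     forall j, s (eta j) = \sum_(i < n) M i j * eta i].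

Definition defined_closed (U : diffFieldType) (C Cb : set U) n
    (A : set 'M[U]_n) : Prop :=
  exists S : set {mpoly U[n * n]},
    (forall p, S p -> forall m, C p@_m) /\
    A = [set M | GL_over Cb M /\
           forall p, S p -> p.@[fun k => mxvec M ord0 k] = 0].

Definition closed_subgroup (U : diffFieldType) (C Cb : set U) n
    (eta : 'I_n -> U) (G : group_on (U -> U)) : set (set (U -> U)) :=
  [set H | is_subgroup G H /\ defined_closed C Cb (matrices_of Cb eta H)].

(* Main.v *)
(* Of the differential closure, only the fact that its underlying field is algebraically
   closed is needed.

   Let [W] be the wronskian matrix of the fundamental set [eta], [Cb] the algebraic closure
   of [C], and [bar F] the compositum of [F] and [Cb].  A morphism [s] of [L] satisfies
   [s W = W M] with [M] invertible over [Cb].  Conversely, let [E] be intermediate and [tau]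
   a differential embedding of [E] into [bar E] over [K].  The images under [tau] of the
   polynomials over [E] vanishing at [W], evaluated at [W X], span an ideal stable under the
   derivation of the coefficients, hence generated over the constants; by the Nullstellensatz
   it has zeros [M] in [GL(Cb)], and comparing the dimensions of spaces of monomials shows
   that each of them defines an embedding of [L] extending [tau].  The same argument, applied
   to [a(W X) - x b(W X)] where [x = a(W) / b(W)] is not in [E], yields a morphism over [E]
   moving [x]; so [E] is the fixed field of [Gal(L|E)], and this group is closed.

   For a closed subgroup [H] with fixed field [E], Galois descent reduces polynomials over
   [bar L] vanishing on [H W] to polynomials over [(bar L)^H].  As [H] is defined over [C],
   it contains the matrices conjugate over [C] to those of its elements, so that
   [(bar L)^H = bar E]; these polynomials then vanish on [Gal(L|E) W] as well.

   If [Gal(L|E)] is normal, then every [s] maps [E] into [bar E].  As [L] is finitely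
   generated, so is [E].  Express the monomials of bounded degree in [W] by an [E]-basis [v]
   extracted from them, with coefficient matrix [B] over [E]: then [E] is generated over [K]
   by the entries of [B], hence by its maximal minors, and a basis [w] of the [C]-span of
   these minors is mapped by [s] to [mu w S] with [S] over [Cb] and a scalar [mu] depending on
   [s].  The products of [M] of the [w j], [M] being their number, divided by the wronskian
   determinant of [w], span a space on which [s] acts by matrices over [Cb], and a basis of
   it is a fundamental set of solutions of an equation over [K] whose Picard-Vessiot field
   is [E]. *)

Require Import Defs.
From HB Require Import structures.
From mathcomp Require Import all_boot all_order all_algebra.
From mathcomp Require Import boolp classical_sets functions.
From mathcomp Require Import perm mpoly separable.
From mathcomp Require Import ring.

Set Implicit Arguments.
Unset Strict Implicit.
Unset Printing Implicit Defensive.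

Import GRing.Theory.

Local Open Scope classical_set_scope.
Local Open Scope ring_scope.

(** * Points of varieties *)

(** The variables [X] stand for the entries of a matrix over [Cb], hence for constants: this is why
    polynomials are evaluated at [W X] and differentiated through their coefficients only. A
    relation [p(W) = 0] over [E] then becomes an equation [p^tau(W M) = 0] on [M]. A solution [M] of
    these equations only yields a ring map on [E[W]]. It extends to the field [L] when its kernel
    contains nothing beyond the relations of [W]; that is the obstacle which the comparison of
    monomial spaces removes, since the monomials of bounded degree in [W] and in [W M] have the same
    span over [Cb]. The embedding [tau] is kept general because two cases are used: [tau = id]
    produces elements of [Gal(L|E)], and an arbitrary [tau] gives the surjectivity of restriction
    onto [Gal(E|K)]. A single descent lemma serves twice, for the derivation and for the operators
    [hat h - id] with [h] in a subgroup. Points are found without any finiteness of ideals: prime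
    ideals come from Zorn's lemma and are arbitrary sets of polynomials. *)

Record is_ideal (R : comNzRingType) (J : set R) : Prop := IsIdeal {
  ideal0 : J 0;
  idealD : forall x y, J x -> J y -> J (x + y);
  idealM : forall a x, J x -> J (a * x)
}.

Record is_prime_ideal (R : comNzRingType) (P : set R) : Prop := IsPrimeIdeal {
  prime_is_ideal : is_ideal P;
  prime_n1 : ~ P 1;
  primeM : forall x y, P (x * y) -> P x \/ P y
}.

Section Ideals.
Variables (R : comNzRingType) (J : set R).
Hypothesis idJ : is_ideal J.

Lemma ideal_sum (T : Type) (r : seq T) (Q : pred T) (F : T -> R) :
  (forall i, Q i -> J (F i)) -> J (\sum_(i <- r | Q i) F i).
Proof.
by move=> JF; elim/big_ind: _ => //; [exact: ideal0 idJ | exact: idealD idJ].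
Qed.

Lemma idealMr a x : J x -> J (x * a).
Proof. by rewrite mulrC; exact: idealM. Qed.

Lemma idealN x : J x -> J (- x).
Proof. by rewrite -mulN1r; exact: idealM. Qed.

Lemma idealB x y : J x -> J y -> J (x - y).
Proof. by move=> Jx /idealN; exact: idealD. Qed.

Lemma prime_avoiding b :
  (forall k, ~ J (b ^+ k)) ->
  exists P, [/\ is_prime_ideal P, J `<=` P & ~ P b].
Proof.
move=> nJb.
(* Zorn's lemma is applied to the part [A] added to [J], so that the union of the empty chain still
   satisfies [Z]. *)
pose Z (A : set R) := is_ideal (J `|` A) /\ forall k, ~ (J `|` A) (b ^+ k).
have [|A [[idA nA] maxA]] := @Zorn_bigcup R Z.
  move=> F FZ Ftot; have two A B : F A -> F B ->
      exists2 D, F D & A `<=` D /\ B `<=` D.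
    by move=> FA FB; have [AB|BA] := Ftot _ _ FA FB; [exists B|exists A] => //; split.
  split; last first.
    by move=> k [/nJb//|[A FA Ak]]; have [_ /(_ k)] := FZ _ FA; apply; right.
  split; first by left; exact: ideal0 idJ.
    move=> x y [Jx|[A FA Ax]] [Jy|[B FB By]].
    - by left; exact: idealD.
    - have [idB _] := FZ _ FB; have: (J `|` B) (x + y).
        by apply: (idealD idB); [left|right].
      by case=> [|?]; [left|right; exists B].
    - have [idA _] := FZ _ FA; have: (J `|` A) (x + y).
        by apply: (idealD idA); [right|left].
      by case=> [|?]; [left|right; exists A].
    have [D FD [AD BD]] := two _ _ FA FB.
    have [idD _] := FZ _ FD; have: (J `|` D) (x + y).
      by apply: (idealD idD); right; [exact: AD|exact: BD].
    by case=> [|?]; [left|right; exists D].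
  move=> a x [Jx|[A FA Ax]]; first by left; exact: idealM.
  have [idA _] := FZ _ FA; have: (J `|` A) (a * x) by apply: (idealM idA); right.
  by case=> [|?]; [left|right; exists A].
exists (J `|` A); split=> //; last by have := nA 1%N; rewrite expr1.
(* By maximality, adding [x] to the ideal makes it meet the powers of [b]. If neither [x] nor [y]
   belonged to the ideal, the product of the two powers obtained would be congruent to a multiple of
   [x * y]. *)
have grow x : ~ (J `|` A) x -> exists k a, (J `|` A) (b ^+ k - a * x).
  move=> nx; pose B := [set y | exists a, (J `|` A) (y - a * x)].
  have AB : (J `|` A) `<=` B by move=> y Ay; exists 0; rewrite mul0r subr0.
  have JB : J `|` B = B by apply/seteqP; split=> [y [Jy|//]|y]; [apply: AB; left|right].
  have idB : is_ideal B.
    split; first by apply: AB; exact: ideal0 idA.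
      move=> y z [c Ac] [d Ad]; exists (c + d).
      by rewrite mulrDl opprD addrACA; exact: idealD idA _ _ Ac Ad.
    move=> c y [d Ad]; exists (c * d).
    by rewrite -mulrA -mulrBr; exact: idealM.
  have /maxA : A `<` B.
    split; first by move=> y Ay; apply: AB; right.
    move=> BA; apply: nx; right; apply: BA; exists 1.
    by rewrite mul1r subrr; exact: ideal0 idA.
  apply: contra_notP => nk; split; rewrite JB //.
  by move=> k [a Ba]; apply: nk; exists k, a.
split=> //; first by have := nA 0%N; rewrite expr0.
move=> x y Axy; apply/or_asboolP/negPn/negP; rewrite negb_or => /andP[].
move=> /asboolPn/grow[k [c Ac]] /asboolPn/grow[l [d Ad]].
apply: (nA (k + l)%N); rewrite exprD.
have -> : b ^+ k * b ^+ l = (b ^+ k - c * x) * b ^+ l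
    + (c * x) * (b ^+ l - d * y) + c * d * (x * y).
  by rewrite mulrBl mulrBr addrA subrK mulrACA subrK.
apply: (idealD idA); last exact: idealM.
apply: (idealD idA); last exact: idealM.
by rewrite mulrC; exact: idealM.
Qed.

End Ideals.

(** A Nullstellensatz for a [k]-algebra [R], in a form that passes from [R] to polynomials in one
    variable over [R]: the [k]-points of a prime ideal are dense in its zero set, [b] being the
    function not to be killed. *)
Definition has_points (k : fieldType) (R : comNzRingType)
    (iota : {rmorphism k -> R}) : Prop :=
  forall (P : set R) (b : R), is_prime_ideal P -> ~ P b ->
    exists phi : {rmorphism R -> k},
      [/\ cancel iota phi, forall p, P p -> phi p = 0 & phi b != 0].

Section PolyPoints.
Variables (k : fieldType) (R : comNzRingType) (iota : {rmorphism k -> R}).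
Hypothesis k_closed : forall p : {poly k}, size p != 1%N -> exists x, root p x.
Hypothesis R_points : has_points iota.

Lemma nonroot_exists (p : {poly k}) : p != 0 -> exists x, ~~ root p x.
Proof.
(* A root [x] of [p * 'X + 1] satisfies [p.[x] * x = -1], hence is not a root of [p]. *)
move=> p0; have [|x /rootP] := k_closed (p := p * 'X + 1).
  by rewrite -polyC1 size_MXaddC (negPf p0) /= eqSS size_poly_eq0.
rewrite !hornerE => px; exists x; apply/negP => /rootP px0.
by move/eqP: px; rewrite px0 mul0r add0r oner_eq0.
Qed.

Variables (P : set {poly R}).
Hypothesis prP : is_prime_ideal P.
Let idP := prime_is_ideal prP.
Let p0 : set R := [set c | P c%:P].

Let prp0 : is_prime_ideal p0.
Proof.
split; [split|exact: prime_n1 prP|].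
- exact: ideal0 idP.
- by move=> x y; rewrite /p0 /= polyCD; exact: idealD.
- by move=> x y; rewrite /p0 /= polyCM; exact: idealM.
by move=> x y; rewrite /p0 /= polyCM => /(primeM prP).
Qed.

(** This is vanishing over the domain [R / p0]; [trim] computes there a representative of the true
    degree, and the quotient ring itself is never formed. *)
Let P0 (q : {poly R}) := forall i, p0 q`_i.

Let P0P q : P0 q -> P q.
Proof.
move=> qp; rewrite -[q]coefK poly_def; apply: (ideal_sum idP) => i _.
by rewrite -mul_polyC; apply: (idealMr idP); exact: qp.
Qed.

Let trim q : ~ P0 q ->
  exists q', [/\ P0 (q - q'), ~ p0 (lead_coef q') & (size q' <= size q)%N].
Proof.
have [m] := ubnP (size q); elim: m q => // m IH q /ltnSE le_m nq.
have [lq|] := pselect (p0 (lead_coef q)); last first.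
  by exists q; split=> // i; rewrite subrr coef0; exact: ideal0 idP.
have q0 : q != 0.
  by apply: contra_not_neq nq => -> i; rewrite coef0; exact: ideal0 idP.
pose t := lead_coef q *: 'X^((size q).-1).
have Pt : P0 t.
  move=> i; rewrite coefZ; exact: (idealMr (prime_is_ideal prp0)).
have sqt : (size (q - t)%R < size q)%N.
  have sq0 : (0 < size q)%N by rewrite size_poly_gt0.
  rewrite -[X in (_ < X)%N](prednK sq0) ltnS.
  apply/leq_sizeP => j le_j; rewrite coefB coefZ coefXn.
  move: le_j; rewrite leq_eqVlt => /orP[/eqP <-|lt_j].
    by rewrite eqxx mulr1 lead_coefE subrr.
  rewrite gtn_eqF // mulr0 subr0 nth_default //.
  by move: lt_j; rewrite prednK.
have [|nqt|q' [Pq' lq' sq']] := IH (q - t).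
- exact: leq_trans sqt le_m.
- apply: nq => i; rewrite -[q](subrK t) coefD.
  exact: idealD (prime_is_ideal prp0) _ _ (nqt i) (Pt i).
exists q'; split=> //; last exact: leq_trans sq' (ltnW sqt).
move=> i; rewrite -[q](subrK t) addrAC coefD.
exact: idealD (prime_is_ideal prp0) _ _ (Pq' i) (Pt i).
Qed.

Let divide (g h : {poly R}) : g != 0 -> exists r c d,
  [/\ lead_coef g ^+ r *: h = c * g + d & (size d < size g)%N].
Proof.
move=> g0; exists (Pdiv.CommonRing.rscalp h g), (Pdiv.CommonRing.rdivp h g),
  (Pdiv.CommonRing.rmodp h g).
by rewrite Pdiv.ComRing.rdivp_eq; split=> //; rewrite Pdiv.CommonRing.ltn_rmodpN0.
Qed.

Let p0X c r : ~ p0 c -> ~ p0 (c ^+ r).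
Proof.
move=> nc; elim: r => [|r IH]; first exact: prime_n1 prp0.
by rewrite exprS => /(primeM prp0)[].
Qed.

Let map0 (phi : {rmorphism R -> k}) q :
  (forall c, p0 c -> phi c = 0) -> P0 q -> map_poly phi q = 0.
Proof. by move=> phi0 q0; apply/polyP => i; rewrite coef_map coef0 /= phi0. Qed.

(* Unless all of [P] has coefficients in [p0], take [p] in [P], and [d] in [P + (b)] outside
   [P], both of minimal degree with leading coefficient outside [p0].  Pseudo-division shows
   that [d] is a constant; at a point of [p0] where [d] and [lead_coef p] do not vanish,
   every root of [p] is then a zero of [P] but not of [b]. *)
Lemma poly_point b : ~ P b ->
  exists phi : {rmorphism {poly R} -> k},
    [/\ cancel (polyC \o iota) phi, forall p, P p -> phi p = 0 & phi b != 0].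
Proof.
move=> nPb.
have ext (phi : {rmorphism R -> k}) (xi : k) : cancel iota phi ->
    (forall q, P q -> root (map_poly phi q) xi) -> ~~ root (map_poly phi b) xi ->
    exists phi : {rmorphism {poly R} -> k},
    [/\ cancel (polyC \o iota) phi, forall p, P p -> phi p = 0 & phi b != 0].
  move=> iK Pxi bxi.
  exists [the {rmorphism {poly R} -> k} of horner_eval xi \o map_poly phi].
  split=> [c|p /Pxi/rootP//|]; last by move: bxi; rewrite rootE.
  by rewrite /= map_polyC /horner_eval /= hornerC iK.
have idp0 := prime_is_ideal prp0.
have [allP0|/existsNP[q /not_implyP[Pq nq]]] := pselect (forall q, P q -> P0 q).
  have /existsNP[i nbi] : ~ P0 b by move/P0P.
  have [phi [iK phi0 phib]] := R_points prp0 nbi.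
  have /nonroot_exists[xi bxi] : map_poly phi b != 0.
    apply: contraNneq phib => /(congr1 (fun f : {poly k} => f`_i)).
    by rewrite coef_map coef0 => /= ->.
  apply: (ext phi xi) => // f /allP0 /map0 -> //; exact: root0.
pose A m := `[< exists2 p, P p & ~ p0 (lead_coef p) /\ size p = m >].
have exA : exists m, A m.
  have [p [Pp lp _]] := trim nq; exists (size p); apply/asboolP; exists p => //.
  by rewrite -[p](subKr q); apply: (idealB idP) => //; exact: P0P.
case: (ex_minnP exA) => m /asboolP[p Pp [lp sp]] minA.
have small h : P h -> (size h < m)%N -> P0 h.
  move=> Ph sh; apply: contrapT => /trim[h' [Ph' lh' sh']].
  have : A (size h').
    apply/asboolP; exists h' => //.
    by rewrite -[h'](subKr h); apply: (idealB idP) => //; exact: P0P.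
  by move/minA; rewrite leqNgt (leq_ltn_trans sh' sh).
have p_neq0 : p != 0.
  by apply: contra_not_neq lp => ->; rewrite lead_coef0; exact: ideal0 idp0.
have mgt1 : (1 < m)%N.
  rewrite ltnNge; apply/negP => m1; apply: lp.
  have /size1_polyC pE : (size p <= 1)%N by rewrite sp.
  by rewrite pE lead_coefC /p0 /= -pE.
pose B d := exists2 u, P (d - u * b) & ~ P d.
have bB : B b by exists 1 => //; rewrite mul1r subrr; exact: ideal0 idP.
have idB d u : P (d - u * b) -> ~ P0 d -> exists d',
    [/\ P (d' - u * b), ~ p0 (lead_coef d') & (size d' <= size d)%N].
  move=> du /trim[d' [dd' ld' sd']]; exists d'; split=> //.
  have -> : d' - u * b = d - u * b - (d - d') by ring.
  by apply: (idealB idP) => //; exact: P0P.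
pose A' m := `[< exists2 d, B d & ~ p0 (lead_coef d) /\ size d = m >].
have notP d u : P (d - u * b) -> ~ p0 (lead_coef d) -> (size d < m)%N -> ~ P d.
  by move=> _ ld sd /small/(_ sd)/(_ (size d).-1).
have exA' : exists2 m', A' m' & (m' < m)%N.
  have [r [c [d [dE sd]]]] := divide b p_neq0.
  have nPd : ~ P d.
    move=> Pd; have : P (lead_coef p ^+ r *: b).
      by rewrite dE; apply: (idealD idP) => //; exact: idealM.
    rewrite -mul_polyC => /(primeM prP)[|//].
    exact: p0X.
  have du : P (d - (lead_coef p ^+ r)%:P * b).
    rewrite mul_polyC dE opprD addrCA subrr addr0.
    by apply: (idealN idP); exact: idealM.
  have [d' [d'u ld' sd']] := idB d _ du (fun h => nPd (P0P h)).
  have sd'm : (size d' < m)%N by rewrite -sp; exact: leq_ltn_trans sd' sd.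
  exists (size d') => //; apply/asboolP; exists d' => //.
  by exists (lead_coef p ^+ r)%:P => //; exact: (notP _ _ d'u ld').
have exB : exists m', A' m' by have [m' ? _] := exA'; exists m'.
case: (ex_minnP exB) => m' /asboolP[d [u du nPd] [ld sd]] minB.
have m'm : (m' < m)%N by have [l /minB le_l lt_l] := exA'; exact: leq_ltn_trans lt_l.
have d_neq0 : d != 0.
  by apply: contra_not_neq ld => ->; rewrite lead_coef0; exact: ideal0 idp0.
(* Otherwise divide [p] by [d]. The remainder [e] lies in [P] by minimality of [d], hence has
   coefficients in [p0] by minimality of [p]; so the quotient [c] lies in [P] as well. If [c] were
   nonzero modulo [p0], its degree would be at least that of [p], and [c * d] would be too large. So
   [c] vanishes modulo [p0], and with it the leading coefficient of [p]. *)
have sd1 : size d = 1%N.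
  apply/eqP; rewrite eqn_leq lt0n size_poly_eq0 d_neq0 andbT leqNgt; apply/negP => sd_gt1.
  have [r [c [e [eE se]]]] := divide p d_neq0.
  have Pe : P e.
    apply: contrapT => nPe.
    have eu : P (e - (- c * u) * b).
      have -> : e - (- c * u) * b = lead_coef d ^+ r *: p - c * (d - u * b).
        by rewrite eE; ring.
      apply: (idealB idP); last exact: idealM.
      by rewrite -mul_polyC; exact: idealM.
    have [e' [e'u le' se']] := idB e _ eu (fun h => nPe (P0P h)).
    have : (size e' < m')%N by rewrite -sd; exact: leq_ltn_trans se' se.
    move=> lt_e'; have : A' (size e').
      apply/asboolP; exists e' => //; exists (- c * u) => //.
      by apply: (notP _ _ e'u le'); exact: ltn_trans m'm.
    by move/minB; rewrite leqNgt lt_e'.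
  have Pcd : P (c * d).
    have -> : c * d = lead_coef d ^+ r *: p - e by rewrite eE addrK.
    by apply: (idealB idP) => //; rewrite -mul_polyC; exact: idealM.
  have Pc : P c by have [] := primeM prP Pcd.
  have p0e := small _ Pe (ltn_trans se (eq_ind_r (fun z => z < m)%N m'm sd)).
  have p0c : P0 c.
    apply: contrapT => /trim[c' [cc' lc' _]].
    have le_c' : (m <= size c')%N.
      apply: minA; apply/asboolP; exists c' => //.
      by rewrite -[c'](subKr c); apply: (idealB idP) => //; exact: P0P.
    have : p0 ((c' * d)`_(size c' + size d).-2).
      have -> : c' * d = lead_coef d ^+ r *: p - e - (c - c') * d.
        by rewrite eE addrK mulrBl subKr.
      rewrite !coefB coefZ; apply: (idealB idp0); first apply: (idealB idp0).
      - rewrite nth_default ?mulr0; first exact: ideal0 idp0.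
        rewrite sp; apply: leq_trans le_c' _.
        by rewrite -subn2 -addnBA // leq_addr.
      - exact: p0e.
      rewrite coefM; apply: (ideal_sum idp0) => i _.
      exact: (idealMr idp0).
    rewrite -mul_lead_coef.
    by move=> /(primeM prp0)[].
  have top : p0 ((lead_coef d ^+ r *: p)`_(size p).-1).
    rewrite eE coefD; apply: (idealD idp0) => //.
    rewrite coefM; apply: (ideal_sum idp0) => i _.
    exact: (idealMr idp0).
  move: top; rewrite coefZ => /(primeM prp0)[|]; first exact: p0X.
  by rewrite -lead_coefE.
have [delta dE] : exists delta, d = delta%:P.
  by exists d`_0; apply: size1_polyC; rewrite sd1.
have nd : ~ p0 delta by rewrite -[delta]lead_coefC -dE.
have ndp : ~ p0 (delta * lead_coef p) by move=> /(primeM prp0)[].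
have [phi [iK phi0 phid]] := R_points prp0 ndp.
have [phid0 phip0] : phi delta != 0 /\ phi (lead_coef p) != 0.
  by apply/andP; rewrite -negb_or -mulf_eq0 -rmorphM.
have [xi pxi] : exists xi, root (map_poly phi p) xi.
  apply: k_closed; rewrite size_map_poly_id0 // sp.
  by rewrite gtn_eqF.
have Pxi q' : P q' -> root (map_poly phi q') xi.
  move=> Pq'; have [r [c [e [eE se]]]] := divide q' p_neq0.
  have Pe : P e.
    have -> : e = lead_coef p ^+ r *: q' - c * p by rewrite eE addrAC subrr add0r.
    apply: (idealB idP); last exact: idealM.
    by rewrite -mul_polyC; exact: idealM.
  have : root (map_poly phi (lead_coef p ^+ r *: q')) xi.
    rewrite eE rmorphD rmorphM /= (map0 phi0 (small _ Pe _)) ?addr0 -?sp //.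
    by rewrite rootM pxi orbT.
  by rewrite map_polyZ rootZ // rmorphXn expf_neq0.
apply: (ext phi xi) => //; apply/negP => bxi.
have := Pxi _ du; rewrite rmorphB rmorphM /= rootE !hornerE (rootP bxi) mulr0 subr0.
by rewrite dE map_polyC hornerC /= (negPf phid0).
Qed.

End PolyPoints.

Section Nullstellensatz.
Variable k : fieldType.
Hypothesis k_closed : forall p : {poly k}, size p != 1%N -> exists x, root p x.

Lemma muniK n (p : {mpoly k[n.+1]}) :
  (map_poly (@mwiden n k) (muni p)).['X_ord_max] = p.
Proof.
rewrite [RHS]mpolyE muniE rmorph_sum horner_sum; apply: eq_bigr => m _.
rewrite -mul_polyC rmorphM /= map_polyC map_polyXn /= hornerM hornerC hornerXn.
rewrite mwidenZ mwidenX -scalerAl mpolyXn -mpolyXD; congr (_ *: 'X_[_]).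
apply/mnmP => i; rewrite mnmDE mulmnE mnm1E.
have [->|ni] := eqVneq i ord_max.
  by rewrite mnmwiden_ordmax mul1n.
have lt_i : (i < n)%N.
    rewrite ltn_neqAle -ltnS ltn_ord andbT.
    by apply: contra_neq ni => i_n; exact: val_inj.
have -> : i = widen_ord (leqnSn n) (Ordinal lt_i) by exact: val_inj.
by rewrite mnmwiden_widen mnmE addn0.
Qed.

Lemma mpoly_points n : has_points (@mpolyC n k).
Proof.
elim: n => [|n IH] P b prP nPb.
  have const (p : {mpoly k[0]}) : p = (p@_0%MM)%:MP.
    apply/mpolyP => m; have -> : m = 0%MM by apply/mnmP => -[].
    by rewrite mcoeffC eqxx mulr1.
  exists [the {rmorphism {mpoly k[0]} -> k} of meval (fun=> 0)].
  split=> [c|p Pp|] /=; first exact: mevalC.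
    rewrite (const p) mevalC; apply/eqP/negPn/negP => p0; apply: (prime_n1 prP).
    rewrite -(mpolyC1 0) -(mulVf p0) mpolyCM -(const p).
    exact: idealM (prime_is_ideal prP) _ _ Pp.
  rewrite (const b) mevalC; apply: contra_not_neq nPb => b0.
  by rewrite (const b) b0; exact: ideal0 (prime_is_ideal prP).
pose psi := [the {rmorphism {poly {mpoly k[n]}} -> {mpoly k[n.+1]}} of
  horner_eval 'X_ord_max \o map_poly (@mwiden n k)].
have psiK p : psi (muni p) = p by exact: muniK.
pose P' := psi @^-1` P.
have P'E x : P' x = P (psi x) by [].
have prP' : is_prime_ideal P'.
  split; [split|by rewrite !P'E rmorph1; exact: prime_n1 prP|].
  - by rewrite !P'E rmorph0; exact: ideal0 (prime_is_ideal prP).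
  - by move=> x y Px Py; rewrite P'E rmorphD; exact: idealD (prime_is_ideal prP) _ _ Px Py.
  - by move=> a x Px; rewrite P'E rmorphM; exact: idealM (prime_is_ideal prP) _ _ Px.
  by move=> x y; rewrite !P'E rmorphM; exact: primeM prP _ _.
have [|phi [iK phi0 phib]] := poly_point k_closed IH prP' (b := muni b).
  by rewrite !P'E psiK.
exists [the {rmorphism {mpoly k[n.+1]} -> k} of phi \o @muni n k].
split=> [c|p Pp|//] /=; first by rewrite muniC; exact: iK.
by apply: phi0; rewrite !P'E psiK.
Qed.

Theorem nullstellensatz n (P : set {mpoly k[n]}) b :
  is_prime_ideal P -> ~ P b ->
  exists v : 'I_n -> k, (forall p, P p -> p.@[v] = 0) /\ b.@[v] != 0.
Proof.
move=> prP nPb; have [phi [iK phi0 phib]] := mpoly_points prP nPb.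
have phiE p : phi p = p.@[fun i => phi 'X_i].
  rewrite {1}[p]mpolyE rmorph_sum mevalE; apply: eq_bigr => m _.
  rewrite -mul_mpolyC rmorphM /= iK; congr (_ * _).
  by rewrite mpolyXE_id rmorph_prod; apply: eq_bigr => i _; rewrite rmorphXn.
exists (fun i => phi 'X_i); split=> [p Pp|]; last by rewrite -phiE.
by rewrite -phiE phi0.
Qed.

End Nullstellensatz.

(** * Subfields, descent and linear independence *)

Section SubfieldTheory.
Variables (U : diffFieldType) (F : set U).
Hypothesis sfF : is_subfield F.

Lemma subfield0 : F 0.
Proof. by rewrite -(subrr 1); apply: subfieldB (subfield1 sfF) (subfield1 sfF). Qed.

Lemma subfieldN x : F x -> F (- x).
Proof. by move=> Fx; rewrite -sub0r; exact: subfieldB subfield0 Fx. Qed.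

Lemma subfieldD x y : F x -> F y -> F (x + y).
Proof. by move=> Fx Fy; rewrite -[y]opprK; exact: subfieldB (subfieldN Fy). Qed.

Lemma subfield_div x y : F x -> F y -> F (x / y).
Proof. by move=> Fx Fy; apply: subfieldM => //; exact: subfieldV. Qed.

Lemma subfield_sum (T : Type) (r : seq T) (Q : pred T) (f : T -> U) :
  (forall i, Q i -> F (f i)) -> F (\sum_(i <- r | Q i) f i).
Proof. by move=> Ff; elim/big_ind: _ => //; [exact: subfield0 | exact: subfieldD]. Qed.

Lemma subfield_prod (T : Type) (r : seq T) (Q : pred T) (f : T -> U) :
  (forall i, Q i -> F (f i)) -> F (\prod_(i <- r | Q i) f i).
Proof. by move=> Ff; elim/big_ind: _ => //; [exact: subfield1 | exact: subfieldM]. Qed.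

Lemma subfieldX x k : F x -> F (x ^+ k).
Proof.
move=> Fx; elim: k => [|k IH]; first by rewrite expr0; exact: subfield1.
by rewrite exprS; exact: subfieldM.
Qed.

Lemma subfield_nat k : F k%:R.
Proof.
elim: k => [|k IH]; first exact: subfield0.
by rewrite -addn1 natrD; apply: subfieldD => //; exact: subfield1.
Qed.

Definition mxover m n (A : 'M[U]_(m, n)) := forall i j, F (A i j).

Lemma mxover_mul m n p (A : 'M_(m, n)) (B : 'M_(n, p)) :
  mxover A -> mxover B -> mxover (A *m B).
Proof. by move=> FA FB i j; rewrite mxE; apply: subfield_sum => k _; exact: subfieldM. Qed.

Lemma mxover_det m (A : 'M_m) : mxover A -> F (\det A).
Proof.
move=> FA; apply: subfield_sum => s _; apply: (subfieldM sfF).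
  by apply: subfieldX; apply: subfieldN; exact: subfield1 sfF.
by apply: subfield_prod => i _.
Qed.

Lemma mxover_inv m (A : 'M_m) : mxover A -> mxover (invmx A).
Proof.
move=> FA; rewrite /invmx; case: ifP => // _ i j; rewrite !mxE; apply: (subfieldM sfF).
  by apply: (subfieldV sfF); exact: mxover_det.
apply: (subfieldM sfF).
  by apply: subfieldX; apply: subfieldN; exact: subfield1 sfF.
by apply: mxover_det => i' j'; rewrite !mxE.
Qed.

End SubfieldTheory.

(* The subset [F] as a type of its own, so that results on fields apply. *)
Definition sf_pred (U : diffFieldType) (F : set U) (sfF : is_subfield F) : {pred U} :=
  fun x => `[< F x >].

Section SubfieldType.
Variables (U : diffFieldType) (F : set U) (sfF : is_subfield F).

Fact sf_divring_closed : divring_closed (sf_pred sfF).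
Proof.
split=> [|x y /asboolP Fx /asboolP Fy|x y /asboolP Fx /asboolP Fy]; apply/asboolP.
- exact: subfield1.
- exact: subfieldB.
- exact: subfield_div.
Qed.

HB.instance Definition _ :=
  GRing.isDivringClosed.Build U (sf_pred sfF) sf_divring_closed.

Record sf_type := SfType { sf_val : U; sf_valP : sf_val \in sf_pred sfF }.

HB.instance Definition _ := [isSub for sf_val].
HB.instance Definition _ := [Choice of sf_type by <:].
HB.instance Definition _ := [SubChoice_isSubIntegralDomain of sf_type by <:].
HB.instance Definition _ := [SubIntegralDomain_isSubField of sf_type by <:].

Definition sf_field : fieldType := [the fieldType of sf_type].

End SubfieldType.

Section SubfieldTypeTheory.
Variables (U : diffFieldType) (F : set U) (sfF : is_subfield F).

(* Opaque, so that simplification does not unfold the morphism to [val]. *)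
Fact sf_inj_subproof :
  {f : {rmorphism sf_field sfF -> U} | f = val :> (sf_field sfF -> U)}.
Proof. by exists [the {rmorphism sf_field sfF -> U} of val]. Qed.

Definition sf_inj : {rmorphism sf_field sfF -> U} := sval sf_inj_subproof.

Lemma sf_injE x : sf_inj x = val x.
Proof. by rewrite /sf_inj; case: sf_inj_subproof => f /= ->. Qed.

Lemma sf_inj_over x : F (sf_inj x).
Proof. by rewrite sf_injE; exact/asboolP/(valP x). Qed.

Lemma sf_injP x : F x -> exists y, sf_inj y = x.
Proof.
move=> Fx; exists (SfType (introT (asboolP _) Fx : x \in sf_pred sfF)).
by rewrite sf_injE.
Qed.

Lemma mxoverP m n (A : 'M[U]_(m, n)) :
  mxover F A -> exists B, A = map_mx sf_inj B.
Proof.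
move=> FA; have /choice[f fE] : forall ij, exists y, sf_inj y = A ij.1 ij.2.
  by move=> ij; exact/sf_injP.
by exists (\matrix_(i, j) f (i, j)); apply/matrixP => i j; rewrite !mxE fE.
Qed.

Lemma mxover_kernel m n (A : 'M[U]_(m, n)) : mxover F A -> (n < m)%N ->
  exists v : 'rV_m, [/\ mxover F v, v != 0 & v *m A = 0].
Proof.
move=> /mxoverP[B ->] lt_nm.
have : kermx B != 0.
  by rewrite -mxrank_eq0 mxrank_ker -lt0n subn_gt0 (leq_ltn_trans (rank_leq_col B)).
case/rowV0Pn => v /sub_kermxP vB v0.
exists (map_mx sf_inj v); split.
- by move=> i j; rewrite mxE; exact: sf_inj_over.
- by rewrite map_mx_eq0.
- by rewrite -map_mxM vB map_mx0.
Qed.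

End SubfieldTypeTheory.

Lemma count_lt (T : eqType) (p q : pred T) s x :
  subpred p q -> x \in s -> q x -> ~~ p x -> (count p s < count q s)%N.
Proof.
move=> pq; elim: s => // y s IH; rewrite inE => /orP[/eqP <- qx npx|xs qx npx] /=.
  by rewrite qx (negPf npx) add0n add1n ltnS sub_count.
by rewrite -addnS leq_add ?IH //; case: (p y) (pq y) => // ->.
Qed.

Section Descent.
Variables (U : diffFieldType) (F : set U) (sfF : is_subfield F).
(** The operators of [Delta] need not be additive: vanishing at 0 and 1 and preserving [V] is all
    that the support argument asks of them. This covers both a derivation and the difference of an
    automorphism and the identity. [Z] is the property to be propagated from the vectors killed by
    [Delta] to all of [V]. *)
Variables (J : eqType) (Delta : set (U -> U)) (V : set (J -> U)).
Hypothesis Delta01 : forall d, Delta d -> d 0 = 0 /\ d 1 = 0.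
Hypothesis VF : forall v j, V v -> F (v j).
Hypothesis V_lin : forall v w c, V v -> V w -> F c -> V (fun j => v j + c * w j).
Hypothesis V_stable : forall d v, Delta d -> V v -> V (d \o v).

(* A vector of minimal support in [V], scaled so as to have a coordinate equal
   to [1], is killed by every [d]: its image has a smaller support. *)
Lemma descent (Z : set (J -> U)) :
  Z (fun=> 0) ->
  (forall v w c, F c -> Z v -> V w -> (forall d j, Delta d -> d (w j) = 0) ->
     Z (fun j => v j + c * w j)) ->
  forall (s : seq J) v, (forall j, v j != 0 -> j \in s) -> V v -> Z v.
Proof.
move=> Z0 Z_lin s; pose supp (v : J -> U) := count (fun j : J => v j != 0) (undup s).
have suppS (v w : J -> U) : (forall j, w j != 0 -> v j != 0) -> (supp w <= supp v)%N.
  by move=> vw; exact: sub_count.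
have suppP (v w : J -> U) j : (forall j, w j != 0 -> v j != 0) ->
    j \in s -> v j != 0 -> w j = 0 -> (supp w < supp v)%N.
  move=> vw js vj wj; rewrite /supp.
  by apply: (count_lt (x := j) vw); rewrite ?mem_undup // wj eqxx.
have scale (v : J -> U) c : V v -> F c -> V (fun j => c * v j).
  move=> Vv Fc; have V0 : V (fun j => v j + -1 * v j).
    by apply: V_lin => //; apply: subfieldN => //; exact: subfield1.
  rewrite (_ : (fun j => _) = fun j => (v j + -1 * v j) + c * v j); first exact: V_lin.
  by apply: funext => j; rewrite mulN1r subrr add0r.
move=> v; have [m] := ubnP (supp v); elim: m v => // m IH v /ltnSE le_m sv Vv.
have [v0|/existsNP[j0 /eqP vj0]] := pselect (forall j, v j = 0).
  by rewrite (_ : v = fun=> 0) //; exact: funext.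
pose A k := `[< exists2 w, V w & [/\ forall j, w j != 0 -> v j != 0,
  exists j, w j != 0 & supp w = k] >].
have exA : exists k, A k.
  by exists (supp v); apply/asboolP; exists v => //; split=> //; exists j0.
case: (ex_minnP exA) => k /asboolP[w Vw [wv [j1 wj1] <-]] minA.
pose w1 j := (w j1)^-1 * w j.
have w1j1 : w1 j1 = 1 by rewrite /w1 mulVf.
have Vw1 : V w1 by apply: scale => //; apply: subfieldV => //; exact: VF.
have w1w j : w1 j != 0 -> w j != 0.
  by apply: contraNneq => wj; rewrite /w1 wj mulr0.
have w1_fixed d j : Delta d -> d (w1 j) = 0.
  move=> Dd; have [d0 d1] := Delta01 Dd.
  have dw i : d (w1 i) != 0 -> w i != 0.
    by move=> di; apply: w1w; apply: contraNneq di => ->; rewrite d0.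
  apply/eqP; apply: contraT => dwj.
  have : A (supp (d \o w1)).
    apply/asboolP; exists (d \o w1); first exact: V_stable.
    by split=> //; [move=> i /dw /wv | exists j].
  move/minA; rewrite leqNgt (suppP w (d \o w1) j1) //=; last by rewrite w1j1.
  exact/sv/wv.
rewrite (_ : v = fun j => (v j + - v j1 * w1 j) + v j1 * w1 j); last first.
  by apply: funext => j; rewrite mulNr subrK.
have sub j : v j + - v j1 * w1 j != 0 -> v j != 0.
  apply: contraNneq => vj; have [/wv|] := boolP (w j != 0); first by rewrite vj eqxx.
  by rewrite negbK => /eqP wj; rewrite vj /w1 wj !mulr0 addr0.
apply: Z_lin => //; first exact: VF.
apply: IH.
- apply: leq_trans le_m; apply: (suppP _ _ j1) => //; first exact/sv/wv.
    exact: wv.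
  by rewrite w1j1 mulr1 subrr.
- by move=> j /sub /sv.
- by apply: V_lin => //; apply: subfieldN => //; exact: VF.
Qed.

End Descent.

Section Free.
Variable U : diffFieldType.

Definition lfree (F : set U) r (v : 'I_r -> U) : Prop :=
  forall c : 'I_r -> U, (forall i, F (c i)) ->
    \sum_(i < r) c i * v i = 0 -> forall i, c i = 0.

Variables (F : set U) (sfF : is_subfield F).

Lemma lfree_mx r m (v : 'rV[U]_r) (A : 'M_(r, m)) :
  lfree F (v 0) -> mxover F A -> v *m A = 0 -> A = 0.
Proof.
move=> fv FA vA; apply/matrixP => i j; rewrite mxE.
apply: (fv (fun i => A i j)) => //; move/matrixP/(_ 0 j): vA; rewrite !mxE => vA.
by rewrite -[RHS]vA; apply: eq_bigr => l _; rewrite mulrC.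
Qed.

Lemma lfree_mx_inj r m (v : 'rV[U]_r) (A B : 'M_(r, m)) :
  lfree F (v 0) -> mxover F A -> mxover F B -> v *m A = v *m B -> A = B.
Proof.
move=> fv FA FB vAB; apply/eqP; rewrite -subr_eq0; apply/eqP.
apply: (lfree_mx fv); last by rewrite mulmxBr vAB subrr.
by move=> i j; rewrite !mxE; exact: subfieldB.
Qed.

(** Two equal indices would give a relation with coefficients 1 and -1, so [f] is injective. This
    bounds the maximum taken in [extract_basis]. *)
Lemma lfree_le r D (u : 'I_D -> U) (f : 'I_r -> 'I_D) :
  lfree F (u \o f) -> (r <= D)%N.
Proof.
move=> fu; rewrite -[r]card_ord -[D]card_ord; apply: (@leq_card _ _ f) => i j fij.
apply/eqP/negPn/negP => nij.
have := fu (fun k => (k == i)%:R - (k == j)%:R).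
rewrite -/(is_true _) => /(_ _ _ i) H.
suff : (1 : U) = 0 by apply/eqP/oner_neq0.
rewrite -[RHS](H _ _); first by rewrite eqxx (negPf nij) subr0.
  by move=> k; apply: subfieldB => //; exact: subfield_nat.
rewrite (eq_bigr (fun k => (if k == i then u (f k) else 0)
    - (if k == j then u (f k) else 0))); last first.
  by move=> k _; rewrite mulrBl; congr (_ - _); case: eqP; rewrite ?mul1r ?mul0r.
by rewrite sumrB -!big_mkcond !big_pred1_eq /= fij subrr.
Qed.

Lemma extract_basis D (u : 'I_D -> U) :
  exists r (f : 'I_r -> 'I_D) (B : 'M[U]_(r, D)),
    [/\ lfree F (u \o f), mxover F B & forall j, u j = \sum_i B i j * u (f i)].
Proof.
pose A r := `[< exists f : 'I_r -> 'I_D, lfree F (u \o f) >].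
have exA : exists r, A r.
  by exists 0%N; apply/asboolP; exists (ffun0 (card_ord 0)) => c _ _ [].
have ubA r : A r -> (r <= D)%N by move=> /asboolP[f /lfree_le].
case: (ex_maxnP exA ubA) => r /asboolP[f fu] maxr.
suff /choice[b bE] : forall j, exists b : 'I_r -> U,
    (forall i, F (b i)) /\ u j = \sum_i b i * u (f i).
  exists r, f, (\matrix_(i, j) b j i); split=> // [i j|j].
    by rewrite mxE; have [] := bE j.
  by have [_ ->] := bE j; apply: eq_bigr => i _; rewrite mxE.
move=> j; pose g (i : 'I_r.+1) := if unlift ord0 i is Some i' then f i' else j.
have : ~ lfree F (u \o g).
  by move=> fg; have := maxr r.+1; rewrite ltnn => H; apply/notF/H/asboolP; exists g.
move=> /existsNP[c /not_implyP[Fc /not_implyP[]]].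
rewrite big_ord_recl /= {1}/g unlift_none.
under eq_bigr => i _ do rewrite /g liftK.
move=> cu /existsNP[i0 ci0].
have c0 : c ord0 != 0.
  apply: contra_notN ci0 => /eqP c0; move: cu; rewrite c0 mul0r add0r => cu.
  case: (unliftP ord0 i0) => [i ->|-> //].
  by apply: (fu (fun i => c (lift ord0 i))).
exists (fun i => - c (lift ord0 i) / c ord0); split.
  by move=> i; apply: subfield_div => //; exact: subfieldN.
apply: (mulfI c0); rewrite mulr_sumr; move/eqP: cu; rewrite addr_eq0 => /eqP ->.
rewrite -sumrN; apply: eq_bigr => i _.
by rewrite mulrA [c ord0 * _]mulrC divfK // mulNr.
Qed.

End Free.

(** * Derivations and wronskians *)

Section Derivation.
Variable U : diffFieldType.
Implicit Types x y : U.

Lemma der0 : der (0 : U) = 0.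
Proof. by apply: (addrI (der (0 : U))); rewrite -derD addr0 addr0. Qed.

Lemma der1 : der (1 : U) = 0.
Proof. by apply: (addrI (der (1 : U))); rewrite addr0 -{3}(mul1r 1) derM mulr1 mul1r. Qed.

Lemma derN x : der (- x) = - der x.
Proof. by apply: (addrI (der x)); rewrite -derD !subrr der0. Qed.

Lemma derB x y : der (x - y) = der x - der y.
Proof. by rewrite derD derN. Qed.

Lemma der_sum (T : Type) (r : seq T) (Q : pred T) (f : T -> U) :
  der (\sum_(i <- r | Q i) f i) = \sum_(i <- r | Q i) der (f i).
Proof. exact: (big_morph _ derD der0). Qed.

Lemma derV x : der x^-1 = - (der x / x ^+ 2).
Proof.
have [->|x0] := eqVneq x 0; first by rewrite invr0 der0 mul0r oppr0.
apply: (mulfI x0); apply: (addrI (der x * x^-1)).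
rewrite -derM mulfV // der1; field; exact: x0.
Qed.

Lemma natU_neq0 k : (k.+1%:R : U) != 0.
Proof. by move/pcharf0P: (@diff_pchar0 U) => ->. Qed.

Lemma constants_subfield (F : set U) : is_subfield F -> is_subfield (constants F).
Proof.
move=> sfF; split; rewrite /constants /=.
- by split; [exact: subfield1 | exact: der1].
- by move=> x y [Fx x0] [Fy y0]; rewrite derB x0 y0 subrr; split=> //; exact: subfieldB.
- by move=> x y [Fx x0] [Fy y0]; rewrite derM x0 y0 mul0r mulr0 addr0; split=> //; exact: subfieldM.
- by move=> x [Fx x0]; rewrite derV x0 mul0r oppr0; split=> //; exact: subfieldV.
Qed.

Lemma map_mx_derM m n p (A : 'M[U]_(m, n)) (B : 'M_(n, p)) :
  map_mx der (A *m B) = map_mx der A *m B + A *m map_mx der B.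
Proof.
apply/matrixP => i j; rewrite !mxE der_sum -big_split; apply: eq_bigr => k _ /=.
by rewrite !mxE derM.
Qed.

Section Extension.
Variables (F : set U) (dsfF : is_dsubfield F).
Let sfF : is_subfield F := dsfF.1.

Lemma dsubfield_iter i x : F x -> F (iter i der x).
Proof. by move=> Fx; elim: i => //= i; exact: dsfF.2. Qed.

Lemma descent_der (J : eqType) (V : set (J -> U)) :
  (forall v j, V v -> F (v j)) ->
  (forall v w c, V v -> V w -> F c -> V (fun j => v j + c * w j)) ->
  (forall v, V v -> V (der \o v)) ->
  forall Z : set (J -> U), Z (fun=> 0) ->
  (forall v w c, F c -> Z v -> V w -> (forall j, constants F (w j)) ->
     Z (fun j => v j + c * w j)) ->
  forall (s : seq J) v, (forall j, v j != 0 -> j \in s) -> V v -> Z v.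
Proof.
move=> VF Vlin Vder Z Z0 Zlin; apply: (descent (Delta := [set der]) sfF) => //.
- by move=> _ ->; split; [exact: der0 | exact: der1].
- by move=> _ v -> Vv; exact: Vder.
move=> v w c Fc Zv Vw w0; apply: Zlin => // j; split; first exact: VF.
exact: w0.
Qed.

Definition wronskian r (y : 'I_r -> U) : 'M[U]_r := \matrix_(i, j) iter i der (y j).

Lemma wronskian_over r (y : 'I_r -> U) : (forall j, F (y j)) -> mxover F (wronskian y).
Proof. by move=> Fy i j; rewrite mxE; exact: dsubfield_iter. Qed.

(** A relation between the rows is a linear differential equation of some order [k < r] satisfied by
    all [y j]; every row [iter m der (y j)] is then a combination of the first [k] ones (this is
    [S]). Having only [k] conditions to meet, some nonzero vector over [F] is orthogonal to all
    these rows. The space [V] of such vectors is stable under the derivation, so by descent it would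
    contain nonzero constant vectors, against the freeness of [y]. *)
Lemma wronskian_unit r (y : 'I_r -> U) : (forall j, F (y j)) ->
  lfree (constants F) y -> wronskian y \in unitmx.
Proof.
move=> Fy fy; rewrite unitmxE unitfE; apply/det0P => -[a a0 aW].
pose A k := [exists i : 'I_r, (i == k :> nat) && (a 0 i != 0)].
have exA : exists k, A k.
  by case/rV0Pn: a0 => i ai; exists i; apply/existsP; exists i; rewrite eqxx.
have ubA k : A k -> (k <= r)%N by case/existsP => i /andP[/eqP <- _]; exact: ltnW.
case: (ex_maxnP exA ubA) => k /existsP[i0 /andP[/eqP i0k ai0]] maxk.
pose S (f : 'I_r -> U) := exists b : 'I_r -> U,
  (forall i : 'I_r, (k <= i)%N -> b i = 0) /\
  forall j, f j = \sum_i b i * iter i der (y j).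
have S0 : S (fun=> 0).
  by exists (fun=> 0); split=> // j; rewrite big1 // => i _; rewrite mul0r.
have SD f g c : S f -> S g -> S (fun j => f j + c * g j).
  move=> [b [b0 fE]] [d [d0 gE]]; exists (fun i => b i + c * d i); split.
    by move=> i ki; rewrite b0 // d0 // mulr0 addr0.
  move=> j; rewrite fE gE mulr_sumr -big_split; apply: eq_bigr => i _ /=.
  by rewrite mulrDl mulrA.
have S_lt (i : 'I_r) : (i < k)%N -> S (fun j => iter i der (y j)).
  move=> ik; exists (fun i' => (i' == i)%:R); split.
    by move=> i' ki; case: eqP => // ii; rewrite ii leqNgt ik in ki.
  move=> j; rewrite (bigD1 i) //= eqxx mul1r big1 ?addr0 // => i' /negPf ->.
  by rewrite mul0r.
have S_k : S (fun j => iter k der (y j)).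
  exists (fun i => if i == i0 then 0 else - a 0 i / a 0 i0); split.
    move=> i ki; case: eqP => // /eqP ni; have [->|ai] := eqVneq (a 0 i) 0.
      by rewrite oppr0 mul0r.
    have /maxk : A i by apply/existsP; exists i; rewrite eqxx.
    by move=> ik; case/eqP: ni; apply/val_inj/anti_leq; rewrite /= i0k ik ki.
  move=> j; apply: (mulfI ai0); rewrite mulr_sumr (bigD1 i0) //= eqxx mul0r mulr0 add0r.
  under eq_bigr => i /negPf ni do rewrite ni mulrA [a 0 i0 * _]mulrC divfK // mulNr.
  rewrite sumrN; apply/eqP; rewrite -addr_eq0; apply/eqP.
  move/matrixP/(_ 0 j): aW; rewrite !mxE => aW; rewrite -[RHS]aW [RHS](bigD1 i0) //=.
  rewrite mxE i0k; congr (_ + _).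
  by apply: eq_bigr => i _; rewrite mxE.
have lt_kr : (k < r)%N by rewrite -i0k.
have S_all m : S (fun j => iter m der (y j)).
  elim: m => [|m [b [b0 bE]]].
    have [k0|k0] := posnP k; first by move: S_k; rewrite k0.
    by apply: (S_lt (Ordinal (ltn_trans k0 lt_kr))).
  rewrite (_ : (fun j => _) = fun j => \sum_i (der (b i) * iter i der (y j)
      + b i * iter i.+1 der (y j))); last first.
    by apply: funext => j; rewrite /= bE der_sum; apply: eq_bigr => i _; rewrite derM.
  have S_sum (s : seq 'I_r) (g : 'I_r -> 'I_r -> U) : (forall i, S (g i)) ->
      S (fun j => \sum_(i <- s) g i j).
    move=> Sg; elim: s => [|i s IH].
      by rewrite (_ : (fun j => _) = fun=> 0) //; apply: funext => j; rewrite big_nil.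
    rewrite (_ : (fun j => _) = fun j => \sum_(i <- s) g i j + 1 * g i j).
      exact: (SD _ (g i)).
    by apply: funext => j; rewrite big_cons mul1r addrC.
  apply: S_sum => i; have [ki|ik] := leqP k i.
    rewrite (_ : (fun j => _) = fun=> 0) //; apply: funext => j.
    by rewrite b0 // der0 !mul0r addr0.
  apply: (SD (fun j => der (b i) * iter i der (y j)) (fun j => iter i.+1 der (y j)));
    last first.
    move: ik; rewrite leq_eqVlt => /orP[/eqP ik|ik]; first by rewrite ik.
    by apply: (S_lt (Ordinal (ltn_trans ik lt_kr))).
  rewrite (_ : (fun j => _) = fun j => 0 + der (b i) * iter i der (y j)).
    by apply: (SD (fun=> 0) (fun j => iter i der (y j))) => //; exact: S_lt.
  by apply: funext => j; rewrite add0r.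
have [v [Fv v0 vA]] : exists v : 'rV_r, [/\ mxover F v, v != 0 &
    v *m (\matrix_(j < r, i < k) iter i der (y j)) = 0].
  by apply: mxover_kernel => // j i; rewrite mxE; exact: dsubfield_iter.
have vW m : \sum_j v 0 j * iter m der (y j) = 0.
  have [b [b0 bE]] := S_all m; under eq_bigr => j _ do rewrite bE mulr_sumr.
  rewrite exchange_big big1 // => i _ /=; have [ki|ik] := leqP k i.
    by rewrite big1 // => j _; rewrite b0 // mul0r mulr0.
  under eq_bigr => j _ do rewrite mulrCA.
  rewrite -mulr_sumr; move/matrixP/(_ 0 (Ordinal ik)): vA; rewrite !mxE => vA.
  rewrite [X in _ * X](_ : _ = 0) ?mulr0 // -[RHS]vA.
  by apply: eq_bigr => j _; rewrite mxE.
case/eqP: v0; apply/rowP => j; rewrite mxE.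
pose V := [set v : 'I_r -> U | (forall i, F (v i)) /\
   forall m, \sum_i v i * iter m der (y i) = 0].
suff /(_ (v 0)) H : V `<=` [set v : 'I_r -> U | forall i, v i = 0] by apply: H.
move=> w; apply: (@descent_der _ V _ _ _ _ _ _ (enum 'I_r)) => //=.
- by move=> {}w i [].
- move=> w1 w2 c [F1 w10] [F2 w20] Fc; split.
    by move=> i; apply: subfieldD => //; exact: subfieldM.
  move=> m; under eq_bigr => i _ do rewrite mulrDl -mulrA.
  by rewrite big_split /= -mulr_sumr w10 w20 mulr0 addr0.
- move=> w1 [F1 w10]; split; first by move=> i; apply: dsfF.2.
  move=> m; have := congr1 der (w10 m); rewrite der0 der_sum.
  under eq_bigr => i _ do rewrite derM -iterS.
  by rewrite big_split /= [X in _ + X](w10 m.+1) addr0.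
- move=> w1 w2 c Fc w10 [F2 w20] C2 i.
  by rewrite w10 (fy w2 C2 (w20 0%N)) mulr0 addr0.
- by move=> i _; rewrite mem_enum.
Qed.

End Extension.
End Derivation.

Lemma der_horner_const (U : diffFieldType) (p : {poly U}) (x : U) :
  (forall i, der p`_i = 0) -> der p.[x] = p^`().[x] * der x.
Proof.
elim/poly_ind: p => [|p c IH] dp; first by rewrite deriv0 !horner0 der0 mul0r.
have dc : der c = 0 by have := dp 0%N; rewrite coefD coefMX coefC add0r.
have {}IH : der p.[x] = p^`().[x] * der x.
  by apply: IH => i; have := dp i.+1; rewrite coefD coefMX coefC addr0.
rewrite derivMXaddC !hornerE derD dc addr0 derM IH; ring.
Qed.

(** * The algebraic closure of the constants *)

Section AlgClosure.
Variables (U : diffFieldType) (C : set U) (sfC : is_subfield C).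
Local Notation Cb := (alg_closure_in C).

Lemma poly_overP (p : {poly U}) : (forall i, C p`_i) ->
  exists q, p = map_poly (sf_inj sfC) q.
Proof.
move=> Cp; have /choice[f fE] : forall i, exists y, sf_inj sfC y = p`_i.
  by move=> i; exact/sf_injP.
exists (\poly_(i < size p) f i); apply/polyP => i.
rewrite coef_map coef_poly /=; case: ltnP => [_|le_i]; first by rewrite fE.
by rewrite rmorph0 nth_default.
Qed.

Lemma alg_closure_inP x : Cb x <-> integralOver (sf_inj sfC) x.
Proof.
rewrite -integral_algebraic; split.
  move=> [p [p0 Cp px]]; have [q pE] := poly_overP Cp.
  by exists q; rewrite -?pE //; apply: contraNneq p0 => q0; rewrite pE q0 rmorph0.
move=> [q q0 qx]; exists (map_poly (sf_inj sfC) q); rewrite map_poly_eq0; split=> // i.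
by rewrite coef_map; exact: sf_inj_over.
Qed.

Lemma alg_closure_subfield : is_subfield Cb.
Proof.
split.
- exact/alg_closure_inP/integral1.
- by move=> x y /alg_closure_inP ix /alg_closure_inP iy; exact/alg_closure_inP/integral_sub.
- by move=> x y /alg_closure_inP ix /alg_closure_inP iy; exact/alg_closure_inP/integral_mul.
- by move=> x /alg_closure_inP ix; exact/alg_closure_inP/integral_inv.
Qed.

Lemma sub_alg_closure : C `<=` Cb.
Proof.
move=> x Cx; have [y <-] := sf_injP sfC Cx; exact/alg_closure_inP/integral_id.
Qed.

Lemma alg_closure_root (p : {poly U}) x : p != 0 -> (forall i, Cb p`_i) -> root p x -> Cb x.
Proof.
move=> p0 Cp px; apply/alg_closure_inP/(integral_root p0 px)/integral_poly => i.
exact/alg_closure_inP.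
Qed.

Lemma alg_closure_const : (forall x, C x -> der x = 0) -> forall x, Cb x -> der x = 0.
Proof.
move=> dC x [p0 [p0_neq0 Cp0 p0x]].
pose A m := `[< exists2 p : {poly U}, p != 0 & [/\ forall i, C p`_i, root p x & size p = m] >].
have exA : exists m, A m by exists (size p0); apply/asboolP; exists p0.
case: (ex_minnP exA) => m /asboolP[p p_neq0 [Cp px sp]] minA.
have dp : p^`().[x] * der x = 0.
  by rewrite -der_horner_const ?(rootP px) ?der0 // => i; exact/dC/Cp.
move/eqP: dp; rewrite mulf_eq0 => /orP[p'x|/eqP //].
have sp1 : (1 < size p)%N by exact: root_size_gt1 px.
have : A (size p^`()).
  apply/asboolP; exists p^`() => //.
    apply: contraTneq sp1 => p'0; rewrite -leqNgt; apply/leq_sizeP => -[//|i] _.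
    move/polyP/(_ i): p'0; rewrite coef_deriv coef0 -mulr_natr => /eqP.
    by rewrite mulf_eq0 (negPf (natU_neq0 _ _)) orbF => /eqP.
  split=> // i; rewrite coef_deriv -mulr_natr; apply: subfieldM => //.
  exact: subfield_nat.
by move/minA; rewrite -sp leqNgt lt_size_deriv.
Qed.

End AlgClosure.

(** A nonconstant [p] is read as a differential polynomial of order 0, the inequation being [1 <> 0]
    in no variables. *)
Lemma diff_closed_root (U : diffFieldType) (p : {poly U}) :
  diff_closed U -> size p != 1%N -> exists x, root p x.
Proof.
move=> Ucl sp1; have [->|p0] := eqVneq p 0; first by exists 0; exact: root0.
have sp : (1 < size p)%N.
  by rewrite ltn_neqAle eq_sym sp1 lt0n size_poly_eq0.
pose P : {mpoly U[1]} := \sum_(i < size p) p`_i *: 'X_[U_(ord0) *+ i].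
have sp0 : (0 < size p)%N := ltnW sp.
have Pd : P@_(U_(ord0) *+ (size p).-1) = lead_coef p.
  have lt_p : ((size p).-1 < size p)%N by rewrite prednK.
  rewrite /P raddf_sum (bigD1 (Ordinal lt_p)) //= mcoeffZ mcoeffX eqxx mulr1.
  rewrite big1 ?addr0 // => i ni; rewrite mcoeffZ mcoeffX.
  case: eqP => [/mnmP/(_ ord0)|]; last by rewrite mulr0.
  rewrite !mulmnE mnm1E eqxx !mul1n => ip; case/eqP: ni.
  exact: val_inj.
have [|y [yP _]] := Ucl 0%N P 1 _ (oner_neq0 _).
  exists (U_(ord0) *+ (size p).-1)%MM.
    by rewrite mcoeff_msupp Pd lead_coef_eq0.
  by rewrite mulmnE mnm1E (_ : ord0 == ord_max) // mul1n -subn1 subn_gt0.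
exists y; rewrite rootE -[X in _ == X]yP /deval /P raddf_sum horner_coef.
apply/eqP/eq_bigr => i _; rewrite /= mevalZ mevalX big_ord1 /=.
by rewrite mulmnE mnm1E eqxx mul1n.
Qed.

(** * Differential morphisms *)

Lemma alg_closure_closed (U : diffFieldType) (C : set U) (sfC : is_subfield C) :
  diff_closed U ->
  forall p : {poly sf_field (alg_closure_subfield sfC)}, size p != 1%N ->
  exists x, root p x.
Proof.
move=> Ucl p sp1; set iota := sf_inj (alg_closure_subfield sfC).
have [p0|p0] := eqVneq p 0; first by exists 0; rewrite p0 root0.
have [|x px] := diff_closed_root (p := map_poly iota p) Ucl.
  by rewrite size_map_poly.
have Cbx : alg_closure_in C x.
  apply: (alg_closure_root sfC _ _ px); first by rewrite map_poly_eq0.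
  by move=> i; rewrite coef_map; exact: sf_inj_over.
have [y yE] := sf_injP (alg_closure_subfield sfC) Cbx.
by exists y; move: px; rewrite -yE fmorph_root.
Qed.

Section DHomTheory.
Variables (U V : diffFieldType) (F : set U) (f : U -> V).
Hypotheses (dsfF : is_dsubfield F) (df : is_dhom F f).
Let sfF : is_subfield F := dsfF.1.

Lemma dhom1 : f 1 = 1. Proof. by case: df. Qed.

Lemma dhomD x y : F x -> F y -> f (x + y) = f x + f y.
Proof. by case: df => _ + _ _; apply. Qed.

Lemma dhomM x y : F x -> F y -> f (x * y) = f x * f y.
Proof. by case: df => _ _ + _; apply. Qed.

Lemma dhom_der x : F x -> f (der x) = der (f x).
Proof. by case: df => _ _ _; apply. Qed.

Lemma dhom0 : f 0 = 0.
Proof.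
have F0 := subfield0 sfF.
by apply: (addrI (f 0)); rewrite -dhomD // !addr0.
Qed.

Lemma dhomN x : F x -> f (- x) = - f x.
Proof.
move=> Fx; apply: (addrI (f x)); rewrite -dhomD ?subrr ?dhom0 //.
exact: subfieldN.
Qed.

Lemma dhomB x y : F x -> F y -> f (x - y) = f x - f y.
Proof. by move=> Fx Fy; rewrite dhomD ?dhomN //; exact: subfieldN. Qed.

Lemma dhomV x : F x -> f x^-1 = (f x)^-1.
Proof.
move=> Fx; have [->|x0] := eqVneq x 0; first by rewrite invr0 dhom0 invr0.
have fx : f x * f x^-1 = 1 by rewrite -dhomM ?mulfV ?dhom1 //; exact: subfieldV.
have fx0 : f x != 0 by apply: contra_eq_neq fx => ->; rewrite mul0r eq_sym oner_neq0.
by apply: (mulfI fx0); rewrite fx mulfV.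
Qed.

Lemma dhom_eq0 x : F x -> (f x == 0) = (x == 0).
Proof.
move=> Fx; apply/eqP/eqP => [fx|->]; last exact: dhom0.
apply/eqP; apply: contraTT isT => x0.
have : f (x * x^-1) = 0 by rewrite dhomM ?fx ?mul0r //; exact: subfieldV.
by rewrite mulfV // dhom1 => /eqP; rewrite oner_eq0.
Qed.

Lemma dhom_inj x y : F x -> F y -> f x = f y -> x = y.
Proof.
move=> Fx Fy fxy; apply/eqP; rewrite -subr_eq0 -dhom_eq0 ?dhomB ?fxy ?subrr //.
exact: subfieldB.
Qed.

Lemma dhom_sum (T : Type) (r : seq T) (g : T -> U) : (forall i, F (g i)) ->
  f (\sum_(i <- r) g i) = \sum_(i <- r) f (g i).
Proof.
move=> Fg; elim: r => [|i r IH]; first by rewrite !big_nil dhom0.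
by rewrite !big_cons dhomD ?IH //; apply: subfield_sum.
Qed.

Lemma dhom_prod (T : Type) (r : seq T) (g : T -> U) : (forall i, F (g i)) ->
  f (\prod_(i <- r) g i) = \prod_(i <- r) f (g i).
Proof.
move=> Fg; elim: r => [|i r IH]; first by rewrite !big_nil dhom1.
by rewrite !big_cons dhomM ?IH //; apply: subfield_prod.
Qed.

Lemma dhom_iter i x : F x -> f (iter i der x) = iter i der (f x).
Proof.
by move=> Fx; elim: i => //= i <-; rewrite dhom_der //; exact: dsubfield_iter.
Qed.

Lemma dhom_mulmx m n p (A : 'M_(m, n)) (B : 'M_(n, p)) : mxover F A -> mxover F B ->
  map_mx f (A *m B) = map_mx f A *m map_mx f B.
Proof.
move=> FA FB; apply/matrixP => i j; rewrite !mxE dhom_sum.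
  by apply: eq_bigr => k _; rewrite !mxE dhomM.
by move=> k; exact: subfieldM.
Qed.

Lemma dhom_det m (A : 'M_m) : mxover F A -> f (\det A) = \det (map_mx f A).
Proof.
move=> FA; have Fs (b : bool) : F ((-1) ^+ b).
  by apply: subfieldX => //; apply: subfieldN => //; exact: subfield1.
have FP (s : 'I_m -> 'I_m) : F (\prod_i A i (s i)) by apply: subfield_prod.
rewrite /determinant dhom_sum; last by move=> s; exact: subfieldM (Fs _) (FP _).
apply: eq_bigr => s _; rewrite dhomM // dhom_prod //; congr (_ * _).
  case: (perm.odd_perm s); rewrite ?expr0 ?expr1 ?dhom1 // dhomN ?dhom1 //.
  exact: subfield1.
by apply: eq_bigr => i _; rewrite mxE.
Qed.

Lemma dhom_unitmx m (A : 'M_m) : mxover F A -> A \in unitmx ->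
  map_mx f A \in unitmx.
Proof.
move=> FA; rewrite !unitmxE !unitfE -dhom_det // dhom_eq0 //.
exact: mxover_det.
Qed.

Lemma dhom_wronskian r (y : 'I_r -> U) : (forall j, F (y j)) ->
  map_mx f (wronskian y) = wronskian (f \o y).
Proof. by move=> Fy; apply/matrixP => i j; rewrite !mxE dhom_iter. Qed.

Lemma dhom_image_dsubfield : is_dsubfield (f @` F).
Proof.
split; [split|].
- by exists 1; [exact: subfield1|exact: dhom1].
- by move=> _ _ [x Fx <-] [y Fy <-]; exists (x - y); [exact: subfieldB|exact: dhomB].
- by move=> _ _ [x Fx <-] [y Fy <-]; exists (x * y); [exact: subfieldM|exact: dhomM].
- by move=> _ [x Fx <-]; exists x^-1; [exact: subfieldV|exact: dhomV].
- by move=> _ [x Fx <-]; exists (der x); [exact: dsfF.2|exact: dhom_der].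
Qed.

End DHomTheory.

Lemma dhom_sub (U V : diffFieldType) (F G : set U) (f : U -> V) :
  F `<=` G -> is_dhom G f -> is_dhom F f.
Proof.
move=> FG [f1 fD fM fd]; split=> // [x y Fx Fy|x y Fx Fy|x Fx].
- by apply: fD; exact: FG.
- by apply: fM; exact: FG.
- by apply: fd; exact: FG.
Qed.

Lemma restrE (U : diffFieldType) (A : set U) (f : U -> U) x : A x -> restr A f x = f x.
Proof. by move=> Ax; rewrite /restr patchT // inE. Qed.

Lemma restrN (U : diffFieldType) (A : set U) (f : U -> U) x : ~ A x -> restr A f x = 0.
Proof. by move=> nAx; rewrite /restr patchN // notin_setE. Qed.

Lemma eq_restr (U : diffFieldType) (A : set U) (f g : U -> U) :
  (forall x, A x -> f x = g x) -> restr A f = restr A g.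
Proof.
move=> fg; apply: funext => x; have [Ax|nAx] := pselect (A x).
  by rewrite !restrE // fg.
by rewrite !restrN.
Qed.

Lemma dhom_eq (U V : diffFieldType) (F : set U) (f g : U -> V) : is_dsubfield F ->
  (forall x, F x -> f x = g x) -> is_dhom F f -> is_dhom F g.
Proof.
move=> [sfF derF] fg [f1 fD fM fd]; split=> [|x y Fx Fy|x y Fx Fy|x Fx].
- by rewrite -fg //; exact: subfield1.
- by rewrite -!fg ?fD //; exact: subfieldD.
- by rewrite -!fg ?fM //; exact: subfieldM.
- by rewrite -!fg ?fd //; exact: derF.
Qed.

Lemma big_uniq_sub (R : nmodType) (I : eqType) (s t : seq I) (g : I -> R) :
  uniq s -> uniq t -> {subset s <= t} -> (forall i, i \notin s -> g i = 0) ->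
  \sum_(i <- s) g i = \sum_(i <- t) g i.
Proof.
move=> us ut st g0; rewrite [RHS](bigID (mem s)) /= [X in _ + X]big1 ?addr0; last first.
  by move=> i; exact: g0.
rewrite -[RHS]big_filter; apply: perm_big; apply: uniq_perm; rewrite ?filter_uniq // => i.
by rewrite mem_filter; case: (boolP (i \in s)) => //= /st ->.
Qed.

(** * The compositum [bar F] as the tensor product of [F] and [Cb] over [C] *)

Section ScalarExtension.
Variables (U : diffFieldType) (C : set U) (I : eqType) (alpha : I -> U).
Hypotheses (sfC : is_subfield C) (dC : forall x, C x -> der x = 0).
Local Notation Cb := (alg_closure_in C).
Hypothesis alpha_basis : is_basis C Cb alpha.
Let sfCb : is_subfield Cb := alg_closure_subfield sfC.
Let dCb : forall x, Cb x -> der x = 0 := alg_closure_const sfC dC.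
Let CCb : C `<=` Cb := sub_alg_closure sfC.

Section OneField.
Variables (F : set U) (dsfF : is_dsubfield F) (CF : constants F = C).
Let sfF : is_subfield F := dsfF.1.
Let sub_CF : C `<=` F. Proof. by rewrite -CF => x []. Qed.

(** The [alpha i] are constants, so differentiating the coefficients of a relation over [F] gives
    another relation. By descent it is enough to treat relations with constant coefficients, which
    are relations over [C]. *)
Lemma alpha_free (s : seq I) (l : I -> U) : uniq s -> (forall i, F (l i)) ->
  \sum_(i <- s) l i * alpha i = 0 -> forall i, i \in s -> l i = 0.
Proof.
move=> us Fl l0; have [alphaCb _ free] := alpha_basis.
pose V := [set v : I -> U | [/\ forall i, F (v i), forall i, i \notin s -> v i = 0 &
  \sum_(i <- s) v i * alpha i = 0]].
pose l' i := if i \in s then l i else 0.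
have : V l'.
  split=> [i|i /negPf|]; rewrite /l'; first by case: ifP => // _; exact: subfield0.
    by move=> ->.
  by rewrite -[RHS]l0; apply: eq_big_seq => i ->.
suff H : V `<=` [set v | forall i, v i = 0].
  by move=> /H l'0 i si; have := l'0 i; rewrite /l' si.
have VF v i : V v -> F (v i) by case.
move=> v Vv; apply: (@descent_der _ F dsfF _ V _ _ _ _ _ _ s) => //=.
- move=> v1 v2 c [F1 s1 v10] [F2 s2 v20] Fc; split.
  + by move=> i; apply: subfieldD => //; exact: subfieldM.
  + by move=> i si; rewrite s1 // s2 // mulr0 addr0.
  under eq_bigr => i _ do rewrite mulrDl -mulrA.
  by rewrite big_split /= -mulr_sumr v10 v20 mulr0 addr0.
- move=> v1 [F1 s1 v10]; split.
  + by move=> i; exact: dsfF.2.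
  + by move=> i si; rewrite /= s1 ?der0.
  have := congr1 der v10; rewrite der0 der_sum => E; rewrite -[RHS]E.
  by apply: eq_bigr => i _; rewrite derM (dCb (alphaCb i)) mulr0 addr0.
- move=> v1 v2 c Fc v10 [F2 s2 v20] C2 i; rewrite v10.
  have [si|si] := boolP (i \in s); last by rewrite s2 // mulr0 addr0.
  rewrite (free s v2) ?mulr0 ?addr0 // => j; rewrite -CF; exact: C2.
- by move=> i; apply: contraNT => si; case: Vv => _ -> //.
Qed.

Definition alpha_sum (s : seq I) (l : I -> U) := \sum_(i <- s) l i * alpha i.

(** A list of pairs is a tensor written without reference to the basis; sums and products of tensors
    are then operations on lists, and [alpha_expand] alone returns to coordinates. *)
Definition cb_pairs (t : seq (U * U)) := forall p, p \in t -> F p.1 /\ Cb p.2.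

Section Hat.
Variable f : U -> U.
Hypotheses (df : is_dhom F f) (fC : forall c, C c -> f c = c).

(** The same [s] and [l] serve for the tensor and for its image under [f]: this makes [hat]
    computable on any expression as a sum of products. The agreement of [f] with the identity on [C]
    is what allows the coordinates of [p.2] to be moved into [p.1]. *)
Lemma alpha_expand (t : seq (U * U)) : cb_pairs t -> exists s l,
  [/\ uniq s, forall i, F (l i), forall i, i \notin s -> l i = 0,
      \sum_(p <- t) p.1 * p.2 = alpha_sum s l &
      \sum_(p <- t) f p.1 * p.2 = alpha_sum s (f \o l)].
Proof.
have [_ span _] := alpha_basis; have f0 := dhom0 dsfF df.
elim: t => [|[x c] t IH] Ft.
  exists [::], (fun=> 0); rewrite /alpha_sum !big_nil; split=> // i.
  exact: subfield0.
have [s [l [us Fl l0 tE ftE]]] := IH (fun p tp => Ft p (mem_behead (s := (x, c) :: t) tp)).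
have [Fx Cbc] := Ft (x, c) (mem_head _ _).
have [s1 [d [us1 Cd cE]]] := span _ Cbc.
pose d' i := if i \in s1 then d i else 0.
have Cd' i : C (d' i) by rewrite /d'; case: ifP => // _; exact: subfield0.
have d'0 i : i \notin s1 -> d' i = 0 by rewrite /d' => /negPf ->.
have {cE} cE : c = \sum_(i <- s1) d' i * alpha i.
  by rewrite [LHS]cE; apply: eq_big_seq => i si; rewrite /d' si.
pose s2 := undup (s1 ++ s).
have us2 : uniq s2 by exact: undup_uniq.
have cE2 : c = \sum_(i <- s2) d' i * alpha i.
  rewrite [LHS]cE; apply: big_uniq_sub => // i; first by rewrite mem_undup mem_cat => ->.
  by move=> /d'0 ->; rewrite mul0r.
have extend (g : U -> U) : g 0 = 0 -> alpha_sum s (g \o l) = alpha_sum s2 (g \o l).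
  move=> g0; apply: big_uniq_sub => // i; first by rewrite mem_undup mem_cat orbC => ->.
  by move=> /l0 /= ->; rewrite g0 mul0r.
exists s2, (fun i => x * d' i + l i); split=> //.
- by move=> i; apply: subfieldD => //; apply: subfieldM => //; exact: sub_CF.
- move=> i; rewrite mem_undup mem_cat negb_or => /andP[/d'0 -> /l0 ->].
  by rewrite mulr0 addr0.
- rewrite big_cons tE (extend id) // /alpha_sum /= {1}cE2 mulr_sumr -big_split.
  by apply: eq_bigr => i _; rewrite /= mulrDl mulrA.
- rewrite big_cons ftE extend // /alpha_sum /= {1}cE2 mulr_sumr -big_split.
  apply: eq_bigr => i _; have Fd := sub_CF (Cd' i).
  rewrite /= (dhomD df) ?(dhomM df) ?(fC (Cd' i)) ?mulrDl ?mulrA //.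
  exact: (subfieldM sfF).
Qed.

Lemma hat_sum (t : seq (U * U)) : cb_pairs t ->
  hat F alpha f (\sum_(p <- t) p.1 * p.2) = \sum_(p <- t) f p.1 * p.2.
Proof.
move=> Ft; have [s [l [us Fl l0 tE ftE]]] := alpha_expand Ft.
rewrite /hat; apply: xget_subset1; first by exists s, l; rewrite tE ftE.
have f0 := dhom0 dsfF df.
(* The choice made by [hat] has a unique candidate: two expansions of the same element, padded by
   zeros to a common list, have equal coefficients by [alpha_free]. *)
suff uniq_val s' l' : uniq s' -> (forall i, F (l' i)) ->
    \sum_(p <- t) p.1 * p.2 = alpha_sum s' l' ->
    alpha_sum s' (f \o l') = alpha_sum s (f \o l).
  move=> y z [s1 [l1 [us1 Fl1 E1 ->]]] [s2 [l2 [us2 Fl2 E2 ->]]].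
  by rewrite [LHS]uniq_val // [RHS]uniq_val.
move=> us' Fl' tE'; pose m i := if i \in s' then l' i else 0.
have Fm i : F (m i) by rewrite /m; case: ifP => // _; exact: subfield0.
pose s2 := undup (s' ++ s); have us2 : uniq s2 by exact: undup_uniq.
have mE (g : U -> U) : g 0 = 0 -> alpha_sum s' (g \o l') = alpha_sum s2 (g \o m).
  move=> g0; transitivity (alpha_sum s' (g \o m)).
    by apply: eq_big_seq => i si; rewrite /= /m si.
  apply: big_uniq_sub => // i; first by rewrite mem_undup mem_cat => ->.
  by move=> /negPf si; rewrite /= /m si g0 mul0r.
have lE (g : U -> U) : g 0 = 0 -> alpha_sum s (g \o l) = alpha_sum s2 (g \o l).
  move=> g0; apply: big_uniq_sub => // i; first by rewrite mem_undup mem_cat orbC => ->.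
  by move=> /l0 /= ->; rewrite g0 mul0r.
rewrite mE // lE //; apply: eq_big_seq => i si /=; congr (f _ * _).
apply/eqP; rewrite -subr_eq0; apply/eqP.
apply: (alpha_free (s := s2) (l := fun i => m i - l i)) => //.
  by move=> j; exact: subfieldB.
under eq_bigr => j _ do rewrite mulrBl.
by rewrite sumrB -[X in X - _](mE id) // -[X in _ - X](lE id) // -tE -tE' subrr.
Qed.

End Hat.

Local Notation bar := (compositum F Cb).

Let span : set U := [set x | exists t, cb_pairs t /\ x = \sum_(p <- t) p.1 * p.2].

Let span_mul_F x y : span x -> F y -> span (y * x).
Proof.
move=> [t [Ft ->]] Fy; exists [seq (y * p.1, p.2) | p <- t]; split.
  by move=> _ /mapP[p /Ft[Fp Cp] ->] /=; split=> //; exact: (subfieldM sfF).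
by rewrite big_map mulr_sumr; apply: eq_bigr => p _ /=; rewrite mulrA.
Qed.

Let spanF x : F x -> span x.
Proof.
move=> Fx; exists [:: (x, 1)]; split; last by rewrite big_seq1 mulr1.
by move=> _ /[1!inE] /eqP -> /=; split=> //; exact: (subfield1 sfCb).
Qed.

Let spanCb x : Cb x -> span x.
Proof.
move=> Cx; exists [:: (1, x)]; split; last by rewrite big_seq1 mul1r.
by move=> _ /[1!inE] /eqP -> /=; split=> //; exact: (subfield1 sfF).
Qed.

Let spanD x y : span x -> span y -> span (x + y).
Proof.
move=> [t [Ft ->]] [u [Fu ->]]; exists (t ++ u); split; last by rewrite big_cat.
by move=> p; rewrite mem_cat => /orP[/Ft|/Fu].
Qed.

Let spanM x y : span x -> span y -> span (x * y).
Proof.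
move=> [t [Ft ->]] [u [Fu ->]].
exists [seq (p.1 * q.1, p.2 * q.2) | p <- t, q <- u]; split.
  move=> _ /allpairsP[[p q] /= [/Ft[F1 C1] /Fu[F2 C2] ->]] /=.
  by split; [exact: (subfieldM sfF) | exact: (subfieldM sfCb)].
rewrite big_allpairs_dep mulr_suml; apply: eq_bigr => p _; rewrite mulr_sumr.
by apply: eq_bigr => q _ /=; rewrite mulrACA.
Qed.

Let span_integral x : span x -> integralOver (sf_inj sfF) x.
Proof.
move=> [t [Ft ->]]; elim: t Ft => [|[y c] t IH] Ft.
  by rewrite big_nil; exact: integral0.
have [Fy0 [q [q0 Cq qc]]] := Ft _ (mem_head _ _).
have {Fy0} Fy : F y := Fy0.
rewrite big_cons; apply: integral_add; last first.
  by apply: IH => p tp; apply: Ft; rewrite inE tp orbT.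
have iy : integralOver (sf_inj sfF) y.
  by have [z <-] := sf_injP sfF Fy; exact: integral_id.
apply: (integral_mul iy); apply: (integral_root q0 qc); apply/integral_poly => i.
by have [z <-] := sf_injP sfF (sub_CF (Cq i)); exact: integral_id.
Qed.

Let span_horner (q : {poly sf_field sfF}) x :
  span x -> span (map_poly (sf_inj sfF) q).[x].
Proof.
move=> Sx; elim/poly_ind: q => [|q c IH].
  by rewrite rmorph0 horner0; apply: spanF; exact: subfield0.
rewrite rmorphD rmorphM /= map_polyX map_polyC /= !hornerE.
by apply: spanD; [exact: spanM | apply: spanF; exact: sf_inj_over].
Qed.

(** Sums of products already form a field: [x] is algebraic over [F], and from [q(x) * x + c = 0]
    with [c != 0] one gets the inverse of [x] as a polynomial in [x]. When [c = 0], the factor [x]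
    is cancelled and the induction goes on with [q]. *)
Let spanV x : span x -> span x^-1.
Proof.
move=> Sx; have [->|x0] := eqVneq x 0.
  by rewrite invr0; apply: spanF; exact: subfield0.
have /integral_algebraic[q] := span_integral Sx.
elim/poly_ind: q => [|q c IH]; first by rewrite eqxx.
rewrite rmorphD rmorphM /= map_polyX map_polyC rootE !hornerE.
have [->|c0] := eqVneq c 0.
  rewrite polyC0 addr0 raddf0 addr0 => qX.
  rewrite mulf_eq0 (negPf x0) orbF => qx; apply: IH => //.
  by apply: contraNneq qX => ->; rewrite mul0r.
move=> _; rewrite addr_eq0 => /eqP qx.
have nc0 : - sf_inj sfF c != 0 by rewrite oppr_eq0 fmorph_eq0.
have -> : x^-1 = (- sf_inj sfF c)^-1 * (map_poly (sf_inj sfF) q).[x].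
  by apply: (mulIf x0); rewrite mulVf // -mulrA qx mulVf.
apply: span_mul_F; first exact: span_horner.
by apply: (subfieldV sfF); apply: subfieldN => //; exact: sf_inj_over.
Qed.

Let span_subfield : is_subfield span.
Proof.
split; [exact/spanF/(subfield1 sfF)| |exact: spanM|exact: spanV].
move=> x y Sx Sy; apply: spanD => //; rewrite -mulN1r; apply: span_mul_F => //.
exact: (subfieldN sfF (subfield1 sfF)).
Qed.

Lemma barP x : bar x <-> exists t, cb_pairs t /\ x = \sum_(p <- t) p.1 * p.2.
Proof.
split.
  suff : bar `<=` span by apply.
  by apply: smallest_sub => [|y [/spanF|/spanCb]] //; exact: span_subfield.
move=> [t [Ft ->]] A [sfA FCA]; rewrite big_seq; apply: subfield_sum => // p /Ft[Fp Cp].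
by apply: (subfieldM sfA); apply: FCA; [left|right].
Qed.

Lemma sub_bar : F `<=` bar.
Proof. by apply: sub_smallest => x; left. Qed.

Lemma cb_sub_bar : Cb `<=` bar.
Proof. by apply: sub_smallest => x; right. Qed.

Lemma bar_subfield : is_subfield bar.
Proof.
rewrite (_ : bar = span); first exact: span_subfield.
by apply/seteqP; split=> x /barP.
Qed.

Lemma bar_dsubfield : is_dsubfield bar.
Proof.
split; first exact: bar_subfield.
move=> _ /barP[t [Ft ->]]; rewrite der_sum; apply/barP.
exists [seq (der p.1, p.2) | p <- t]; split.
  by move=> _ /mapP[p /Ft[Fp Cp] ->]; split=> //; exact: dsfF.2.
rewrite big_map; apply: eq_big_seq => p /Ft[_ Cp].
by rewrite derM (dCb Cp) mulr0 addr0.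
Qed.

Lemma bar_family (J : finType) (x : J -> U) : (forall j, bar (x j)) -> exists s l,
  [/\ uniq s, forall j i, F (l j i), forall j i, i \notin s -> l j i = 0 &
      forall j, x j = alpha_sum s (l j)].
Proof.
move=> bx; have /choice[sl slE] : forall j, exists sl : seq I * (I -> U),
    [/\ uniq sl.1, forall i, F (sl.2 i), forall i, i \notin sl.1 -> sl.2 i = 0 &
      x j = alpha_sum sl.1 sl.2].
  move=> j; have /barP[t [Ft xE]] := bx j.
  have idF : is_dhom F id by [].
  have [s [l [us Fl l0 tE _]]] := alpha_expand idF (fun _ _ => erefl) Ft.
  by exists (s, l); rewrite xE.
pose s := undup (flatten [seq (sl j).1 | j <- enum J]).
exists s, (fun j => (sl j).2); split=> [|j|j i si|j].
- exact: undup_uniq.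
- by have [_ + _ _] := slE j.
- have [_ _ l0 _] := slE j; apply: l0; apply: contra si => si.
  by rewrite mem_undup; apply/flatten_mapP; exists j; rewrite ?mem_enum.
have [us _ l0 ->] := slE j; apply: big_uniq_sub => //.
- exact: undup_uniq.
- move=> i si; rewrite mem_undup; apply/flatten_mapP; exists j => //.
  by rewrite mem_enum.
- by move=> i /l0 ->; rewrite mul0r.
Qed.

Lemma bar_alpha x : bar x -> exists s l, [/\ uniq s, forall i, F (l i),
  forall i, i \notin s -> l i = 0 & x = alpha_sum s l].
Proof.
move=> bx; have [s [l [us Fl l0 xE]]] := @bar_family unit (fun=> x) (fun=> bx).
by exists s, (l tt); split; [|exact: (Fl tt)|exact: (l0 tt)|exact: (xE tt)].
Qed.

Lemma alpha_sum_bar s l : (forall i, F (l i)) -> bar (alpha_sum s l).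
Proof.
have Calpha i : Cb (alpha i) by have [] := alpha_basis.
move=> Fl; apply: (subfield_sum bar_subfield) => i _.
exact: subfieldM bar_subfield _ _ (sub_bar (Fl i)) (cb_sub_bar (Calpha i)).
Qed.

(** The derivation acts on [alpha]-coordinates one by one, so by [alpha_free] the coordinates of a
    constant are constants of [F], that is, elements of [C]. *)
Lemma constants_bar : constants bar = Cb.
Proof.
have Calpha i : Cb (alpha i) by have [] := alpha_basis.
apply/seteqP; split=> [x [bx dx]|x Cx]; last by split; [exact: cb_sub_bar|exact: dCb].
have [s [l [us Fl l0 xE]]] := bar_alpha bx; rewrite xE.
apply: (subfield_sum sfCb) => i _; apply: (subfieldM sfCb) => //; apply: CCb.
have [si|/l0 ->] := boolP (i \in s); last exact: subfield0.
rewrite -CF; split=> //.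
apply: (alpha_free (s := s) (l := der \o l)) => // [j|]; first exact: dsfF.2.
rewrite -[RHS]dx xE der_sum; apply: eq_bigr => j _.
by rewrite derM (dCb (Calpha j)) mulr0 addr0.
Qed.

Section HatTheory.
Variable f : U -> U.
Hypotheses (df : is_dhom F f) (fC : forall c, C c -> f c = c).
Local Notation hatf := (hat F alpha f).

Lemma hat_alpha_sum s l : (forall i, F (l i)) ->
  hatf (alpha_sum s l) = alpha_sum s (f \o l).
Proof.
have Calpha i : Cb (alpha i) by have [] := alpha_basis.
move=> Fl; have := hat_sum df fC (t := [seq (l i, alpha i) | i <- s]).
rewrite !big_map; apply => _ /mapP[i _ ->]; split; [exact: Fl|exact: Calpha].
Qed.

Lemma hatM_Cb x c : F x -> Cb c -> hatf (x * c) = f x * c.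
Proof.
move=> Fx Cc; have := hat_sum df fC (t := [:: (x, c)]).
by rewrite !big_seq1; apply => _ /[1!inE] /eqP ->.
Qed.

Lemma hatE x : F x -> hatf x = f x.
Proof. by move=> Fx; rewrite -{1}[x]mulr1 hatM_Cb ?mulr1 //; exact: (subfield1 sfCb). Qed.

Lemma hat_Cb c : Cb c -> hatf c = c.
Proof.
move=> Cc; rewrite -{1}[c]mul1r hatM_Cb ?(dhom1 df) ?mul1r //.
exact: (subfield1 sfF).
Qed.

Lemma hat_dhom : is_dhom bar hatf.
Proof.
split.
- by rewrite hatE ?(dhom1 df) //; exact: (subfield1 sfF).
- move=> _ _ /barP[t [Ft ->]] /barP[u [Fu ->]].
  rewrite -big_cat !(hat_sum df fC) ?big_cat // => p.
  by rewrite mem_cat => /orP[/Ft|/Fu].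
- move=> _ _ /barP[t [Ft ->]] /barP[u [Fu ->]].
  have tuE (g : U -> U) : (forall x y, F x -> F y -> g (x * y) = g x * g y) ->
      (\sum_(p <- t) g p.1 * p.2) * (\sum_(p <- u) g p.1 * p.2) =
      \sum_(p <- [seq (p.1 * q.1, p.2 * q.2) | p <- t, q <- u]) g p.1 * p.2.
    move=> gM; rewrite big_allpairs_dep mulr_suml; apply: eq_big_seq => p /Ft[Fp _].
    rewrite mulr_sumr; apply: eq_big_seq => q /Fu[Fq _] /=.
    by rewrite gM // mulrACA.
  have Ftu : cb_pairs [seq (p.1 * q.1, p.2 * q.2) | p <- t, q <- u].
    move=> _ /allpairsP[[p q] /= [/Ft[F1 C1] /Fu[F2 C2] ->]] /=.
    by split; [exact: (subfieldM sfF) | exact: (subfieldM sfCb)].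
  have idM x y : F x -> F y -> id (x * y) = id x * id y by [].
  rewrite [X in hatf X](tuE id idM) (hat_sum df fC Ftu) (hat_sum df fC Ft).
  by rewrite (hat_sum df fC Fu) (tuE f (dhomM df)).
move=> _ /barP[t [Ft ->]].
have dE (g : U -> U) : der (\sum_(p <- t) g p.1 * p.2) = \sum_(p <- t) der (g p.1) * p.2.
  rewrite der_sum; apply: eq_big_seq => p /Ft[_ Cp].
  by rewrite derM (dCb Cp) mulr0 addr0.
rewrite (dE id) (hat_sum df fC) // dE.
have := hat_sum df fC (t := [seq (der p.1, p.2) | p <- t]).
rewrite !big_map => -> /=.
  by apply: eq_big_seq => p /Ft[Fp _]; rewrite (dhom_der df).
by move=> _ /mapP[p /Ft[Fp Cp] ->]; split=> //; exact: dsfF.2.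
Qed.

Lemma hat_unique g : is_dhom bar g -> (forall x, F x -> g x = f x) ->
  (forall c, Cb c -> g c = c) -> forall x, bar x -> g x = hatf x.
Proof.
have Calpha i : Cb (alpha i) by have [] := alpha_basis.
move=> dg gF gC x /bar_alpha[s [l [us Fl l0 ->]]].
rewrite hat_alpha_sum // (dhom_sum bar_dsubfield dg).
  apply: eq_bigr => i _.
  by rewrite (dhomM dg (sub_bar (Fl i)) (cb_sub_bar (Calpha i))) gF // gC.
move=> i; exact: subfieldM bar_subfield _ _ (sub_bar (Fl i)) (cb_sub_bar (Calpha i)).
Qed.

End HatTheory.
End OneField.
End ScalarExtension.

(** * Picard-Vessiot extensions and their Galois groups *)

Section Bar.
Variables (U : diffFieldType) (C : set U) (I : eqType) (alpha : I -> U).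
Hypotheses (sfC : is_subfield C) (dC : forall x, C x -> der x = 0).
Local Notation Cb := (alg_closure_in C).
Local Notation bar F := (compositum F Cb).
Hypothesis alpha_basis : is_basis C Cb alpha.
Variables (F G : set U).
Hypotheses (dsfF : is_dsubfield F) (CF : constants F = C).
Hypotheses (dsfG : is_dsubfield G) (CG : constants G = C) (FG : F `<=` G).

Lemma bar_sub : bar F `<=` bar G.
Proof.
apply: smallest_sub; first exact: (bar_subfield sfC dsfG CG).
move=> x [/FG|]; [exact: sub_bar | exact: cb_sub_bar].
Qed.

(** Linear disjointness of [G] and [bar F] over [F]: expand the coefficients of a relation along
    [alpha], exchange the sums, and apply [alpha_free] over [G] to get a relation over [F] for each
    [alpha i]. *)
Lemma lfree_bar r (v : 'I_r -> U) : (forall i, G (v i)) -> lfree F v -> lfree (bar F) v.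
Proof.
move=> Gv fv c bc c0.
have [s [l [us Fl l0 cE]]] := bar_family sfC alpha_basis dsfF CF bc.
suff lE j i : l j i = 0.
  by move=> j; rewrite cE /alpha_sum big1 // => i _; rewrite lE mul0r.
have [si|/l0 //] := boolP (i \in s).
apply: (fv (fun j => l j i)) => //.
apply: (alpha_free sfC dC alpha_basis dsfG CG (s := s)
  (l := fun i => \sum_j l j i * v j)) => // [k|].
  by apply: (subfield_sum dsfG.1) => k' _; apply: (subfieldM dsfG.1); [exact: FG|].
rewrite -[RHS]c0; under eq_bigr => k _ do rewrite mulr_suml.
rewrite exchange_big; apply: eq_bigr => j' _ /=.
rewrite cE /alpha_sum mulr_suml; apply: eq_bigr => k _.
by rewrite mulrAC.
Qed.

End Bar.

Lemma smallest_subfield (U : diffFieldType) (A : set U) :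
  is_subfield (smallest (@is_subfield U) A).
Proof.
split.
- by move=> B [sfB _]; exact: subfield1.
- by move=> x y Ax Ay B sAB; apply: (subfieldB sAB.1); [exact: Ax | exact: Ay].
- by move=> x y Ax Ay B sAB; apply: (subfieldM sAB.1); [exact: Ax | exact: Ay].
- by move=> x Ax B sAB; apply: (subfieldV sAB.1); exact: Ax.
Qed.

Lemma dgenerated_dsubfield (U : diffFieldType) (A S : set U) :
  is_dsubfield (dgenerated A S).
Proof.
split; [split|].
- by move=> B [[sfB _] _]; exact: subfield1.
- by move=> x y Ax Ay B sAB; apply: (subfieldB sAB.1.1); [exact: Ax | exact: Ay].
- by move=> x y Ax Ay B sAB; apply: (subfieldM sAB.1.1); [exact: Ax | exact: Ay].
- by move=> x Ax B sAB; apply: (subfieldV sAB.1.1); exact: Ax.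
- by move=> x Ax B sAB; apply: sAB.1.2; exact: Ax.
Qed.

Section PVMatrix.
Variables (U : diffFieldType) (K L : set U) (n : nat) (a eta : 'I_n -> U).
Hypotheses (dsfK : is_dsubfield K) (L_PV : PV_for K L a eta).
Local Notation W := (wronskian eta).

Definition companion : 'M[U]_n :=
  \matrix_(i, j) if (i.+1 < n)%N then (j == i.+1 :> nat)%:R else - a j.

Lemma PV_dsubfield : is_dsubfield L.
Proof. by have [_ _ _ -> _] := L_PV; exact: dgenerated_dsubfield. Qed.

Lemma PV_sub : K `<=` L.
Proof. by have [_ _ _ -> _] := L_PV; apply: sub_smallest => x; left. Qed.

Lemma PV_constants : constants L = constants K.
Proof. by have [] := L_PV. Qed.

Lemma PV_eta j : L (eta j).
Proof. by have [_ /(_ j)[]] := L_PV. Qed.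

Lemma PV_wronskian_over : mxover L W.
Proof. by apply: wronskian_over => [|j]; [exact: PV_dsubfield | exact: PV_eta]. Qed.

Lemma PV_wronskian_unit : W \in unitmx.
Proof.
have [_ _ free _ _] := L_PV.
by apply: (wronskian_unit PV_dsubfield) => //; exact: PV_eta.
Qed.

Lemma companion_over : mxover K companion.
Proof.
have [[_ Ka] _ _ _ _] := L_PV.
move=> i j; rewrite mxE; case: ifP => _; first exact: (subfield_nat dsfK.1).
exact: (subfieldN dsfK.1).
Qed.

Lemma der_wronskian (y : 'I_n -> U) :
  (forall j, iter n der (y j) + \sum_(i < n) a i * iter i der (y j) = 0) ->
  map_mx der (wronskian y) = companion *m wronskian y.
Proof.
move=> y_sol; apply/matrixP => i j; rewrite !mxE -iterS.
have [lt_i|ge_i] := ltnP i.+1 n.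
  rewrite (bigD1 (Ordinal lt_i)) //= !mxE lt_i eqxx mul1r big1 ?addr0 // => k nk.
  rewrite mxE lt_i (_ : (k == _ :> nat) = false) ?mul0r //.
  by apply/negbTE; apply: contraNneq nk => ki; apply/eqP/val_inj.
have -> : i.+1 = n by apply/eqP; rewrite eqn_leq ltn_ord.
move/eqP: (y_sol j); rewrite addr_eq0 => /eqP ->; rewrite -sumrN.
by apply: eq_bigr => k _; rewrite !mxE ltnNge ge_i mulNr.
Qed.

Lemma PV_der_wronskian : map_mx der W = companion *m W.
Proof. by apply: der_wronskian => j; have [_ /(_ j)[]] := L_PV. Qed.

(** The subfield generated by [K] and the entries of [W] is closed under the derivation, since
    [W' = companion *m W]. So [L] is generated by them as a mere field, and containments of [L] need
    no check on derivatives. *)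
Lemma PV_sub_subfield (A : set U) : is_subfield A -> K `<=` A -> mxover A W -> L `<=` A.
Proof.
move=> sfA KA WA; pose S := smallest (@is_subfield U) (K `|` [set W ij.1 ij.2 | ij in setT]).
have sfS : is_subfield S by exact: smallest_subfield.
have SA : S `<=` A by apply: smallest_sub => // x [/KA//|[ij _ <-]].
apply: subset_trans SA; have [[n0 _] _ _ -> _] := L_PV.
have KS : K `<=` S by move=> x Kx; apply: sub_gen_smallest; left.
have WS i j : S (W i j) by apply: sub_gen_smallest; right; exists (i, j).
apply: smallest_sub; last first.
  move=> x [/KS//|[j _ <-]]; have := WS (Ordinal n0) j.
  by rewrite mxE.
split=> //; suff : S `<=` S `&` [set x | S (der x)] by move=> H x /H[].
apply: smallest_sub; last first.
  move=> x [Kx|[[i j] _ <-]] /=.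
    by split; [exact: KS | exact: KS (dsfK.2 _ Kx)].
  split=> //; move/matrixP/(_ i j): PV_der_wronskian; rewrite [LHS]mxE => ->.
  by apply: (mxover_mul sfS) => // i' j'; apply: KS; exact: companion_over.
split=> /=.
- by split; [exact: (subfield1 sfS) | rewrite /= der1; exact: (subfield0 sfS)].
- move=> x y [Sx dx] [Sy dy]; split; first exact: (subfieldB sfS).
  by rewrite /= derB; exact: (subfieldB sfS).
- move=> x y [Sx dx] [Sy dy]; split; first exact: (subfieldM sfS).
  by rewrite /= derM; apply: (subfieldD sfS); exact: (subfieldM sfS).
- move=> x [Sx dx]; split; first exact: (subfieldV sfS).
  rewrite /= derV; apply: (subfieldN sfS); apply: (subfield_div sfS) => //.
  exact: (subfieldX sfS).
Qed.

Section Solutions.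
Variables (B D : set U) (f : U -> U).
Hypotheses (dsfB : is_dsubfield B) (CB : constants B = D) (LB : L `<=` B).
Hypotheses (df : is_dhom L f) (fK : forall x, K x -> f x = x) (fB : f @` L `<=` B).

Definition galmx : 'M[U]_n := invmx W *m map_mx f W.

Lemma galmxE : map_mx f W = W *m galmx.
Proof. by rewrite /galmx mulKVmx // PV_wronskian_unit. Qed.

Lemma galmx_unit : galmx \in unitmx.
Proof.
rewrite unitmx_mul unitmx_inv PV_wronskian_unit.
exact: (dhom_unitmx PV_dsubfield df PV_wronskian_over PV_wronskian_unit).
Qed.

(** [W] and its image under [f] satisfy the same system [Y' = companion *m Y]; comparing the two
    derivatives of [W *m galmx] leaves [W *m galmx' = 0]. *)
Lemma galmx_over : mxover D galmx.
Proof.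
have WB : mxover B W by move=> i j; apply: LB; exact: PV_wronskian_over.
have MB : mxover B galmx.
  apply: (mxover_mul dsfB.1); first exact: (mxover_inv dsfB.1).
  by move=> i j; rewrite mxE; apply: fB; exists (W i j) => //; exact: PV_wronskian_over.
suff dM : map_mx der galmx = 0.
  move=> i j; rewrite -CB; split; first exact: MB.
  by move/matrixP/(_ i j): dM; rewrite !mxE.
have E : companion *m W *m galmx = companion *m W *m galmx + W *m map_mx der galmx.
  rewrite -{2}PV_der_wronskian -map_mx_derM -galmxE -mulmxA -galmxE.
  transitivity (map_mx f (companion *m W)).
    rewrite (dhom_mulmx PV_dsubfield df); last exact: PV_wronskian_over.
      by congr (_ *m _); apply/matrixP => i j; rewrite [RHS]mxE fK //; exact: companion_over.
    by move=> i j; apply: PV_sub; exact: companion_over.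
  rewrite -PV_der_wronskian; apply/matrixP => i j; rewrite !mxE (dhom_der df) //.
  by have := PV_wronskian_over i j; rewrite mxE.
rewrite -[LHS](mulKmx PV_wronskian_unit).
by rewrite (_ : W *m _ = 0) ?mulmx0 //; apply: (addrI (companion *m W *m galmx));
  rewrite -E addr0.
Qed.

Lemma galmx_eta j : f (eta j) = \sum_i galmx i j * eta i.
Proof.
have [[n0 _] _ _ _ _] := L_PV.
have := galmxE => /matrixP/(_ (Ordinal n0) j); rewrite !mxE /= => ->.
by apply: eq_bigr => i _; rewrite mxE mulrC.
Qed.

End Solutions.
End PVMatrix.

Lemma dhom_equalizer (U V : diffFieldType) (F : set U) (f g : U -> V) :
  is_dsubfield F -> is_dhom F f -> is_dhom F g ->
  is_dsubfield [set x | F x /\ f x = g x].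
Proof.
move=> dsfF df dg; have sfF := dsfF.1; split; [split|] => /=.
- by split; [exact: (subfield1 sfF) | rewrite (dhom1 df) (dhom1 dg)].
- move=> x y [Fx fx] [Fy fy]; split; first exact: (subfieldB sfF).
  by rewrite (dhomB dsfF df) // (dhomB dsfF dg) // fx fy.
- move=> x y [Fx fx] [Fy fy]; split; first exact: (subfieldM sfF).
  by rewrite (dhomM df) // (dhomM dg) // fx fy.
- move=> x [Fx fx]; split; first exact: (subfieldV sfF).
  by rewrite (dhomV dsfF df) // (dhomV dsfF dg) // fx.
- move=> x [Fx fx]; split; first exact: dsfF.2.
  by rewrite (dhom_der df) // (dhom_der dg) // fx.
Qed.

Lemma dhom_comp (U : diffFieldType) (F G : set U) (f g : U -> U) :
  is_dhom F f -> f @` F `<=` G -> is_dhom G g -> is_dhom F (g \o f).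
Proof.
move=> df fFG dg; have fG x : F x -> G (f x) by move=> Fx; apply: fFG; exists x.
split=> [|x y Fx Fy|x y Fx Fy|x Fx] /=.
- by rewrite (dhom1 df) (dhom1 dg).
- by rewrite (dhomD df) // (dhomD dg) //; exact: fG.
- by rewrite (dhomM df) // (dhomM dg) //; exact: fG.
- by rewrite (dhom_der df) // (dhom_der dg) //; exact: fG.
Qed.

Lemma dhom_restr (U : diffFieldType) (F : set U) (f : U -> U) :
  is_dsubfield F -> is_dhom F f -> is_dhom F (restr F f).
Proof. by move=> dsfF; apply: dhom_eq => // x Fx; rewrite restrE. Qed.

Section GaloisGroup.
Variables (U : diffFieldType) (K L : set U) (I : eqType) (alpha : I -> U).
Variables (n : nat) (a eta : 'I_n -> U).
Hypotheses (dsfK : is_dsubfield K) (L_PV : PV_for K L a eta).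
Local Notation C := (constants K).
Local Notation Cb := (alg_closure_in C).
Local Notation bar F := (compositum F Cb).
Local Notation W := (wronskian eta).
Hypothesis alpha_basis : is_basis C Cb alpha.
Local Notation G := (DGal Cb alpha L K).
Local Notation hat := (hat L alpha).

Lemma PV_sfC : is_subfield C. Proof. exact: constants_subfield dsfK.1. Qed.
Lemma PV_dC x : C x -> der x = 0. Proof. by case. Qed.
Let sfC := PV_sfC.
Let dC := PV_dC.
Let sfCb : is_subfield Cb := alg_closure_subfield sfC.
Let dsfL : is_dsubfield L := PV_dsubfield L_PV.
Let CL : constants L = C := PV_constants L_PV.
Let KL : K `<=` L := PV_sub L_PV.

Lemma dsf_bar : is_dsubfield (bar L).
Proof. exact: (bar_dsubfield sfC dC dsfL CL). Qed.

Lemma inter_constants E : K `<=` E -> E `<=` L -> constants E = C.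
Proof.
move=> KE EL; apply/seteqP; split=> x [Ex dx]; last by split=> //; exact: KE.
by rewrite -CL; split=> //; exact: EL.
Qed.

Lemma dgal_dhom s : carrier G s -> is_dhom L s.
Proof. by case. Qed.

Lemma dgal_bar s x : carrier G s -> L x -> bar L (s x).
Proof. by case=> _ + _ _ Lx; apply; exists x. Qed.

Lemma dgal_fixK s x : carrier G s -> K x -> s x = x.
Proof. by case=> _ _ + _; apply. Qed.

Let dgal_fixC s : carrier G s -> forall x, C x -> s x = x.
Proof. by move=> Gs x [Kx _]; exact: dgal_fixK. Qed.

Lemma dgal_eq s t : carrier G s -> carrier G t -> (forall x, L x -> s x = t x) -> s = t.
Proof. by move=> [_ _ _ sE] [_ _ _ tE] st; rewrite sE tE; exact: eq_restr. Qed.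

Lemma dgal_hat s : carrier G s -> is_dhom (bar L) (hat s).
Proof.
by move=> Gs; exact: (hat_dhom sfC dC alpha_basis dsfL CL (dgal_dhom Gs) (dgal_fixC Gs)).
Qed.

Lemma dgal_hatE s x : carrier G s -> L x -> hat s x = s x.
Proof.
by move=> Gs; exact: (hatE sfC dC alpha_basis dsfL CL (dgal_dhom Gs) (dgal_fixC Gs)).
Qed.

Lemma dgal_hat_Cb s x : carrier G s -> Cb x -> hat s x = x.
Proof.
by move=> Gs; exact: (hat_Cb sfC dC alpha_basis dsfL CL (dgal_dhom Gs) (dgal_fixC Gs)).
Qed.

Lemma dgal_hat_alpha s t l : carrier G s -> (forall i, L (l i)) ->
  hat s (alpha_sum alpha t l) = alpha_sum alpha t (s \o l).
Proof.
by move=> Gs; exact: (hat_alpha_sum sfC dC alpha_basis dsfL CL (dgal_dhom Gs) (dgal_fixC Gs)).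
Qed.

Lemma dgal_hat_unique s g : carrier G s -> is_dhom (bar L) g ->
  (forall x, L x -> g x = s x) -> (forall c, Cb c -> g c = c) ->
  forall x, bar L x -> g x = hat s x.
Proof.
move=> Gs; exact: (hat_unique sfC dC alpha_basis dsfL CL (dgal_dhom Gs) (dgal_fixC Gs)).
Qed.

Lemma dgal_hat_bar s : carrier G s -> hat s @` bar L `<=` bar L.
Proof.
move=> Gs _ [x bx <-].
have [t [l [_ Ll _ ->]]] := bar_alpha sfC alpha_basis dsfL CL bx.
rewrite dgal_hat_alpha // /alpha_sum; apply: (subfield_sum dsf_bar.1) => i _.
apply: (subfieldM dsf_bar.1); first exact: dgal_bar.
by apply: cb_sub_bar; have [] := alpha_basis.
Qed.

Lemma dgal_mx s : carrier G s ->
  [/\ GL_over Cb (galmx eta s), map_mx s W = W *m galmx eta s &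
      forall j, s (eta j) = \sum_i galmx eta s i j * eta i].
Proof.
move=> Gs; have [ds sb sK _] := Gs; have LB : L `<=` bar L by exact: sub_bar.
split.
- split; first exact: (galmx_unit L_PV ds).
  exact: (galmx_over dsfK L_PV dsf_bar
    (constants_bar sfC dC alpha_basis dsfL CL) LB ds sK sb).
- exact: (galmxE L_PV s).
- exact: (galmx_eta L_PV s).
Qed.

Lemma dgal_mx_eq s t : carrier G s -> carrier G t ->
  (forall j, s (eta j) = t (eta j)) -> s = t.
Proof.
move=> Gs Gt st; apply: dgal_eq => // x.
suff : L `<=` [set x | L x /\ s x = t x] by move=> H /H[].
have [_ _ _ LE _] := L_PV; rewrite [X in X `<=` _]LE; apply: smallest_sub.
  exact: dhom_equalizer dsfL (dgal_dhom Gs) (dgal_dhom Gt).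
move=> y [Ky|[j _ <-]]; first by split; [exact: KL | rewrite !(dgal_fixK _ Ky)].
by split; [exact: (PV_eta L_PV) | exact: st].
Qed.

(** The image of [hat s] is a field containing [K] and [Cb]. It also contains [W], which is the
    image of [W] times the inverse of a matrix over [Cb], hence it contains [L]. *)
Lemma dgal_hat_surj s y : carrier G s -> bar L y -> exists2 x, bar L x & hat s x = y.
Proof.
move=> Gs; suff H : bar L `<=` hat s @` bar L by move=> /H[x bx <-]; exists x.
have [[Mu Mo] sW _] := dgal_mx Gs; set M := galmx eta s in Mu Mo sW.
have dI : is_dsubfield (hat s @` bar L) by exact: (dhom_image_dsubfield dsf_bar (dgal_hat Gs)).
have CbI : Cb `<=` hat s @` bar L.
  by move=> c Cc; exists c; [exact: cb_sub_bar Cc | exact: (dgal_hat_Cb Gs)].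
apply: smallest_sub; first exact: dI.1.
move=> x [|/CbI//]; move: x; apply: (PV_sub_subfield dsfK L_PV dI.1).
  move=> x Kx; exists x; first exact: sub_bar (KL Kx).
  by rewrite dgal_hatE ?dgal_fixK //; exact: KL.
have -> : W = map_mx (hat s) W *m invmx M.
  rewrite -[LHS](mulmxK Mu); congr (_ *m _); rewrite -sW.
  apply/matrixP => i j; rewrite [LHS]mxE [RHS]mxE dgal_hatE //.
  exact: (PV_wronskian_over L_PV).
apply: (mxover_mul dI.1); last first.
  by move=> i j; apply: CbI; exact: (mxover_inv sfCb).
move=> i j; rewrite mxE; exists (W i j) => //.
exact: sub_bar (PV_wronskian_over L_PV i j).
Qed.

Lemma gmulE s t x : carrier G s -> carrier G t -> L x ->
  gmul G s t x = hat s (t x).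
Proof. by move=> Gs Gt Lx; rewrite /= restrE //= (dgal_hatE Gt Lx). Qed.

Section Subgroup.
Variables (E : set U) (KE : K `<=` E) (EL : E `<=` L).
Local Notation N := (carrier (DGal Cb alpha L E)).

Lemma dgal_sub : N `<=` carrier G.
Proof. by move=> s [ds sb sE sr]; split=> // x /KE /sE. Qed.

Lemma dgal_one : N (gone G).
Proof.
split.
- exact: (dhom_restr dsfL).
- by move=> _ [x Lx <-]; rewrite /= restrE //; exact: sub_bar Lx.
- by move=> x /EL Lx; rewrite /= restrE.
- by rewrite /=; apply: eq_restr => x Lx; rewrite restrE.
Qed.

Lemma dgal_mul s t : N s -> N t -> N (gmul G s t).
Proof.
move=> Ns Nt; have Gs := dgal_sub Ns; have Gt := dgal_sub Nt; split.
- apply: (dhom_restr dsfL); apply: (dhom_comp (G := bar L)).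
  + by apply: dhom_sub (dgal_hat Gt); exact: sub_bar.
  + by move=> _ [x Lx <-]; rewrite dgal_hatE //; exact: dgal_bar.
  + exact: dgal_hat.
- move=> _ [x Lx <-]; rewrite gmulE //; apply: (dgal_hat_bar Gs).
  by exists (t x) => //; exact: dgal_bar.
- move=> x Ex; have Lx := EL Ex; rewrite gmulE //.
  have [_ _ -> // _] := Nt; rewrite dgal_hatE //.
  by have [_ _ -> // _] := Ns.
- by apply: eq_restr => x Lx; rewrite /= restrE.
Qed.

(** An extension to [bar L] fixing [Cb] is unique. The associativity of [gmul] rests on this. *)
Lemma dgal_hat_mul s t x : carrier G s -> carrier G t -> bar L x ->
  hat (gmul G s t) x = hat s (hat t x).
Proof.
move=> Gs Gt bx; apply/esym.
have Gst : carrier G (gmul G s t).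
  split.
  - apply: (dhom_restr dsfL); apply: (dhom_comp (G := bar L)).
    + by apply: dhom_sub (dgal_hat Gt); exact: sub_bar.
    + by move=> _ [y Ly <-]; rewrite dgal_hatE //; exact: dgal_bar.
    + exact: dgal_hat.
  - move=> _ [y Ly <-]; rewrite gmulE //; apply: (dgal_hat_bar Gs).
    by exists (t y) => //; exact: dgal_bar.
  - move=> y Ky; have Ly := KL Ky; rewrite gmulE //.
    by rewrite (dgal_fixK Gt Ky) dgal_hatE // (dgal_fixK Gs Ky).
  - by apply: eq_restr => y Ly; rewrite /= restrE.
apply: (dgal_hat_unique (g := hat s \o hat t) Gst) => //.
- exact: (dhom_comp (dgal_hat Gt) (dgal_hat_bar Gt) (dgal_hat Gs)).
- by move=> y Ly; rewrite gmulE //= (dgal_hatE Gt Ly).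
- by move=> c Cc /=; rewrite !dgal_hat_Cb.
Qed.

(** [hat s] is a bijection of [bar L], whose inverse is chosen pointwise and then restricted to [L].
    The last two clauses keep the inverse on all of [bar L], since morphisms of [L] take their
    values there. *)
Lemma dgal_inv s : N s -> exists t,
  [/\ N t, gmul G s t = gone G, gmul G t s = gone G,
      forall x, bar L x -> hat s (hat t x) = x &
      forall x, bar L x -> hat t (hat s x) = x].
Proof.
move=> Ns; have Gs := dgal_sub Ns; have dhs := dgal_hat Gs.
have inj x y : bar L x -> bar L y -> hat s x = hat s y -> x = y.
  exact: (dhom_inj dsf_bar dhs).
have /choice[g gE] : forall y, exists x, bar L y -> bar L x /\ hat s x = y.
  move=> y; have [/(dgal_hat_surj Gs)[x bx <-]|nb] := pselect (bar L y); first by exists x.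
  by exists 0.
have gb y : bar L y -> bar L (g y) by move=> /gE[].
have sg y : bar L y -> hat s (g y) = y by move=> /gE[].
have gs x : bar L x -> g (hat s x) = x.
  move=> bx; have bsx : bar L (hat s x) by apply: (dgal_hat_bar Gs); exists x.
  by apply: inj; rewrite ?sg //; exact: gb.
have dg : is_dhom (bar L) g.
  have b1 := subfield1 dsf_bar.1; split.
  - by rewrite -{1}(dhom1 dhs) gs.
  - move=> x y bx hy; have gxb := gb _ bx; have gyb := gb _ hy.
    rewrite -{1}(sg x) // -{1}(sg y) // -(dhomD dhs) // gs //.
    exact: (subfieldD dsf_bar.1).
  - move=> x y bx hy; have gxb := gb _ bx; have gyb := gb _ hy.
    rewrite -{1}(sg x) // -{1}(sg y) // -(dhomM dhs) // gs //.
    exact: (subfieldM dsf_bar.1).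
  - move=> x bx; have gxb := gb _ bx.
    rewrite -{1}(sg x) // -(dhom_der dhs) // gs //.
    exact: dsf_bar.2.
have gE' x : E x -> g x = x.
  move=> Ex; have bx : bar L x by exact: sub_bar (EL Ex).
  have [_ _ sE _] := Ns.
  by rewrite -[RHS](gs x) // (dgal_hatE Gs (EL Ex)) sE.
have Nt : N (restr L g).
  split.
  - by apply: (dhom_restr dsfL); apply: dhom_sub dg; exact: sub_bar.
  - by move=> _ [x Lx <-]; rewrite restrE //; apply: gb; exact: sub_bar Lx.
  - by move=> x Ex; rewrite restrE ?gE' //; exact: EL.
  - by apply: eq_restr => x Lx; rewrite restrE.
have Gt := dgal_sub Nt.
have hatt x : bar L x -> hat (restr L g) x = g x.
  move=> bx; apply/esym; apply: (dgal_hat_unique Gt dg) => //.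
    by move=> y Ly; rewrite restrE.
  move=> c Cc; have bc : bar L c by exact: cb_sub_bar Cc.
  by rewrite -{1}(dgal_hat_Cb Gs Cc) gs.
exists (restr L g); split=> //.
- apply: eq_restr => x Lx /=; have bx : bar L x by exact: sub_bar Lx.
  by rewrite hatt // sg.
- apply: eq_restr => x Lx /=; have bx : bar L x by exact: sub_bar Lx.
  by rewrite hatt ?gs //; apply: (dgal_hat_bar Gs); exists x.
- by move=> x bx; rewrite hatt // sg.
- by move=> x bx; rewrite hatt ?gs //; apply: (dgal_hat_bar Gs); exists x.
Qed.

Lemma dgal_subgroup : is_subgroup G N.
Proof.
split; [exact: dgal_sub|exact: dgal_one|exact: dgal_mul|].
by move=> s /dgal_inv[t [Nt st ts _ _]]; exists t.
Qed.

End Subgroup.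
End GaloisGroup.

(** * Extension of morphisms *)

HB.instance Definition _ (U : diffFieldType) :=
  GRing.isZmodMorphism.Build U U (@der U) (@derB U).

Lemma mpoly_rmorph_ext (A : nzRingType) (T : comNzRingType) N
    (f g : {rmorphism {mpoly A[N]} -> T}) :
  (forall c, f c%:MP = g c%:MP) -> (forall i, f 'X_i = g 'X_i) -> f =1 g.
Proof.
move=> fgC fgX p; rewrite [p]mpolyE !rmorph_sum; apply: eq_bigr => m _.
rewrite -mul_mpolyC !rmorphM fgC; congr (_ * _).
rewrite mpolyXE_id !rmorph_prod; apply: eq_bigr => i _.
by rewrite !rmorphXn fgX.
Qed.

Lemma mpoly_gen_ind (A : comNzRingType) N (P : {mpoly A[N]} -> Prop) :
  (forall c, P c%:MP) -> (forall i, P 'X_i) ->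
  (forall p q, P p -> P q -> P (p + q)) -> (forall p q, P p -> P q -> P (p * q)) ->
  forall p, P p.
Proof.
move=> PC PX PD PM p; rewrite [p]mpolyE.
apply: (big_ind P); [by rewrite -(mpolyC0 N); exact: PC | exact: PD |].
move=> m _; rewrite -mul_mpolyC; apply: (PM _ _ (PC _)); rewrite mpolyXE_id.
apply: (big_ind P); [by rewrite -(mpolyC1 N); exact: PC | exact: PM |].
move=> i _; elim: (m i) => [|k IH]; first by rewrite expr0 -(mpolyC1 N); exact: PC.
by rewrite exprS; exact: PM.
Qed.

Section CoefDerivation.
Variables (U : diffFieldType) (N : nat).
Implicit Types p q : {mpoly U[N]}.

(** The variables have derivative 0, in accordance with their role as entries of a constant matrix;
    see [der_meval]. *)
Definition coefder : {mpoly U[N]} -> {mpoly U[N]} := map_mpoly (@der U).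

Lemma mcoeff_coefder p m : (coefder p)@_m = der p@_m.
Proof. by rewrite /coefder mcoeff_map_mpoly. Qed.

Lemma coefderD p q : coefder (p + q) = coefder p + coefder q.
Proof. by apply/mpolyP => m; rewrite mcoeffD !mcoeff_coefder mcoeffD derD. Qed.

Lemma coefderC c : coefder c%:MP = (der c)%:MP.
Proof. by rewrite /coefder map_mpolyC. Qed.

Lemma coefderX i : coefder 'X_i = 0.
Proof.
apply/mpolyP => m; rewrite mcoeff_coefder mcoeffX mcoeff0.
by case: (_ == _); rewrite ?der1 ?der0.
Qed.

Lemma coefderM p q : coefder (p * q) = coefder p * q + p * coefder q.
Proof.
apply/mpolyP => m; rewrite mcoeffD !mcoeff_coefder !mcoeffM der_sum -big_split.
by apply: eq_bigr => k _; rewrite /= derM !mcoeff_coefder.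
Qed.

Lemma coefderZ c p : coefder (c *: p) = der c *: p + c *: coefder p.
Proof. by rewrite -!mul_mpolyC coefderM coefderC. Qed.

Lemma coefder_sum (T : Type) (r : seq T) (f : T -> {mpoly U[N]}) :
  coefder (\sum_(i <- r) f i) = \sum_(i <- r) coefder (f i).
Proof. by apply: (big_morph coefder coefderD); rewrite -(mpolyC0 N) coefderC der0. Qed.

Lemma der_meval p (v : 'I_N -> U) : (forall i, der (v i) = 0) ->
  der p.@[v] = (coefder p).@[v].
Proof.
move=> dv; elim/mpoly_gen_ind: p => [c|i|p q IHp IHq|p q IHp IHq].
- by rewrite coefderC !mevalC.
- by rewrite coefderX mevalXU meval0 dv.
- by rewrite coefderD !mevalD derD IHp IHq.
- by rewrite coefderM mevalD !mevalM derM IHp IHq.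
Qed.

Definition mpolyover (F : set U) p := forall m, F p@_m.

Variables (F : set U) (sfF : is_subfield F).

Lemma mpolyoverC c : F c -> mpolyover F c%:MP.
Proof.
move=> Fc m; rewrite mcoeffC; apply: (subfieldM sfF) => //.
exact: (subfield_nat sfF).
Qed.

Lemma mpolyoverX i : mpolyover F 'X_i.
Proof. by move=> m; rewrite mcoeffX; exact: (subfield_nat sfF). Qed.

Lemma mpolyoverD p q : mpolyover F p -> mpolyover F q -> mpolyover F (p + q).
Proof. by move=> Fp Fq m; rewrite mcoeffD; exact: (subfieldD sfF). Qed.

Lemma mpolyoverM p q : mpolyover F p -> mpolyover F q -> mpolyover F (p * q).
Proof.
move=> Fp Fq m; rewrite mcoeffM; apply: (subfield_sum sfF) => k _.
exact: (subfieldM sfF).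
Qed.

Lemma mpolyoverZ c p : F c -> mpolyover F p -> mpolyover F (c *: p).
Proof. by move=> Fc Fp m; rewrite mcoeffZ; exact: (subfieldM sfF). Qed.

Lemma mpolyover_sum (T : Type) (r : seq T) (Q : pred T) (f : T -> {mpoly U[N]}) :
  (forall i, Q i -> mpolyover F (f i)) -> mpolyover F (\sum_(i <- r | Q i) f i).
Proof.
move=> Ff; apply: (big_ind (mpolyover F)) => //; last exact: mpolyoverD.
by move=> m; rewrite mcoeff0; exact: (subfield0 sfF).
Qed.

Lemma mpolyover_eval p (v : 'I_N -> U) : mpolyover F p -> (forall i, F (v i)) -> F p.@[v].
Proof.
move=> Fp Fv; rewrite mevalE; apply: (subfield_sum sfF) => m _.
apply: (subfieldM sfF) => //; apply: (subfield_prod sfF) => i _.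
exact: (subfieldX sfF).
Qed.

Lemma mpolyoverP p : mpolyover F p ->
  exists r : {mpoly (sf_field sfF)[N]}, p = map_mpoly (sf_inj sfF) r.
Proof.
move=> Fp; have /choice[f fE] : forall m, exists y, sf_inj sfF y = p@_m.
  by move=> m; exact/sf_injP.
exists (\sum_(m <- msupp p) f m *: 'X_[m]).
rewrite [LHS]mpolyE raddf_sum; apply: eq_bigr => m _.
by rewrite /= map_mpolyZ map_mpolyX fE.
Qed.

End CoefDerivation.

Lemma dhom_rmorphism (U V : diffFieldType) (F : set U) (dsfF : is_dsubfield F)
    (f : U -> V) : is_dhom F f ->
  exists g : {rmorphism sf_field dsfF.1 -> V}, forall x, g x = f (sf_inj dsfF.1 x).
Proof.
move=> df; pose g (x : sf_field dsfF.1) := f (sf_inj dsfF.1 x).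
have Fi x : F (sf_inj dsfF.1 x) by exact: sf_inj_over.
have gB : zmod_morphism g by move=> x y; rewrite /g rmorphB (dhomB dsfF df).
have gM : monoid_morphism g.
  by split=> [|x y]; rewrite /g ?rmorph1 ?(dhom1 df) // rmorphM (dhomM df).
pose gBm := GRing.isZmodMorphism.Build _ _ g gB.
pose gMm := GRing.isMonoidMorphism.Build _ _ g gM.
pose gR : {rmorphism sf_field dsfF.1 -> V} := HB.pack g gBm gMm.
by exists gR.
Qed.

Section Core.
Variables (U : diffFieldType) (K L : set U) (I : eqType) (alpha : I -> U).
Variables (n : nat) (a eta : 'I_n -> U).
Hypotheses (dsfK : is_dsubfield K) (L_PV : PV_for K L a eta).
Local Notation C := (constants K).
Local Notation Cb := (alg_closure_in C).
Local Notation bar F := (compositum F Cb).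
Local Notation W := (wronskian eta).
Hypothesis alpha_basis : is_basis C Cb alpha.
Local Notation G := (DGal Cb alpha L K).
Local Notation N := (n * n)%N.
Let sfC : is_subfield C := PV_sfC dsfK.
Let dC : forall x, C x -> der x = 0 := @PV_dC U K.
Let sfCb : is_subfield Cb := alg_closure_subfield sfC.
Let dCb : forall x, Cb x -> der x = 0 := alg_closure_const sfC dC.
Let dsfL : is_dsubfield L := PV_dsubfield L_PV.
Let CL : constants L = C := PV_constants L_PV.
Let KL : K `<=` L := PV_sub L_PV.
Let dsfbL : is_dsubfield (bar L) := dsf_bar dsfK L_PV.
Let CbL : constants (bar L) = Cb := constants_bar sfC dC alpha_basis dsfL CL.

Variables (E : set U) (dsfE : is_dsubfield E).
Hypotheses (KE : K `<=` E) (EL : E `<=` L).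
Variable tau : U -> U.
Hypotheses (dtau : is_dhom E tau) (tauK : forall x, K x -> tau x = x).
Local Notation kE := (sf_field dsfE.1).
Local Notation iE := (sf_inj dsfE.1).
Variable tE : {rmorphism kE -> U}.
Hypothesis tEE : forall x, tE x = tau (iE x).
Local Notation R := {mpoly kE[N]}.
Local Notation MP := {mpoly U[N]}.

Definition entries (T : nzRingType) (A : 'M[T]_n) (k : 'I_N) : T := mxvec A 0 k.

Definition varmx (T : nzRingType) : 'M[{mpoly T[N]}]_n := vec_mx (\row_k 'X_k).

Lemma entries_varmx (T : nzRingType) k : entries (varmx T) k = 'X_k.
Proof. by rewrite /entries vec_mxK mxE. Qed.

Lemma entriesE (T : nzRingType) (A : 'M[T]_n) i j : entries A (mxvec_index i j) = A i j.
Proof. exact: mxvecE. Qed.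

Definition evW : R -> U := mmap iE (entries W).

(* [Sp p] is [p^tau (W X)], for a matrix [X] of variables. *)
Definition Sp : R -> MP :=
  mmap (@mpolyC N U \o tE) (entries (map_mx (@mpolyC N U) W *m varmx U)).

HB.instance Definition _ := GRing.RMorphism.copy evW (mmap iE (entries W)).
HB.instance Definition _ := GRing.RMorphism.copy Sp
  (mmap (@mpolyC N U \o tE) (entries (map_mx (@mpolyC N U) W *m varmx U))).

Lemma evWC c : evW c%:MP = iE c. Proof. exact: mmapC. Qed.
Lemma evWX k : evW 'X_k = entries W k. Proof. by rewrite /evW mmapX mmap1U. Qed.
Lemma SpC c : Sp c%:MP = (tE c)%:MP. Proof. exact: mmapC. Qed.
Lemma SpX k : Sp 'X_k = entries (map_mx (@mpolyC N U) W *m varmx U) k.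
Proof. by rewrite /Sp mmapX mmap1U. Qed.
Lemma evWZ c p : evW (c *: p) = iE c * evW p.
Proof. by rewrite -mul_mpolyC rmorphM /= evWC. Qed.
Lemma SpZ c p : Sp (c *: p) = tE c *: Sp p.
Proof. by rewrite -mul_mpolyC rmorphM /= SpC mul_mpolyC. Qed.

Lemma Sp_eval p (M : 'M[U]_n) : (Sp p).@[entries M] = mmap tE (entries (W *m M)) p.
Proof.
apply: (mpoly_rmorph_ext (f := meval (entries M) \o Sp) (g := mmap tE _)) => [c|k] /=.
  by rewrite SpC mevalC mmapC.
rewrite SpX mmapX mmap1U; case/mxvec_indexP: k => i j.
rewrite !entriesE [X in meval _ X]mxE [RHS]mxE rmorph_sum; apply: eq_bigr => l _.
rewrite [X in X * _]mxE rmorphM /= mevalC -[varmx U l j]entriesE entries_varmx.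
by rewrite mevalXU entriesE.
Qed.

Lemma tau_sum_K (A : 'M[kE]_n) : mxover K (map_mx iE A) -> map_mx tE A = map_mx iE A.
Proof.
by move=> KA; apply/matrixP => i j; rewrite !mxE tEE tauK //; move: (KA i j); rewrite mxE.
Qed.

(* The derivation of [E[X]] for which evaluation at [W] is differential. *)
Lemma Sp_der p : exists p', der (evW p) = evW p' /\ coefder (Sp p) = Sp p'.
Proof.
have [A AE] := mxoverP dsfE.1 (fun i j => KE (companion_over dsfK L_PV i j)).
have KA : mxover K (map_mx iE A) by rewrite -AE; exact: (companion_over dsfK L_PV).
have tA := tau_sum_K KA.
elim/mpoly_gen_ind: p => [c|k|p q [p' [p1 p2]] [q' [q1 q2]]|p q [p' [p1 p2]] [q' [q1 q2]]].
- have [c' c'E] := sf_injP dsfE.1 (dsfE.2 _ (sf_inj_over c)).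
  exists c'%:MP; rewrite !evWC !SpC coefderC c'E; split=> //; congr _%:MP.
  by rewrite !tEE c'E (dhom_der dtau) //; exact: sf_inj_over.
- case/mxvec_indexP: k => i j.
  exists (\sum_l A i l *: 'X_(mxvec_index l j)); rewrite !rmorph_sum /= evWX SpX !entriesE.
  split.
    have := PV_der_wronskian L_PV => /matrixP/(_ i j).
    rewrite mxE AE => ->; rewrite mxE; apply: eq_bigr => l _.
    by rewrite evWZ evWX entriesE mxE.
  rewrite [X in coefder X]mxE coefder_sum.
  have dX i' j' : coefder (varmx U i' j') = 0 by rewrite -entriesE entries_varmx coefderX.
  transitivity ((map_mx (@mpolyC N U) (map_mx iE A) *m (map_mx (@mpolyC N U) W *m varmx U)) i j).
    rewrite mulmxA -map_mxM -AE -(PV_der_wronskian L_PV) mxE; apply: eq_bigr => l _.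
    by rewrite coefderM dX mulr0 addr0 [X in coefder X]mxE coefderC !mxE.
  rewrite mxE; apply: eq_bigr => l _.
  by rewrite SpZ SpX entriesE -mul_mpolyC -tA !mxE.
- by exists (p' + q'); rewrite !rmorphD derD coefderD p1 q1 p2 q2.
- by exists (p' * q + p * q'); rewrite !(rmorphD, rmorphM) /= derM coefderM p1 q1 p2 q2.
Qed.

(** Over [F = [set: U]] this is the ideal to which the Nullstellensatz is applied. The smaller
    fields serve in descent: [bar L], with constants [Cb], to find points, and [L], with constants
    [C], to get equations over [C]. *)
Definition Span (F : set U) : set MP := [set q | exists t : seq (U * R),
  (forall x, x \in t -> F x.1 /\ evW x.2 = 0) /\ q = \sum_(x <- t) x.1 *: Sp x.2].

Lemma SpanD F p q : Span F p -> Span F q -> Span F (p + q).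
Proof.
move=> [t [Ft ->]] [u [Fu ->]]; exists (t ++ u); split; last by rewrite big_cat.
by move=> x; rewrite mem_cat => /orP[/Ft|/Fu].
Qed.

Lemma SpanZ F c q : is_subfield F -> F c -> Span F q -> Span F (c *: q).
Proof.
move=> sfF Fc [t [Ft ->]]; exists [seq (c * x.1, x.2) | x <- t]; split.
  by move=> _ /mapP[x /Ft[Fx x0] ->] /=; split=> //; exact: (subfieldM sfF).
by rewrite big_map scaler_sumr; apply: eq_bigr => x _; rewrite scalerA.
Qed.

Lemma Span_Sp F p : is_subfield F -> evW p = 0 -> Span F (Sp p).
Proof.
move=> sfF p0; exists [:: (1, p)]; split; last by rewrite big_seq1 scale1r.
by move=> _ /[1!inE] /eqP -> /=; split=> //; exact: (subfield1 sfF).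
Qed.

Lemma SpanS F F' : F `<=` F' -> Span F `<=` Span F'.
Proof. by move=> FF' q [t [Ft ->]]; exists t; split=> // x /Ft[/FF']. Qed.

Lemma Span_ind (F : set U) (Q : MP -> Prop) : Q 0 -> (forall p q, Q p -> Q q -> Q (p + q)) ->
  (forall c p, F c -> evW p = 0 -> Q (c *: Sp p)) -> forall q, Span F q -> Q q.
Proof.
move=> Q0 QD QS _ [t [Ft ->]]; rewrite big_seq; apply: (big_ind Q Q0 QD).
by move=> x /Ft[Fx x0]; exact: QS.
Qed.

Let WWX : map_mx (@mpolyC N U) (invmx W) *m (map_mx (@mpolyC N U) W *m varmx U) = varmx U.
Proof.
by rewrite mulmxA -map_mxM mulVmx ?(PV_wronskian_unit L_PV) // map_mx1 mul1mx.
Qed.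

Lemma setT_subfield : is_subfield [set: U]. Proof. by []. Qed.

(** The only nontrivial multiplier is a variable. As [X = W^-1 (W X)], it is a combination over [U]
    of the entries of [W X], which are the [Sp 'X_l], and the relations of [W] are stable under
    multiplication by ['X_l]. *)
Lemma Span_ideal : is_ideal (Span [set: U]).
Proof.
split; [|exact: SpanD|].
  by exists [::]; split=> //; rewrite big_nil.
elim/mpoly_gen_ind => [c q Sq|k q|p q IHp IHq r Sr|p q IHp IHq r Sr].
- by rewrite mul_mpolyC; exact: (SpanZ setT_subfield).
- move: q; apply: (@Span_ind _ (fun q => Span [set: U] ('X_k * q))).
    by rewrite mulr0; exists [::]; split=> //; rewrite big_nil.
    by move=> p1 q1; rewrite mulrDr; exact: SpanD.
  move=> c p _ p0; case/mxvec_indexP: k => i j.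
  rewrite -entries_varmx entriesE -WWX mxE mulr_suml.
  elim: (index_enum _) => [|l t IH]; first by exists [::]; split=> //; rewrite !big_nil.
  rewrite big_cons; apply: SpanD => //.
  rewrite -[(map_mx (@mpolyC N U) W *m varmx U) l j]entriesE -SpX mxE -mulrA -scalerAr -rmorphM mul_mpolyC.
  by do 2!apply: (SpanZ setT_subfield) => //; apply: Span_Sp => //; rewrite rmorphM /= p0 mulr0.
- by rewrite mulrDl; apply: SpanD; [exact: IHp|exact: IHq].
- by rewrite -mulrA; apply: IHp; exact: IHq.
Qed.

Definition Iso (M : 'M[U]_n) := forall p, evW p = 0 -> (Sp p).@[entries M] = 0.

Lemma Sp_over (F : set U) p : is_subfield F -> mxover F W -> tau @` E `<=` F ->
  mpolyover F (Sp p).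
Proof.
move=> sfF FW tF; elim/mpoly_gen_ind: p => [c|k|p q Fp Fq|p q Fp Fq].
- rewrite SpC; apply: (mpolyoverC sfF); rewrite tEE; apply: tF.
  by exists (iE c) => //; exact: sf_inj_over.
- rewrite SpX; case/mxvec_indexP: k => i j; rewrite entriesE mxE.
  apply: (mpolyover_sum sfF) => l _; rewrite mxE; apply: (mpolyoverM sfF).
    exact: (mpolyoverC sfF).
  by rewrite -entriesE entries_varmx; exact: (mpolyoverX sfF).
- by rewrite rmorphD; exact: (mpolyoverD sfF).
- by rewrite rmorphM; exact: (mpolyoverM sfF).
Qed.

(** Descent is applied to the vectors of coefficients of the elements of [Span F]. Their stability
    under [coefder] comes from [Sp_der]: the derivative of a relation of [W] is again a relation. *)
Lemma Span_descent (F : set U) M : is_dsubfield F -> mxover F W -> tau @` E `<=` F ->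
  (forall q, Span F q -> mpolyover (constants F) q -> q.@[entries M] = 0) -> Iso M.
Proof.
move=> dsfF FW tF Mq p p0; have sfF := dsfF.1.
pose V : set ('X_{1..N} -> U) := [set v | exists2 q, Span F q & v = fun m => q@_m].
pose Z : set ('X_{1..N} -> U) :=
  [set v | exists2 q : MP, q.@[entries M] = 0 & v = fun m => q@_m].
have Vp : V (fun m => (Sp p)@_m) by exists (Sp p) => //; exact: Span_Sp.
suff [q q0 qE] : Z (fun m => (Sp p)@_m).
  by rewrite (_ : Sp p = q) //; apply/mpolyP => m; exact: (congr1 (@^~ m) qE).
apply: (@descent_der _ F dsfF _ V _ _ _ _ _ _ (msupp (Sp p))) Vp.
- move=> _ m [q Sq ->]; move: q Sq; apply: Span_ind.
  + by rewrite mcoeff0; exact: (subfield0 sfF).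
  + by move=> q1 q2 F1 F2; rewrite mcoeffD; exact: (subfieldD sfF).
  + move=> c q Fc q0; rewrite mcoeffZ; apply: (subfieldM sfF) => //.
    exact: Sp_over.
- move=> _ _ c [q1 S1 ->] [q2 S2 ->] Fc; exists (q1 + c *: q2).
    by apply: SpanD => //; exact: SpanZ.
  by apply: funext => m; rewrite mcoeffD mcoeffZ.
- move=> _ [q Sq ->]; exists (coefder q); last first.
    by apply: funext => m; rewrite /= mcoeff_coefder.
  move: q Sq; apply: Span_ind.
  + by exists [::]; split=> //; rewrite big_nil -(mpolyC0 N) coefderC der0.
  + by move=> q1 q2; rewrite coefderD; exact: SpanD.
  + move=> c q Fc q0; have [q' [q1 q2]] := Sp_der q.
    rewrite coefderZ q2; apply: SpanD; apply: SpanZ => //.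
    * exact: dsfF.2.
    * exact: Span_Sp.
    * by apply: Span_Sp => //; rewrite -q1 q0 der0.
- by exists 0; [rewrite meval0 | apply: funext => m; rewrite mcoeff0].
- move=> _ _ c Fc [q1 M1 ->] [q2 S2 ->] C2; exists (q1 + c *: q2).
    by rewrite mevalD mevalZ M1 Mq // mulr0 addr0.
  by apply: funext => m; rewrite mcoeffD mcoeffZ.
- by move=> m; rewrite mcoeff_msupp.
Qed.

Hypothesis tauB : tau @` E `<=` bar E.
Let CE : constants E = C := inter_constants L_PV KE EL.
Let dsfbE : is_dsubfield (bar E) := bar_dsubfield sfC dC dsfE CE.
Let bEL : bar E `<=` bar L := bar_sub sfC dsfL CL EL.

Lemma W_bar : mxover (bar L) W.
Proof. by move=> i j; exact: sub_bar (PV_wronskian_over L_PV i j). Qed.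

Lemma tau_bar : tau @` E `<=` bar L.
Proof. exact: subset_trans tauB bEL. Qed.

Lemma det_varmx_eval (M : 'M[U]_n) : (\det (varmx U)).@[entries M] = \det M.
Proof.
rewrite -det_map_mx; congr (\det _); apply/matrixP => i j.
by rewrite mxE /= -[varmx U i j]entriesE entries_varmx mevalXU entriesE.
Qed.

Lemma map_det_varmx (A B : comNzRingType) (f : {rmorphism A -> B}) :
  map_mpoly f (\det (varmx A)) = \det (varmx B).
Proof.
rewrite -det_map_mx; congr (\det _); apply/matrixP => i j.
by rewrite mxE -[varmx A i j]entriesE -[RHS]entriesE !entries_varmx /= map_mpolyX.
Qed.

Hypothesis U_closed : diff_closed U.
Local Notation k := (sf_field sfCb).
Local Notation ik := (sf_inj sfCb).

(** The prime ideal found over [U] is contracted to [Cb[X]], where points are available;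
    [Span_descent] shows that zeros of the contraction are zeros of the whole span. The factor
    [\det (varmx U)] forces the point to be an invertible matrix. *)
Lemma Iso_exists (f : MP) : (forall r, ~ Span [set: U] ((f * \det (varmx U)) ^+ r)) ->
  exists M, [/\ GL_over Cb M, Iso M & f.@[entries M] != 0].
Proof.
move=> nf; have [PP [prPP SP nPP]] := prime_avoiding Span_ideal nf.
have idPP := prime_is_ideal prPP.
pose P : set {mpoly k[N]} := [set q | PP (map_mpoly ik q)].
have PE q : P q = PP (map_mpoly ik q) by [].
have prP : is_prime_ideal P.
  split; [split|by rewrite PE rmorph1; exact: (prime_n1 prPP)|].
  - by rewrite PE rmorph0; exact: (ideal0 idPP).
  - by move=> x y Px Py; rewrite PE rmorphD; exact: (idealD idPP).
  - by move=> c x Px; rewrite PE rmorphM; exact: (idealM idPP).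
  - by move=> x y; rewrite !PE rmorphM; exact: (primeM prPP).
pose D := size (msupp f); pose mon (j : 'I_D) := tnth (in_tuple (msupp f)) j.
(* [f] has coefficients in [U], but only polynomials over [Cb] can be kept nonzero at the point. So
   [f] is written with coefficients free over [Cb] times polynomials [g i] over [Cb]: one [g i] lies
   outside the prime ideal, and [f] cannot vanish at [M] unless all [g i] do. *)
have [r [c [B [free BCb fE]]]] := extract_basis sfCb (fun j => f@_(mon j)).
have /choice[b bE] : forall ij : 'I_r * 'I_D, exists y, ik y = B ij.1 ij.2.
  by move=> ij; apply: (sf_injP sfCb); exact: BCb.
pose g i : {mpoly k[N]} := \sum_j b (i, j) *: 'X_[mon j].
have fg : f = \sum_i f@_(mon (c i)) *: map_mpoly ik (g i).
  rewrite [LHS]mpolyE big_tnth.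
  under eq_bigr => j _ do rewrite -/(mon j) fE scaler_suml.
  rewrite exchange_big; apply: eq_bigr => i _; rewrite /g (raddf_sum (map_mpoly ik)) scaler_sumr.
  apply: eq_bigr => j _; rewrite /= map_mpolyZ map_mpolyX bE scalerA.
  by rewrite mulrC.
have [i nPi] : exists i, ~ P (g i * \det (varmx k)).
  apply/existsNP => Pg; apply: nPP; rewrite fg mulr_suml.
  apply: (ideal_sum idPP) => i _; rewrite -scalerAl -mul_mpolyC.
  by apply: (idealM idPP); have := Pg i; rewrite PE rmorphM /= map_det_varmx.
have [v [vP]] := nullstellensatz (alg_closure_closed (sfC := sfC) U_closed) prP nPi.
rewrite mevalM mulf_eq0 negb_or => /andP[gv detv].
pose M : 'M[U]_n := vec_mx (\row_l ik (v l)).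
have MvE l : entries M l = ik (v l) by rewrite /entries vec_mxK mxE.
have evM q : (map_mpoly ik q).@[entries M] = ik q.@[v].
  apply: (mpoly_rmorph_ext (f := meval _ \o map_mpoly ik) (g := ik \o meval v)) => [x|l] /=.
    by rewrite map_mpolyC !mevalC.
  by rewrite map_mpolyX !mevalXU.
have MCb : mxover Cb M by move=> i1 j1; rewrite -entriesE MvE; exact: sf_inj_over.
exists M; split.
- split=> //; rewrite unitmxE unitfE -det_varmx_eval.
  by rewrite -(map_det_varmx ik) evM fmorph_eq0.
- apply: (Span_descent dsfbL W_bar tau_bar) => q Sq; rewrite CbL => /(mpolyoverP sfCb)[q' qE].
  rewrite qE evM vP ?rmorph0 // PE -qE; apply: SP.
  by apply: SpanS Sq.
apply/eqP => f0; move/eqP: gv; apply.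
apply/eqP; rewrite -(fmorph_eq0 ik); apply/eqP.
apply: (free (fun i => ik (g i).@[v])) => [l|]; first exact: sf_inj_over.
rewrite -[RHS]f0 [in RHS]fg (raddf_sum (meval (entries M))).
by apply: eq_bigr => l _; rewrite /= mevalZ evM mulrC.
Qed.

Let lq := [tuple (entries (map_mx (@mpolyC N U) (invmx W) *m varmx U)) i | i < N].

Lemma Sp_W p : Sp p \mPo lq = map_mpoly tE p.
Proof.
have lqE l : tnth lq l = entries (map_mx (@mpolyC N U) (invmx W) *m varmx U) l.
  by rewrite tnth_map tnth_ord_tuple.
apply: (mpoly_rmorph_ext (f := comp_mpoly lq \o Sp) (g := map_mpoly tE)) => [c|l] /=.
  by rewrite SpC comp_mpolyC map_mpolyC.
rewrite SpX map_mpolyX; case/mxvec_indexP: l => i j; rewrite entriesE mxE rmorph_sum.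
transitivity ((map_mx (@mpolyC N U) W *m (map_mx (@mpolyC N U) (invmx W) *m varmx U)) i j).
  rewrite mxE; apply: eq_bigr => l _; rewrite rmorphM /= [X in comp_mpoly lq X * _]mxE comp_mpolyC.
  rewrite -[varmx U l j]entriesE entries_varmx comp_mpolyXU -tnth_nth lqE entriesE.
  by rewrite [X in _ = X * _]mxE.
rewrite mulmxA -map_mxM mulmxV ?(PV_wronskian_unit L_PV) // map_mx1 mul1mx.
by rewrite -entriesE entries_varmx.
Qed.

Lemma Sp_free r (lam : 'I_r -> U) (Q : 'I_r -> R) :
  lfree (tau @` E) lam -> \sum_l lam l *: Sp (Q l) = 0 -> forall l, Q l = 0.
Proof.
move=> free sumQ l; apply/mpolyP => m; rewrite mcoeff0; apply/eqP.
rewrite -(fmorph_eq0 tE); apply/eqP.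
apply: (free (fun l => tE (Q l)@_m)) => [i|].
  by rewrite tEE; exists (iE (Q i)@_m) => //; exact: sf_inj_over.
have := congr1 (fun q => (q \mPo lq)@_m) sumQ; rewrite comp_mpoly0 mcoeff0.
rewrite (raddf_sum (comp_mpoly lq)) (raddf_sum (mcoeff m)) => E0.
rewrite -[RHS]E0; apply: eq_bigr => i _ /=.
by rewrite comp_mpolyZ Sp_W mcoeffZ mcoeff_map_mpoly mulrC.
Qed.

(* The span is the base change along [tau] of the kernel of evaluation at [W], so that a
   relation over [U] is a combination of relations over [E]. *)
Lemma Span_tensor J (y : 'I_J -> U) (H : 'I_J -> R) :
  Span [set: U] (\sum_j y j *: Sp (H j)) ->
  exists r (lam : 'I_r -> U) (b : 'I_r -> 'I_J -> kE),
    (forall j, y j = \sum_l tE (b l j) * lam l) /\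
    forall l, \sum_j iE (b l j) * evW (H j) = 0.
Proof.
move=> [t [t0 sumE]]; pose D := size t.
pose y' (k : 'I_(J + D)) := match fintype.split k with
  inl j => y j | inr i => - (tnth (in_tuple t) i).1 end.
pose H' (k : 'I_(J + D)) := match fintype.split k with
  inl j => H j | inr i => (tnth (in_tuple t) i).2 end.
have yl j : y' (lshift D j) = y j by rewrite /y' (fintype.unsplitK (inl j)).
have yr i : y' (rshift J i) = - (tnth (in_tuple t) i).1 by rewrite /y' (fintype.unsplitK (inr i)).
have Hl j : H' (lshift D j) = H j by rewrite /H' (fintype.unsplitK (inl j)).
have Hr i : H' (rshift J i) = (tnth (in_tuple t) i).2 by rewrite /H' (fintype.unsplitK (inr i)).
have dT : is_dsubfield (tau @` E) by exact: (dhom_image_dsubfield dsfE dtau).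
have [r [f [B [free BT yE]]]] := extract_basis dT.1 y'.
have /choice[b bE] : forall ij, exists c, tE c = B ij.1 ij.2.
  move=> ij; have [x Ex <-] := BT ij.1 ij.2; have [c cE] := sf_injP dsfE.1 Ex.
  by exists c; rewrite tEE cE.
pose Q l : R := \sum_j b (l, j) *: H' j.
have sumQ : \sum_l y' (f l) *: Sp (Q l) = 0.
  transitivity (\sum_j y' j *: Sp (H' j)).
    under [RHS]eq_bigr => j _ do rewrite yE scaler_suml.
    rewrite exchange_big; apply: eq_bigr => l _; rewrite rmorph_sum scaler_sumr.
    by apply: eq_bigr => j _; rewrite /= SpZ bE scalerA mulrC.
  rewrite big_split_ord /=.
  under eq_bigr => j _ do rewrite yl Hl.
  under [X in _ + X]eq_bigr => j _ do rewrite yr Hr scaleNr.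
  by rewrite sumrN sumE big_tnth subrr.
have Q0 := Sp_free free sumQ.
exists r, (y' \o f), (fun l j => b (l, lshift D j)); split=> [j|l].
  by rewrite -yl yE; apply: eq_bigr => l _; rewrite bE.
have := congr1 evW (Q0 l); rewrite rmorph0 rmorph_sum /= big_split_ord /=.
rewrite [X in _ + X]big1 ?addr0 => [E0|i _].
  by rewrite -[RHS]E0; apply: eq_bigr => j _; rewrite evWZ Hl.
rewrite evWZ Hr; have /t0[_ ->] : tnth (in_tuple t) i \in t by exact: mem_tnth.
by rewrite mulr0.
Qed.

(** Multiplication by a constant matrix preserves the span over [Cb] of the monomials of bounded
    degree. It is used with [M] and with its inverse in [Iso_inj], and to make the Galois group act
    on [monomials]. *)
Lemma monomial_mul (Z M : 'M[U]_n) (m : 'X_{1..N}) : mxover Cb M ->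
  exists q : MP, [/\ mpolyover Cb q, (msize q <= (mdeg m).+1)%N &
    q.@[entries Z] = mmap1 (entries (Z *m M)) m].
Proof.
move=> CM; pose dg (q : MP) e := mpolyover Cb q /\ (msize q <= e.+1)%N.
have dgM p q e1 e2 : dg p e1 -> dg q e2 -> dg (p * q) (e1 + e2)%N.
  move=> [Cp pe] [Cq qe]; split; first exact: (mpolyoverM sfCb).
  have [->|p0] := eqVneq p 0; first by rewrite mul0r msize0.
  have [->|q0] := eqVneq q 0; first by rewrite mulr0 msize0.
  rewrite msizeM // -subn1 leq_subLR add1n -addSn -addnS; exact: leq_add.
have dg1 : dg 1 0%N by split; [exact: (mpolyoverC sfCb (subfield1 sfCb)) | rewrite msize1].
have lin k : exists2 q, dg q 1%N & q.@[entries Z] = entries (Z *m M) k.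
  case/mxvec_indexP: k => i j.
  exists (\sum_l M l j *: 'X_(mxvec_index i l)).
    split.
      apply: (mpolyover_sum sfCb) => l _; apply: (mpolyoverZ sfCb) => //.
      exact: (mpolyoverX sfCb).
    apply: leq_trans (msize_sum _ _ _) _; apply/bigmax_leqP => l _.
    by apply: leq_trans (msizeZ_le _ _) _; rewrite msizeX mdeg1.
  rewrite rmorph_sum entriesE mxE; apply: eq_bigr => l _.
  by rewrite /= mevalZ mevalXU entriesE mulrC.
suff [q [Cq qm] qE] : exists2 q, dg q (mdeg m) &
    q.@[entries Z] = mmap1 (entries (Z *m M)) m by exists q.
rewrite mdegE /mmap1; elim: (index_enum _) => [|k s [q dq qE]].
  by exists 1; rewrite ?big_nil ?meval1.
have [p dp pE] : exists2 p, dg p (m k) & p.@[entries Z] = entries (Z *m M) k ^+ m k.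
  elim: (m k) => [|e [p dp pE]]; first by exists 1; rewrite ?meval1.
  have [l dl lE] := lin k; exists (l * p); first by rewrite -add1n; exact: dgM.
  by rewrite mevalM lE pE exprS.
exists (p * q); first by rewrite big_cons; exact: dgM.
by rewrite mevalM pE qE big_cons.
Qed.

(** Let [u] and [z] be the monomials of degree less than [d] in [W] and in [W M], and [u = v B] with
    [v] an [E]-basis extracted from [u]. As [Iso M] transports relations over [E], also
    [z = zf B^tau]. Each of [u] and [z] is a combination of the other over [Cb], so the base changes
    between [v] and [zf] are inverse matrices over [bar E]. For [c] the coefficients of [p], the
    value at [M] is [zf B^tau c^tau]; its vanishing forces [B^tau c^tau = 0], hence [B c = 0]. *)
Lemma Iso_inj M p : GL_over Cb M -> Iso M -> (Sp p).@[entries M] = 0 -> evW p = 0.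
Proof.
move=> [Mu CM] IsoM Sp0; pose d := msize p; pose T : finType := 'X_{1..N < d}; pose D := #|T|.
pose m (j : 'I_D) : 'X_{1..N} := bmnm (enum_val j).
pose u j := mmap1 (entries W) (m j); pose z j := mmap1 (entries (W *m M)) (m j).
have sumT (F : 'X_{1..N} -> U) : \sum_(x : T) F (bmnm x) = \sum_j F (m j).
  by rewrite (reindex _ (onW_bij _ (enum_val_bij T))).
have expand (Z M' : 'M[U]_n) j : mxover Cb M' -> exists c : 'I_D -> U,
    (forall i, Cb (c i)) /\
    mmap1 (entries (Z *m M')) (m j) = \sum_i c i * mmap1 (entries Z) (m i).
  move=> CM'; have [q [Cq sq <-]] := monomial_mul Z (m j) CM'.
  exists (fun i => q@_(m i)); split=> //; rewrite /meval (mmapE d) //.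
    exact: (sumT (fun m => q@_m * mmap1 (entries Z) m)).
  apply: leq_trans sq _; exact: bmdeg.
have Lu j : L (u j).
  apply: (subfield_prod dsfL.1) => k _; apply: (subfieldX dsfL.1).
  case/mxvec_indexP: k => i i'; rewrite entriesE; exact: (PV_wronskian_over L_PV).
have [r [f [B [free BE uE]]]] := extract_basis dsfE.1 u.
have [b bE] := mxoverP dsfE.1 BE.
have tb : mxover (bar E) (map_mx tE b).
  move=> i j; rewrite mxE tEE; apply: tauB; exists (iE (b i j)) => //.
  exact: sf_inj_over.
have zE j : z j = \sum_i tE (b i j) * z (f i).
  pose q : R := 'X_[m j] - \sum_i b i j *: 'X_[m (f i)].
  have q0 : evW q = 0.
    rewrite rmorphB rmorph_sum /= /evW mmapX -/(u j) uE; apply/eqP; rewrite subr_eq0.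
    by apply/eqP/eq_bigr => i _; rewrite -/evW evWZ /evW mmapX bE mxE.
  have := IsoM _ q0; rewrite Sp_eval rmorphB rmorph_sum /= mmapX => /eqP.
  rewrite subr_eq0 => /eqP; rewrite -/(z j) => ->; apply: eq_bigr => i _.
  by rewrite mmapZ mmapX.
have /choice[c1 c1E] : forall i, exists c : 'I_D -> U, (forall j, Cb (c j)) /\
    z (f i) = \sum_j c j * u j by move=> i; exact: expand.
have /choice[c2 c2E] : forall i, exists c : 'I_D -> U, (forall j, Cb (c j)) /\
    u (f i) = \sum_j c j * z j.
  move=> i; have [] := expand (W *m M) (invmx M) (f i); first exact: (mxover_inv sfCb).
  by move=> c; rewrite mulmxK //; exists c.
pose v : 'rV_r := \row_i u (f i); pose zf : 'rV_r := \row_i z (f i).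
pose R1 : 'M_(D, r) := \matrix_(j, i) c1 i j.
pose R2 : 'M_(D, r) := \matrix_(j, i) c2 i j.
have uB : \row_j u j = v *m B.
  by apply/rowP => j; rewrite !mxE uE; apply: eq_bigr => i _; rewrite mxE mulrC.
have zB : \row_j z j = zf *m map_mx tE b.
  by apply/rowP => j; rewrite !mxE zE; apply: eq_bigr => i _; rewrite !mxE mulrC.
have zf1 : zf = v *m (B *m R1).
  rewrite mulmxA -uB; apply/rowP => i; rewrite !mxE; have [_ ->] := c1E i.
  by apply: eq_bigr => j _; rewrite !mxE mulrC.
have v2 : v = zf *m (map_mx tE b *m R2).
  rewrite mulmxA -zB; apply/rowP => i; rewrite !mxE; have [_ ->] := c2E i.
  by apply: eq_bigr => j _; rewrite !mxE mulrC.
have Cb_bE x : Cb x -> bar E x by move=> Cx; exact: cb_sub_bar Cx.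
have N1E : mxover (bar E) (B *m R1).
  apply: (mxover_mul dsfbE.1) => [i j|j i]; first exact: sub_bar (BE i j).
  by rewrite mxE; apply: Cb_bE; have [] := c1E i.
have N2E : mxover (bar E) (map_mx tE b *m R2).
  apply: (mxover_mul dsfbE.1) => // j i.
  by rewrite mxE; apply: Cb_bE; have [] := c2E i.
have freeb : lfree (bar E) (v 0).
  have -> : v 0 = u \o f by apply: funext => i; rewrite mxE.
  by apply: (lfree_bar sfC dC alpha_basis dsfE CE dsfL CL EL) => // i; exact: Lu.
have N12 : (B *m R1) *m (map_mx tE b *m R2) = 1%:M.
  apply: (lfree_mx_inj dsfbE.1 freeb); first exact: (mxover_mul dsfbE.1).
    move=> i j; rewrite mxE; exact: (subfield_nat dsfbE.1).
  by rewrite mulmx1 mulmxA -zf1 -v2.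
pose c : 'cV[kE]_D := \col_j p@_(m j).
have evp : evW p = (v *m (B *m map_mx iE c)) 0 0.
  rewrite mulmxA -uB mxE /evW (mmapE d) //
    (sumT (fun m => iE p@_m * mmap1 (entries W) m)).
  by apply: eq_bigr => j _; rewrite !mxE mulrC.
have Spp : (Sp p).@[entries M] = (zf *m (map_mx tE b *m map_mx tE c)) 0 0.
  rewrite Sp_eval mulmxA -zB mxE (mmapE d) //
    (sumT (fun m => tE p@_m * mmap1 (entries (W *m M)) m)).
  by apply: eq_bigr => j _; rewrite !mxE mulrC.
have bc0 : map_mx tE b *m map_mx tE c = 0.
  have : (B *m R1) *m (map_mx tE b *m map_mx tE c) = 0.
    apply: (lfree_mx freeb).
      apply: (mxover_mul dsfbE.1) => //; apply: (mxover_mul dsfbE.1) => // j i.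
      rewrite mxE tEE; apply: tauB; exists (iE (c j i)) => //; exact: sf_inj_over.
    rewrite mulmxA -zf1; apply/matrixP => i j; rewrite !ord1 -Spp Sp0.
    by rewrite mxE.
  (* Both factors in [N12] are square of size [r], so a right inverse is a left inverse: here the
     equality of dimensions is used. *)
  move=> /(congr1 (mulmx (map_mx tE b *m R2))).
  by rewrite mulmxA (mulmx1C N12) mul1mx mulmx0.
have bc : b *m c = 0.
  by apply/eqP; rewrite -(map_mx_eq0 tE) map_mxM bc0.
by rewrite evp bE -map_mxM bc map_mx0 mulmx0 mxE.
Qed.

Lemma evW_L p : L (evW p).
Proof.
elim/mpoly_gen_ind: p => [x|k|p q Lp Lq|p q Lp Lq].
- by rewrite evWC; apply: EL; exact: sf_inj_over.
- by rewrite evWX; case/mxvec_indexP: k => i j; rewrite entriesE; exact: (PV_wronskian_over L_PV).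
- by rewrite rmorphD; exact: (subfieldD dsfL.1).
- by rewrite rmorphM; exact: (subfieldM dsfL.1).
Qed.

Lemma L_frac x : L x -> exists p q, evW q != 0 /\ x = evW p / evW q.
Proof.
pose A := [set x | exists p q, evW q != 0 /\ x = evW p / evW q].
have ev1 : evW 1 = 1 by rewrite rmorph1.
suff LA : L `<=` A by move=> /LA.
have AE y : (exists p, y = evW p) -> A y.
  by move=> [p ->]; exists p, 1; rewrite ev1 oner_neq0 divr1.
apply: (PV_sub_subfield dsfK L_PV).
- split.
  + by apply: AE; exists 1.
  + move=> _ _ [p [q [q0 ->]]] [p' [q' [q'0 ->]]].
    exists (p * q' - p' * q), (q * q').
    rewrite rmorphB !rmorphM /= mulf_neq0 //; split=> //; field.
    by rewrite q0 q'0.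
  + move=> _ _ [p [q [q0 ->]]] [p' [q' [q'0 ->]]].
    by exists (p * p'), (q * q'); rewrite !rmorphM /= mulf_neq0 // mulf_div.
  + move=> _ [p [q [q0 ->]]]; have [p0|p0] := eqVneq (evW p) 0.
      by apply: AE; exists 0; rewrite rmorph0 p0 mul0r invr0.
    by exists q, p; rewrite invf_div.
- by move=> y Ky; apply: AE; have [z <-] := sf_injP dsfE.1 (KE Ky); exists z%:MP; rewrite evWC.
- by move=> i j; apply: AE; exists 'X_(mxvec_index i j); rewrite evWX entriesE.
Qed.

(** [T p] vanishes exactly when [evW p] does, so a quotient [evW p / evW q] may be sent to
    [T p / T q]. The result is differential because [Sp_der] gives the same polynomial [p'] for both
    evaluations, [M] being constant. *)
Lemma Iso_extend M : GL_over Cb M -> Iso M -> exists s,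
  [/\ carrier G s, forall x, E x -> s x = tau x & forall j, s (eta j) = \sum_i M i j * eta i].
Proof.
move=> GM IsoM; have [Mu CM] := GM; pose T p := (Sp p).@[entries M].
have T0 p : (T p == 0) = (evW p == 0).
  by apply/eqP/eqP; [exact: Iso_inj | exact: IsoM].
have TD p q : T (p + q) = T p + T q by rewrite /T rmorphD mevalD.
have TM p q : T (p * q) = T p * T q by rewrite /T rmorphM mevalM.
have T1 : T 1 = 1 by rewrite /T rmorph1 meval1.
have TB p q : T (p - q) = T p - T q by rewrite /T rmorphB mevalB.
have Tder p : exists p', der (evW p) = evW p' /\ der (T p) = T p'.
  have [p' [p1 p2]] := Sp_der p; exists p'; split=> //.
  rewrite /T -p2; apply: der_meval => k.
  by case/mxvec_indexP: k => i j; rewrite entriesE; apply: dCb.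
have TL p : bar L (T p).
  apply: (mpolyover_eval dsfbL.1).
    apply: Sp_over => //; [exact: dsfbL.1| |exact: subset_trans bEL].
    by move=> i j; exact: sub_bar (PV_wronskian_over L_PV i j).
  by move=> k; case/mxvec_indexP: k => i j; rewrite entriesE; exact: cb_sub_bar (CM i j).
have /choice[g gE] : forall x, exists pq : R * R,
    L x -> evW pq.2 != 0 /\ x = evW pq.1 / evW pq.2.
  move=> x; have [Lx|nLx] := pselect (L x); last by exists (0, 0).
  by have [p [q [q0 xE]]] := L_frac Lx; exists (p, q).
pose s x := T (g x).1 / T (g x).2.
have sE x p q : L x -> evW q != 0 -> x = evW p / evW q -> s x = T p / T q.
  move=> Lx q0 xE; have [g0 gxE] := gE x Lx; rewrite /s.
  apply/eqP; rewrite eqr_div ?T0 // -subr_eq0 -!TM -TB T0 rmorphB !rmorphM /=.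
  by rewrite subr_eq0 -eqr_div // -xE -gxE.
have ds : is_dhom L s.
  split.
  - rewrite (sE 1 1 1) ?T1 ?divr1 ?rmorph1 ?oner_neq0 ?divr1 //.
    exact: (subfield1 dsfL.1).
  - move=> x y Lx Ly; have [p [q [q0 xE]]] := L_frac Lx; have [p' [q' [q'0 yE]]] := L_frac Ly.
    rewrite (sE x p q) // (sE y p' q') // (sE (x + y) (p * q' + p' * q) (q * q')).
    + by rewrite TD !TM addf_div ?T0.
    + exact: (subfieldD dsfL.1).
    + by rewrite rmorphM mulf_neq0.
    + by rewrite xE yE rmorphD !rmorphM addf_div.
  - move=> x y Lx Ly; have [p [q [q0 xE]]] := L_frac Lx; have [p' [q' [q'0 yE]]] := L_frac Ly.
    rewrite (sE x p q) // (sE y p' q') // (sE (x * y) (p * p') (q * q')).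
    + by rewrite !TM mulf_div.
    + exact: (subfieldM dsfL.1).
    + by rewrite rmorphM mulf_neq0.
    + by rewrite xE yE !rmorphM mulf_div.
  - move=> x Lx; have [p [q [q0 xE]]] := L_frac Lx.
    have [p' [p1 p2]] := Tder p; have [q' [q1 q2]] := Tder q.
    have der_div y z : z != 0 -> der (y / z) = (der y * z - y * der z) / (z * z) :> U.
      by move=> z0; rewrite derM derV; field.
    rewrite (sE x p q) // (sE (der x) (p' * q - p * q') (q * q)).
    + by rewrite TB !TM der_div ?T0 // p2 q2.
    + exact: dsfL.2.
    + by rewrite rmorphM mulf_neq0.
    + by rewrite xE der_div // p1 q1 rmorphB !rmorphM.
have sT p : s (evW p) = T p.
  by rewrite (sE _ p 1) ?rmorph1 ?oner_neq0 ?divr1 ?T1 ?divr1 //; exact: evW_L.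
have sTau x : E x -> s x = tau x.
  move=> Ex; have [y yE] := sf_injP dsfE.1 Ex.
  by rewrite -yE -(evWC y) sT /T SpC mevalC evWC tEE.
have LW j : L (eta j) by exact: (PV_eta L_PV).
have [[n0 _] _ _ _ _] := L_PV.
have etaE j : eta j = evW 'X_(mxvec_index (Ordinal n0) j).
  by rewrite evWX entriesE mxE.
exists (restr L s); split.
- split.
  + exact: (dhom_restr dsfL).
  + move=> _ [x Lx <-]; rewrite restrE //; have [p [q [q0 xE]]] := L_frac Lx.
    by rewrite (sE x p q) //; exact: (subfield_div dsfbL.1).
  + by move=> x Kx; rewrite restrE ?sTau ?tauK //; [exact: KE|exact: KL].
  + by apply: eq_restr => x Lx; rewrite restrE.
- by move=> x Ex; rewrite restrE ?sTau //; exact: EL.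
- move=> j; rewrite restrE // [in LHS]etaE sT /T Sp_eval mmapX mmap1U entriesE mxE.
  by apply: eq_bigr => l _; rewrite mxE mulrC.
Qed.

Lemma evW_det : evW (\det (varmx kE)) = \det W.
Proof.
rewrite -det_map_mx; congr (\det _); apply/matrixP => i j.
by rewrite mxE -[varmx kE i j]entriesE entries_varmx /= evWX entriesE.
Qed.

Lemma Sp_det : Sp (\det (varmx kE)) = \det W *: \det (varmx U).
Proof.
rewrite -mul_mpolyC -(det_map_mx (@mpolyC N U)) -det_mulmx -det_map_mx; congr (\det _).
apply/matrixP => i j.
by rewrite mxE -[varmx kE i j]entriesE entries_varmx /= SpX entriesE.
Qed.

Lemma det_W_neq0 : \det W != 0.
Proof. by rewrite -unitfE -unitmxE; exact: (PV_wronskian_unit L_PV). Qed.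

(** A point is missing only if a power of the determinant of [X] lies in the span. Then
    [Span_tensor] writes 1 as a combination whose coefficients [b l] satisfy [b l * (\det W)^r = 0],
    hence are all zero. *)
Lemma tau_extend : exists2 s, carrier G s & forall x, E x -> s x = tau x.
Proof.
have [r|M [GM IsoM _]] := @Iso_exists 1; last first.
  by have [s [Gs sE _]] := Iso_extend GM IsoM; exists s.
rewrite mul1r => Sdet; pose delta := \det (varmx kE).
have : Span [set: U] (\sum_(j < 1) 1 *: Sp (delta ^+ r)).
  rewrite big_ord1 scale1r rmorphXn /= Sp_det exprZn.
  exact: (SpanZ setT_subfield).
case/(Span_tensor (y := fun=> 1) (H := fun=> delta ^+ r)) => m [lam [b [yE b0]]].
have b00 l : b l ord0 = 0.
  have := b0 l; rewrite big_ord1 rmorphXn /= evW_det => /eqP.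
  by rewrite mulf_eq0 expf_eq0 (negPf det_W_neq0) andbF orbF fmorph_eq0 => /eqP.
have := yE ord0; rewrite big1 => [/eqP|l _]; first by rewrite oner_eq0.
by rewrite b00 rmorph0 mul0r.
Qed.

End Core.

(** The minimal polynomial of [x] over [k] divides all [h l], hence divides a power of ['X - x%:P],
    and is itself such a power up to a scalar. In characteristic 0 minimality excludes a multiple
    root, so it has degree 1 and [x] lies in [k]. *)
Lemma root_power_rational (k U : fieldType) (iota : {rmorphism k -> U}) (x : U) e r
    (lam : 'I_r -> U) (h : 'I_r -> {poly k}) :
  [pchar U] =i pred0 ->
  (forall l, root (map_poly iota (h l)) x) ->
  ('X - x%:P) ^+ e = \sum_l lam l *: map_poly iota (h l) ->
  exists c, x = iota c.
Proof.
move=> char0 hx sumE.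
have [l hl0] : exists l, h l != 0.
  apply/not_existsP => h0; have : ('X - x%:P) ^+ e != 0 by rewrite expf_neq0 // polyXsubC_eq0.
  rewrite sumE big1 ?eqxx // => l _; have /negP := h0 l; rewrite negbK => /eqP ->.
  by rewrite rmorph0 scaler0.
pose A d := `[< exists2 m : {poly k}, m != 0 & root (map_poly iota m) x /\ size m = d >].
have exA : exists d, A d by exists (size (h l)); apply/asboolP; exists (h l).
case: (ex_minnP exA) => d /asboolP[m m0 [mx sm]] minA.
have m_dvd q : root (map_poly iota q) x -> m %| q.
  move=> qx; rewrite /dvdp; apply: contraT => qm0.
  have : A (size (q %% m)).
    apply/asboolP; exists (q %% m) => //; split=> //.
    move: qx; rewrite {1}(divp_eq q m) rmorphD rmorphM /= !rootE hornerD hornerM.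
    by rewrite (rootP mx) mulr0 add0r.
  by move/minA; rewrite leqNgt -sm ltn_modp m0.
have : map_poly iota m %| ('X - x%:P) ^+ e.
  rewrite sumE; apply: (big_ind (fun q => map_poly iota m %| q)); first exact: dvdp0.
    by move=> p q; exact: dvdp_add.
  by move=> i _; rewrite -mul_polyC dvdp_mull // dvdp_map; exact: m_dvd.
case/dvdp_exp_XsubCP => j _ /eqpf_eq[c c0 mE].
case: j mE => [|[|j]] mE.
- by move: mx; rewrite mE expr0 rootE !hornerE (negPf c0).
- have m1 : iota m`_1 = c by rewrite -coef_map mE !(coefE, mulr0, subr0, mulr1).
  have m00 : iota m`_0 = - (c * x) by rewrite -coef_map mE !(coefE, mulr0, sub0r, mulrN).
  by exists (- m`_0 / m`_1); rewrite rmorphM rmorphN fmorphV m1 m00 opprK mulrC mulKf.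
have m'x : root (map_poly iota m^`()) x.
  rewrite -deriv_map mE derivZ deriv_exp rootE hornerZ hornerMn hornerM horner_exp.
  by rewrite hornerXsubC subrr expr0n mulr0 mul0rn mulr0.
have m'0 : m^`() != 0.
  apply: contraTneq isT => m'0; have sm1 : (1 < size m)%N.
    by rewrite -(size_map_poly iota); apply: root_size_gt1 mx; rewrite map_poly_eq0.
  have := congr1 (fun p : {poly k} => p`_(size m).-2) m'0.
  rewrite coef_deriv coef0 -mulr_natr => /eqP; rewrite mulf_eq0 => /orP[].
    by rewrite prednK -?subn1 ?subn_gt0 // subn1 -lead_coefE lead_coef_eq0 (negPf m0).
  rewrite -(fmorph_eq0 iota) rmorph_nat; move/pcharf0P: char0 => -> //.
have : A (size m^`()) by apply/asboolP; exists m^`().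
by move/minA; rewrite -sm leqNgt lt_size_deriv.
Qed.

(** * Morphisms over [E] moving an element outside [E] *)

Section Moving.
Variables (U : diffFieldType) (K L : set U) (I : eqType) (alpha : I -> U).
Variables (n : nat) (a eta : 'I_n -> U).
Hypotheses (dsfK : is_dsubfield K) (L_PV : PV_for K L a eta).
Local Notation C := (constants K).
Local Notation Cb := (alg_closure_in C).
Local Notation bar F := (compositum F Cb).
Local Notation W := (wronskian eta).
Hypothesis alpha_basis : is_basis C Cb alpha.
Local Notation G := (DGal Cb alpha L K).
Local Notation N := (n * n)%N.
Hypothesis U_closed : diff_closed U.

Lemma dgal_extend E tau : is_dsubfield E -> K `<=` E -> E `<=` L ->
  DHom K E (bar E) tau -> exists2 s, carrier G s & forall x, E x -> s x = tau x.
Proof.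
move=> dsfE KE EL [dtau tauB tauK _]; have [tE tEE] := dhom_rmorphism dsfE dtau.
exact: (tau_extend dsfK L_PV alpha_basis KE EL dtau tauK tEE tauB U_closed).
Qed.

Lemma dgal_wronskian s M : carrier G s -> mxover Cb M ->
  (forall j, s (eta j) = \sum_i M i j * eta i) -> map_mx s W = W *m M.
Proof.
move=> Gs CM sM; apply/matrixP => i j.
have dM l : der (M l j) = 0.
  exact: (alg_closure_const (PV_sfC dsfK) (@PV_dC U K)).
transitivity (\sum_l M l j * iter i der (eta l)); last first.
  by rewrite mxE; apply: eq_bigr => l _; rewrite mxE mulrC.
rewrite !mxE (dhom_iter (PV_dsubfield L_PV) (dgal_dhom Gs)); last exact: (PV_eta L_PV).
rewrite sM; elim: (nat_of_ord i) => [//|e IH] /=.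
by rewrite IH der_sum; apply: eq_bigr => l _; rewrite derM dM mul0r add0r.
Qed.

Section Intermediate.
Variables (E : set U) (dsfE : is_dsubfield E) (KE : K `<=` E) (EL : E `<=` L).
Local Notation kE := (sf_field dsfE.1).
Local Notation iE := (sf_inj dsfE.1).
Local Notation evW := (evW eta (dsfE := dsfE)).
Local Notation Sp := (Sp eta iE).
Local Notation Span := (Span eta iE).
Local Notation Iso := (Iso eta iE).
Local Notation NE := (carrier (DGal Cb alpha L E)).

Let did : is_dhom E id. Proof. by []. Qed.
Let idK x : K x -> id x = x. Proof. by []. Qed.
Let iEE x : iE x = id (iE x). Proof. by []. Qed.
Let idB : id @` E `<=` bar E.
Proof. by move=> _ [x Ex <-]; exact: sub_bar Ex. Qed.

Lemma Iso_dgal M : GL_over Cb M -> Iso M ->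
  exists2 s, NE s & forall j, s (eta j) = \sum_i M i j * eta i.
Proof.
move=> GM IsoM.
have [s [[ds sb sK sr] sE sM]] :=
  Iso_extend dsfK L_PV alpha_basis KE EL did idK iEE idB GM IsoM.
by exists s.
Qed.

Lemma dgal_eval s M y : NE s -> mxover Cb M ->
  (forall j, s (eta j) = \sum_i M i j * eta i) -> s (evW y) = (Sp y).@[entries M].
Proof.
move=> Ns CM sM; have Gs := dgal_sub KE Ns; have [_ _ sEE _] := Ns.
have ds := dgal_dhom Gs.
rewrite Sp_eval.
have LE c : L (iE c) by apply: EL; exact: sf_inj_over.
have Lev := evW_L L_PV EL.
elim/mpoly_gen_ind: y => [c|k|y z IHy IHz|y z IHy IHz].
- by rewrite evWC mmapC sEE //; exact: sf_inj_over.
- rewrite evWX mmapX mmap1U; case/mxvec_indexP: k => i j; rewrite !entriesE.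
  by rewrite -(dgal_wronskian Gs CM sM) [RHS]mxE.
- by rewrite !rmorphD /= (dhomD ds) ?IHy ?IHz //; exact: Lev.
- by rewrite !rmorphM /= (dhomM ds) ?IHy ?IHz //; exact: Lev.
Qed.

Lemma dgal_moves x : L x -> ~ E x -> exists2 s, NE s & s x <> x.
Proof.
move=> Lx nEx; have [p [q [q0 xE]]] := L_frac dsfK L_PV dsfE KE Lx.
(* At the matrix of a morphism [s] over [E], the value of [f] is [s (evW q) * (s x - x)]; so [s]
   moves [x] as soon as [f] does not vanish there. *)
pose f := Sp p - x *: Sp q.
have [r Sf|M [GM IsoM fM]] :=
    Iso_exists dsfK L_PV alpha_basis KE EL did idK iEE idB U_closed (f := f).
  (* A power of [f] times the determinant lies in the span; the relations over [E] given by
     [Span_tensor] are polynomials with root [x] that span [(X - x)^r]. *)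
  pose delta := \det (varmx n kE).
  have fE : (\det W) ^+ r *: (f * \det (varmx n U)) ^+ r =
      \sum_(i < r.+1) (- x) ^+ i *: Sp ((p ^+ (r - i) * q ^+ i * delta ^+ r) *+ 'C(r, i)).
    have -> : (\det W) ^+ r *: (f * \det (varmx n U)) ^+ r = f ^+ r * Sp delta ^+ r.
      by rewrite Sp_det exprZn exprMn -scalerAr.
    rewrite /f -scaleNr exprDn mulr_suml; apply: eq_bigr => i _.
    rewrite rmorphMn !rmorphM !rmorphXn /= exprZn -scalerAr scalerMnr.
    by rewrite -scalerAl mulrnAl.
  have : Span [set: U] (\sum_(i < r.+1) (- x) ^+ i *:
      Sp ((p ^+ (r - i) * q ^+ i * delta ^+ r) *+ 'C(r, i))).
    by rewrite -fE; exact: (SpanZ (setT_subfield U)).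
  case/(Span_tensor L_PV did iEE (y := fun i : 'I_r.+1 => (- x) ^+ i) (H := fun i : 'I_r.+1 =>
    (p ^+ (r - i) * q ^+ i * delta ^+ r) *+ 'C(r, i))) => m [lam [b [yE b0]]].
  pose h l : {poly kE} := \sum_(i < r.+1) (b l i *+ 'C(r, i)) *: 'X^(r - i).
  have mapX (i : nat) : map_poly iE 'X^i = 'X^i by rewrite rmorphXn /= map_polyX.
  have [|l||c xc] := @root_power_rational _ _ iE x r m lam h; first exact: diff_pchar0.
  - have := b0 l; rewrite /h rmorph_sum rootE horner_sum => bl.
    have s0 : evW q ^+ r * \det W ^+ r != 0 by rewrite mulf_neq0 ?expf_neq0 ?(det_W_neq0 L_PV).
    rewrite -(mulIr_eq0 _ (mulIf s0)) mulr_suml; apply/eqP; rewrite -[RHS]bl.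
    apply: eq_bigr => i _; rewrite /= map_polyZ mapX hornerZ hornerXn rmorphMn.
    rewrite rmorphMn !rmorphM !rmorphXn /= evW_det.
    have -> : evW p = x * evW q by rewrite xE divfK.
    have qr : evW q ^+ r = evW q ^+ (r - i) * evW q ^+ i.
      by rewrite -exprD subnK // -ltnS.
    rewrite exprMn qr; ring.
  - rewrite exprDn.
    transitivity (\sum_(i < r.+1) ((- x) ^+ i *+ 'C(r, i)) *: 'X^(r - i)).
      apply: eq_bigr => i _; rewrite -polyCN -polyC_exp mulrC mul_polyC.
      by rewrite scalerMnl.
    under eq_bigr => i _ do rewrite yE -sumrMnl scaler_suml.
    rewrite exchange_big; apply: eq_bigr => l _; rewrite /h rmorph_sum scaler_sumr.
    apply: eq_bigr => i _; rewrite /= map_polyZ mapX scalerA rmorphMn mulrnAr.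
    by rewrite mulrC.
  - by exfalso; apply: nEx; rewrite xc; exact: sf_inj_over.
have [s Ns sM] := Iso_dgal GM IsoM; exists s => // sx.
have Gs := dgal_sub KE Ns.
have sT y := dgal_eval y Ns GM.2 sM.
have ds := dgal_dhom Gs.
move/negP: fM; apply; rewrite /f mevalB mevalZ -!sT subr_eq0; apply/eqP.
have Lev := evW_L L_PV EL.
have -> : evW p = x * evW q by rewrite xE divfK.
by rewrite (dhomM ds) // sx.
Qed.

End Intermediate.
End Moving.

(** * Minimal polynomials, conjugates and primitive elements *)

Lemma poly_splits (U : fieldType) (p : {poly U}) :
  (forall q : {poly U}, size q != 1%N -> exists x, root q x) -> p != 0 ->
  exists s, p = lead_coef p *: \prod_(x <- s) ('X - x%:P).
Proof.
move=> Ucl; have [m] := ubnP (size p); elim: m p => // m IH p /ltnSE le_m p0.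
have [sp|/Ucl[x px]] := eqVneq (size p) 1%N.
  exists [::]; rewrite big_nil alg_polyC; apply/polyP => i.
  by rewrite {1}(size1_polyC (p := p)) ?sp // lead_coefE sp.
have [q pE] := factor_theorem _ _ px.
have q0 : q != 0 by apply: contraNneq p0 => q0; rewrite pE q0 mul0r.
have [|s qE] := IH q _ q0.
  by apply: leq_trans le_m; rewrite pE size_Mmonic ?monicXsubC // size_XsubC addn2.
have lp : lead_coef p = lead_coef q.
  by rewrite pE lead_coefM lead_coefXsubC mulr1.
by exists (x :: s); rewrite lp big_cons [LHS]pE {1}qE -scalerAl mulrC.
Qed.

Section Conjugates.
Variables (k U : fieldType) (iota : {rmorphism k -> U}).
Hypothesis char0 : [pchar k] =i pred0.
Hypothesis U_closed : forall q : {poly U}, size q != 1%N -> exists x, root q x.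

(** [m] is the minimal polynomial of [th] and [s] the list of its roots. Separability makes the
    roots distinct, which gives the divisibility by [m]; a polynomial over [k] not vanishing at [th]
    is coprime to [m], which gives the last clause. *)
Lemma conjugates (th : U) : algebraicOver iota th -> exists (m : {poly k}) (s : seq U),
  [/\ m != 0 /\ root (map_poly iota m) th,
      forall q : {poly U}, {in s, forall x, root q x} -> map_poly iota m %| q &
      forall x, x \in s -> forall p : {poly k},
        root (map_poly iota p) x = root (map_poly iota p) th].
Proof.
move=> [m1 m10 m1x].
pose A d := `[< exists2 m : {poly k}, m != 0 & root (map_poly iota m) th /\ size m = d >].
have exA : exists d, A d by exists (size m1); apply/asboolP; exists m1.
case: (ex_minnP exA) => d /asboolP[m m0 [mx sm]] minA.
have min p : p != 0 -> root (map_poly iota p) th -> (size m <= size p)%N.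
  by move=> p0 px; rewrite sm; apply: minA; apply/asboolP; exists p.
have copr p : ~~ root (map_poly iota p) th -> coprimep m p.
  move=> px; have /dvdpP[h mE] := dvdp_gcdl m p.
  have g0 : gcdp m p != 0 by rewrite gcdp_eq0 negb_and m0.
  have h0 : h != 0 by apply: contraNneq m0 => h0; rewrite mE h0 mul0r.
  have gx : ~~ root (map_poly iota (gcdp m p)) th.
    apply: contra px; have /dvdpP[h' pE] := dvdp_gcdr m p.
    by move=> gx; rewrite pE rmorphM rootM gx orbT.
  move: mx; rewrite {1}mE rmorphM rootM (negPf gx) orbF => /(min _ h0).
  rewrite {1}mE size_mul // -{2}[size h]addn0 /coprimep.
  have : (0 < size (gcdp m p))%N by rewrite size_poly_gt0.
  by case: (size _) => // e _; rewrite addnS /= leq_add2l leqn0 => /eqP ->.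
have sep : separable_poly m.
  rewrite unlock; apply: (copr m^`()); apply/negP => m'x; have m'0 : m^`() != 0.
    apply/negP => /eqP m'0; have sm1 : (1 < size m)%N.
      by rewrite -(size_map_poly iota); apply: root_size_gt1 mx; rewrite map_poly_eq0.
    have := congr1 (fun p : {poly k} => p`_(size m).-2) m'0.
    rewrite coef_deriv coef0 -mulr_natr => /eqP; rewrite mulf_eq0 => /orP[].
      by rewrite prednK -?subn1 ?subn_gt0 // subn1 -lead_coefE lead_coef_eq0 (negPf m0).
    by move/pcharf0P: char0 => -> //.
  by have := min _ m'0 m'x; rewrite leqNgt lt_size_deriv.
have mi0 : map_poly iota m != 0 by rewrite map_poly_eq0.
have [s sE] := poly_splits U_closed mi0.
have us : uniq s.
  move: sep; rewrite -(separable_map iota) -separable_prod_XsubC.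
  by apply: dvdp_separable; rewrite [X in _ %| X]sE dvdpZr ?lead_coef_eq0.
exists m, s; split=> // [q qs|x xs p].
  rewrite sE dvdpZl ?lead_coef_eq0 //; apply: uniq_roots_dvdp.
    by apply/allP.
  by rewrite uniq_rootsE.
have msx : root (map_poly iota m) x.
  by rewrite sE rootZ ?lead_coef_eq0 // root_prod_XsubC.
apply/idP/idP => [px|px].
  apply: contraLR (px) => /copr; rewrite -(coprimep_map iota) => /coprimep_root.
  by move/(_ _ msx).
have /dvdpP[h ->] : m %| p.
  rewrite /dvdp; apply: contraT => pm0.
  have pmx : root (map_poly iota (p %% m)) th.
    move: px; rewrite {1}(divp_eq p m) rmorphD rmorphM /= !rootE hornerD hornerM.
    by rewrite (rootP mx) mulr0 add0r.
  by have := min _ pm0 pmx; rewrite leqNgt ltn_modp m0.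
by rewrite rmorphM rootM msx orbT.
Qed.

Lemma primitive_element r (c : 'I_r -> U) : (forall i, algebraicOver iota (c i)) ->
  exists th (P : 'I_r -> {poly k}),
    algebraicOver iota th /\ forall i, c i = (map_poly iota (P i)).[th].
Proof.
elim: r c => [|r IH] c algc.
  by exists 0, (fun=> 0); split=> [|[]//]; exact: algebraic0.
have [z [P [[rz rz0 rzz] cE]]] := IH (fun i => c (lift ord0 i)) (fun i => algc _).
have [rx rx0 rxx] := algc ord0.
have rzN : root (map_poly iota (rz \Po - 'X)) (- z).
  by rewrite map_comp_poly root_comp /= rmorphN /= map_polyX hornerN hornerX opprK.
have rzN0 : rz \Po - 'X != 0.
  apply: contraNneq rz0 => /(congr1 (fun p => p \Po - 'X)).
  by rewrite -comp_polyA comp_poly0 raddfN /= comp_polyX opprK comp_polyXr => ->.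
have [e [[pz zE] [px xE]]] := pchar0_PET rzN0 rzN rx0 rxx char0.
set w := c ord0 *+ e - - z in zE xE.
exists w, (fun i => if unlift ord0 i is Some j then P j \Po (- pz) else px); split.
  rewrite /w opprK; apply: algebraic_add; last by exists rz.
  by rewrite -mulr_natr; apply: algebraic_mul => //; rewrite -(rmorph_nat iota); exact: algebraic_id.
move=> i; case: (unliftP ord0 i) => [j ->|-> //].
rewrite map_comp_poly horner_comp raddfN /= hornerN zE opprK.
exact: cE.
Qed.

End Conjugates.

(** * Finitely generated intermediate fields *)

Section FinitelyGenerated.
Variable U : diffFieldType.
Implicit Types (F E : set U) (s : seq U).

Definition adjoin F s : set U := compositum F [set` s].

Lemma adjoin_subfield F s : is_subfield (adjoin F s).
Proof. exact: smallest_subfield. Qed.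

Lemma sub_adjoin F s : F `<=` adjoin F s.
Proof. by move=> x Fx; apply: sub_gen_smallest; left. Qed.

Lemma mem_adjoin F s x : x \in s -> adjoin F s x.
Proof. by move=> sx; apply: sub_gen_smallest; right. Qed.

Lemma adjoin_min F s E : is_subfield E -> F `<=` E -> (forall x, x \in s -> E x) ->
  adjoin F s `<=` E.
Proof. by move=> sfE FE sE; apply: smallest_sub => // x [/FE|/sE]. Qed.

Lemma adjoin_sub F F' s s' : F `<=` F' -> {subset s <= s'} -> adjoin F s `<=` adjoin F' s'.
Proof.
move=> FF' ss'; apply: adjoin_min (adjoin_subfield _ _) _ _ => [x /FF'|x /ss'].
  exact: sub_adjoin.
exact: mem_adjoin.
Qed.

Lemma adjoin1_frac F (sfF : is_subfield F) x y : adjoin F [:: x] y ->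
  exists p q : {poly sf_field sfF}, (map_poly (sf_inj sfF) q).[x] != 0 /\
    y * (map_poly (sf_inj sfF) q).[x] = (map_poly (sf_inj sfF) p).[x].
Proof.
set i := sf_inj sfF; pose ev (p : {poly sf_field sfF}) := (map_poly i p).[x].
pose A : set U := [set y | exists p q, ev q != 0 /\ y * ev q = ev p].
have evM p q : ev (p * q) = ev p * ev q by rewrite /ev rmorphM hornerM.
have evB p q : ev (p - q) = ev p - ev q by rewrite /ev rmorphB hornerD hornerN.
have ev1 : ev 1 = 1 by rewrite /ev rmorph1 hornerC.
suff : adjoin F [:: x] `<=` A by move=> H /H.
apply: adjoin_min.
- split.
  + by exists 1, 1; rewrite ev1 oner_neq0 mulr1.
  + move=> z t [p [q [q0 zE]]] [p' [q' [q'0 tE]]].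
    exists (p * q' - p' * q), (q * q'); rewrite evB !evM mulf_neq0 // -zE -tE.
    by split=> //; ring.
  + move=> z t [p [q [q0 zE]]] [p' [q' [q'0 tE]]].
    exists (p * p'), (q * q'); rewrite !evM mulf_neq0 // -zE -tE.
    by split=> //; ring.
  + move=> z [p [q [q0 zE]]]; have [z0|z0] := eqVneq z 0.
      exists 0, 1; rewrite ev1 oner_neq0 z0 invr0 mul0r; split=> //.
      by rewrite /ev rmorph0 horner0.
    by exists q, p; rewrite -zE mulf_neq0 // mulKf.
- move=> z Fz; have [c <-] := sf_injP sfF Fz.
  by exists c%:P, 1; rewrite ev1 oner_neq0 mulr1 /ev map_polyC hornerC.
- move=> z; rewrite inE => /eqP ->; exists 'X, 1.
  by rewrite ev1 oner_neq0 mulr1 /ev map_polyX hornerX.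
Qed.

(* If [E] contains some [e] outside [F], then [x] is algebraic over [F(e)], so that
   [E] has finite dimension over [F(e)]. *)
Lemma fg_adjoin1 F E x : is_subfield F -> is_subfield E -> F `<=` E ->
  E `<=` adjoin F [:: x] ->
  exists t, (forall y, y \in t -> E y) /\ E `<=` adjoin F t.
Proof.
move=> sfF sfE FE EFx; have [EF|/existsNP[e /not_implyP[Ee nFe]]] := pselect (E `<=` F).
  by exists [::]; split=> // y /EF; exact: sub_adjoin.
pose F1 := adjoin F [:: e]; have sfF1 : is_subfield F1 by exact: adjoin_subfield.
have F1E : F1 `<=` E by apply: adjoin_min => // y; rewrite inE => /eqP ->.
pose i := sf_inj sfF1; pose ev (p : {poly sf_field sfF1}) := (map_poly i p).[x].
have EF1x y : E y -> adjoin F1 [:: x] y.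
  by move=> /EFx; apply: adjoin_sub => //; exact: sub_adjoin.
have [m mm mx] : integralOver i x.
  apply/integral_algebraic; have [p [q [q0 eE]]] := adjoin1_frac sfF (EFx _ Ee).
  pose up (r : {poly sf_field sfF}) := map_poly (sf_inj sfF) r.
  have [p' p'E] : exists p', up p = map_poly i p'.
    by apply: (poly_overP sfF1) => j; rewrite coef_map; apply: sub_adjoin; exact: sf_inj_over.
  have [q' q'E] : exists q', up q = map_poly i q'.
    by apply: (poly_overP sfF1) => j; rewrite coef_map; apply: sub_adjoin; exact: sf_inj_over.
  have [e' e'E] : exists e', i e' = e by apply: sf_injP; apply: mem_adjoin; rewrite inE.
  exists (p' - e' *: q'); last first.
    rewrite rootE rmorphB /= map_polyZ -p'E -q'E hornerD hornerN hornerZ.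
    by rewrite -[(up p).[x]]eE [i e']e'E subrr.
  (* If [p = e q] as polynomials, the coefficients in the degree of [q] express [e] as a quotient of
     elements of [F]. *)
  apply: contra_not_neq nFe => pq0.
  have q1 : q != 0 by apply: contraNneq q0 => ->; rewrite rmorph0 horner0.
  have := congr1 (fun r : {poly U} => r`_(size q).-1) (congr1 (map_poly i) pq0).
  rewrite rmorphB rmorph0 /= map_polyZ -p'E -q'E coefB coefZ coef0 !coef_map.
  move=> /eqP; rewrite subr_eq0 => /eqP pe.
  have lq : sf_inj sfF (lead_coef q) != 0 by rewrite fmorph_eq0 lead_coef_eq0.
  have -> : e = sf_inj sfF p`_(size q).-1 / sf_inj sfF (lead_coef q).
    by apply: (mulIf lq); rewrite divfK // pe [i e']e'E.
  by apply: (subfield_div sfF); exact: sf_inj_over.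
pose d := (size m).-1.
have low p : exists c : 'I_d -> U, (forall j, F1 (c j)) /\ ev p = \sum_j c j * x ^+ j.
  exists (fun j => i (p %% m)`_j); split=> [j|]; first exact: sf_inj_over.
  rewrite [ev p]/ev {1}(divp_eq p m) rmorphD rmorphM /= hornerD hornerM (rootP mx) mulr0 add0r.
  rewrite (@horner_coef_wide _ d); first by apply: eq_bigr => j _; rewrite coef_map.
  rewrite size_map_poly -ltnS prednK ?ltn_modp ?monic_neq0 //.
  by rewrite size_poly_gt0 monic_neq0.
pose A r := `[< exists v : 'I_r -> U, (forall j, E (v j)) /\ lfree F1 v >].
have exA : exists r, A r.
  by exists 0%N; apply/asboolP; exists (fun=> 0); split=> [[]//|c _ _ []].
have ubA r : A r -> (r <= d)%N.
  move=> /asboolP[v [Ev vfree]]; rewrite leqNgt; apply/negP => lt_dr.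
  have /choice[pq pqE] : forall j, exists pq : {poly sf_field sfF1} * {poly sf_field sfF1},
      ev pq.2 != 0 /\ v j * ev pq.2 = ev pq.1.
    by move=> j; have [p [q pqE]] := adjoin1_frac sfF1 (EF1x _ (Ev j)); exists (p, q).
  (* A common denominator turns the [v j] into polynomials in [x], which lie in the span of the [d]
     first powers of [x]; more than [d] of them cannot be free over [F1]. *)
  pose q := \prod_j (pq j).2.
  have evM p1 p2 : ev (p1 * p2) = ev p1 * ev p2 by rewrite /ev rmorphM hornerM.
  have q0 : ev q != 0.
    apply: (big_ind (fun q => ev q != 0)); first by rewrite /ev rmorph1 hornerC oner_neq0.
      by move=> *; rewrite evM mulf_neq0.
    by move=> j _; have [] := pqE j.
  have vq j : v j * ev q = ev ((pq j).1 * \prod_(k | k != j) (pq k).2).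
    by rewrite /q (bigD1 j) //= !evM mulrA (pqE j).2.
  have /choice[c cE] : forall j, exists c : 'I_d -> U, (forall k, F1 (c k)) /\
      v j * ev q = \sum_k c k * x ^+ k by move=> j; rewrite vq.
  have [|k [F1k k0 kc]] := mxover_kernel sfF1 (A := \matrix_(j, l) c j l) _ lt_dr.
    by move=> j l; rewrite mxE; have [] := cE j.
  move/negP: k0; apply; apply/eqP/rowP => j; rewrite [RHS]mxE.
  apply: (vfree (k 0)); first by move=> l; exact: F1k.
  apply: (mulIf q0); rewrite mul0r mulr_suml.
  under eq_bigr => l _ do rewrite -mulrA (cE l).2 mulr_sumr.
  rewrite exchange_big big1 //= => l _.
  have := congr1 (fun M : 'rV[U]_d => M 0 l * x ^+ l) kc.
  rewrite [in RHS]mxE mul0r => kc0; rewrite -[RHS]kc0 mxE mulr_suml.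
  by apply: eq_bigr => l' _; rewrite mxE mulrA.
case: (ex_maxnP exA ubA) => r /asboolP[v [Ev vfree]] maxr.
exists (e :: codom v); split.
  by move=> y; rewrite inE => /orP[/eqP -> //|/codomP[j ->]].
have sfA : is_subfield (adjoin F (e :: codom v)) by exact: adjoin_subfield.
have F1A : F1 `<=` adjoin F (e :: codom v).
  by apply: adjoin_sub => // y; rewrite !inE => ->.
move=> y Ey; pose g (j : 'I_r.+1) := if unlift ord0 j is Some j' then v j' else y.
have : ~ lfree F1 g.
  move=> gfree; have := maxr r.+1; rewrite ltnn => H; apply/notF/H/asboolP; exists g.
  by split=> // j; rewrite /g; case: unlift.
move=> /existsNP[c /not_implyP[F1c /not_implyP[]]].
rewrite big_ord_recl /= {1}/g unlift_none.
under eq_bigr => j _ do rewrite /g liftK.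
move=> cu /existsNP[j0 cj0].
have c0 : c ord0 != 0.
  apply: contra_notN cj0 => /eqP c0; move: cu; rewrite c0 mul0r add0r => cu.
  case: (unliftP ord0 j0) => [j ->|-> //].
  by apply: (vfree (fun j => c (lift ord0 j))).
have -> : y = (- \sum_j c (lift ord0 j) * v j) / c ord0.
  by apply: (mulfI c0); rewrite mulrC [RHS]mulrC divfK //; apply/eqP;
    rewrite mulrC -addr_eq0 cu.
apply: (subfield_div sfA); last exact: F1A.
apply: (subfieldN sfA); apply: (subfield_sum sfA) => j _.
apply: (subfieldM sfA); first exact: F1A.
by apply: mem_adjoin; rewrite inE codom_f orbT.
Qed.

Lemma adjoin1_finitary F E x : F `<=` E -> adjoin E [:: x] `<=`
  [set y | exists c, (forall z, z \in c -> E z) /\ adjoin F (x :: c) y].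
Proof.
move=> FE; have sub1 c c' : adjoin F (x :: c) `<=` adjoin F (x :: c ++ c').
  by apply: adjoin_sub => // y; rewrite !inE mem_cat => /orP[->//|->]; rewrite orbT.
have sub2 c c' : adjoin F (x :: c) `<=` adjoin F (x :: c' ++ c).
  by apply: adjoin_sub => // y; rewrite !inE mem_cat => /orP[->//|->]; rewrite !orbT.
have Ecat c c' : (forall z, z \in c -> E z) -> (forall z, z \in c' -> E z) ->
    forall z, z \in c ++ c' -> E z.
  by move=> Ec Ec' z; rewrite mem_cat => /orP[/Ec|/Ec'].
apply: adjoin_min.
- split.
  + by exists [::]; split=> //; exact: (subfield1 (adjoin_subfield _ _)).
  + move=> y z [c [Ec Fy]] [c' [Ec' Fz]]; exists (c ++ c'); split; first exact: Ecat.
    by apply: (subfieldB (adjoin_subfield _ _)); [exact: sub1 | exact: sub2].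
  + move=> y z [c [Ec Fy]] [c' [Ec' Fz]]; exists (c ++ c'); split; first exact: Ecat.
    by apply: (subfieldM (adjoin_subfield _ _)); [exact: sub1 | exact: sub2].
  + move=> y [c [Ec Fy]]; exists c; split=> //.
    exact: (subfieldV (adjoin_subfield _ _)).
- move=> y Ey; exists [:: y]; split; first by move=> z; rewrite inE => /eqP ->.
  by apply: mem_adjoin; rewrite !inE eqxx orbT.
- move=> y; rewrite inE => /eqP ->; exists [::]; split=> //.
  by apply: mem_adjoin; rewrite inE.
Qed.

(** By induction [E(x)] is generated over [F(x)] by a finite list, and the elements of this list
    involve only a finite list [c] of elements of [E]. Hence [E] lies between [F(c)] and [F(c)(x)],
    and the case of one generator applies. *)
Lemma fg_subfield s F E : is_subfield F -> is_subfield E -> F `<=` E ->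
  E `<=` adjoin F s -> exists t, (forall y, y \in t -> E y) /\ E `<=` adjoin F t.
Proof.
elim: s F E => [|x s IH] F E sfF sfE FE EFs; first by exists [::].
pose F1 := adjoin F [:: x]; pose E1 := adjoin E [:: x].
have [||||t1 [Et1 E1t1]] := IH F1 E1.
- exact: adjoin_subfield.
- exact: adjoin_subfield.
- exact: adjoin_sub.
- apply: adjoin_min; first exact: adjoin_subfield.
    apply: subset_trans EFs _; apply: adjoin_min; first exact: adjoin_subfield.
      by move=> y Fy; do 2!apply: sub_adjoin.
    move=> y; rewrite inE => /orP[/eqP ->|]; last exact: mem_adjoin.
    by apply: sub_adjoin; apply: mem_adjoin; rewrite inE.
  by move=> y; rewrite inE => /eqP ->; apply: sub_adjoin; apply: mem_adjoin; rewrite inE.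
have [c [Ec t1c]] : exists c, (forall z, z \in c -> E z) /\
    forall y, y \in t1 -> adjoin F (x :: c) y.
  elim: t1 Et1 {E1t1} => [|y t1 IHt] Et1; first by exists [::].
  have [z zt1|c [Ec cE]] := IHt; first by apply: Et1; rewrite inE zt1 orbT.
  have [c' [Ec' c'y]] := adjoin1_finitary FE (Et1 y (mem_head _ _)).
  exists (c ++ c'); split; first by move=> z; rewrite mem_cat => /orP[/Ec|/Ec'].
  move=> z; rewrite inE => /orP[/eqP ->|/cE]; last first.
    by apply: adjoin_sub => // w; rewrite !inE mem_cat => /orP[->//|->]; rewrite orbT.
  move: c'y; apply: adjoin_sub => // w.
  by rewrite !inE mem_cat => /orP[->//|->]; rewrite !orbT.
pose F2 := adjoin F c.
have F2E : F2 `<=` E by exact: adjoin_min.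
have EF2 : E `<=` adjoin F2 [:: x].
  apply: (@subset_trans _ E1); first exact: sub_adjoin.
  apply: subset_trans E1t1 _.
  have sub : adjoin F (x :: c) `<=` adjoin F2 [:: x].
    apply: adjoin_min; first exact: adjoin_subfield.
      by move=> y Fy; do 2!apply: sub_adjoin.
    move=> y; rewrite inE => /orP[/eqP ->|yc]; first by apply: mem_adjoin; rewrite inE.
    by apply: sub_adjoin; exact: mem_adjoin.
  apply: adjoin_min; first exact: adjoin_subfield.
    apply: adjoin_sub => //; exact: sub_adjoin.
  by move=> y /t1c /sub.
have [t2 [Et2 EF2t2]] := fg_adjoin1 (adjoin_subfield _ _) sfE F2E EF2.
exists (c ++ t2); split; first by move=> z; rewrite mem_cat => /orP[/Ec|/Et2].
apply: subset_trans EF2t2 _; apply: adjoin_min; first exact: adjoin_subfield.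
  by apply: adjoin_sub => // y yc; rewrite mem_cat yc.
by move=> y yt; apply: mem_adjoin; rewrite mem_cat yt orbT.
Qed.

End FinitelyGenerated.

(** The Cauchy-Binet expansion before the terms are grouped, over all maps [h] and not only the
    increasing ones. The indexing by maps lets the minors be permuted or degenerate without case
    distinctions. *)
Lemma det_mulmx_expand (R : comNzRingType) r D (B : 'M[R]_(r, D)) (Y : 'M[R]_(D, r)) :
  \det (B *m Y) = \sum_(h : {ffun 'I_r -> 'I_D}) \det (colsub h B) * \prod_j Y (h j) j.
Proof.
rewrite -det_tr /determinant.
transitivity (\sum_(s : 'S_r) \sum_(h : {ffun 'I_r -> 'I_D})
    (-1) ^+ s * \prod_i (B (s i) (h i) * Y (h i) i)).
  apply: eq_bigr => s _; rewrite -big_distrr /=; congr (_ * _).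
  rewrite -(bigA_distr_bigA (fun i k => B (s i) k * Y k i)).
  by apply: eq_bigr => i _; rewrite !mxE.
rewrite exchange_big; apply: eq_bigr => h _ /=.
rewrite -[X in X * _]det_tr /determinant mulr_suml; apply: eq_bigr => s _.
rewrite big_split /= mulrA; congr (_ * _ * _).
by apply: eq_bigr => i _; rewrite !mxE.
Qed.

Lemma det_replace_col (R : comNzRingType) r (A : 'M[R]_r) (i : 'I_r) :
  (forall l k, k != i -> A l k = (l == k)%:R) -> \det A = A i i.
Proof.
move=> A1; rewrite (expand_det_row A i) (bigD1 i) //= big1 ?addr0 => [|k ki]; last first.
  by rewrite A1 // eq_sym (negPf ki) mul0r.
rewrite /cofactor -signr_odd addnn odd_double expr0 mul1r (_ : row' i (col' i A) = 1%:M).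
  by rewrite det1 mulr1.
apply/matrixP => l k; rewrite !mxE A1; last by rewrite eq_sym neq_lift.
by rewrite (inj_eq lift_inj).
Qed.

Section WronskianAction.
Variable U : diffFieldType.

Lemma iter_der_comb i r (y : 'I_r -> U) (c : 'I_r -> U) : (forall k, der (c k) = 0) ->
  iter i der (\sum_k y k * c k) = \sum_k iter i der (y k) * c k.
Proof.
move=> c0; elim: i => //= i ->; rewrite der_sum; apply: eq_bigr => k _.
by rewrite derM c0 mulr0 addr0.
Qed.

Lemma wronskian_comb r (y : 'I_r -> U) (S : 'M_r) : (forall k j, der (S k j) = 0) ->
  wronskian (fun j => \sum_k y k * S k j) = wronskian y *m S.
Proof.
move=> S0; apply/matrixP => i j; rewrite [LHS]mxE [RHS]mxE iter_der_comb //.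
by apply: eq_bigr => k _; rewrite [wronskian y i k]mxE.
Qed.

(* By Leibniz' rule, the two wronskian matrices differ by a triangular factor with
   diagonal [mu]. *)
Lemma det_wronskian_scale r (mu : U) (y : 'I_r -> U) :
  \det (wronskian (fun j => mu * y j)) = mu ^+ r * \det (wronskian y).
Proof.
have /choice[t tE] : forall i : nat, exists t : nat -> U, t i = mu /\
    forall x, iter i der (mu * x) = \sum_(k < i.+1) t k * iter k der x.
  elim=> [|i [t [ti tE]]].
    by exists (fun=> mu); split=> // x; rewrite big_ord1.
  exists (fun k => (if (k <= i)%N then der (t k) else 0) + if k is k'.+1 then t k' else 0).
  rewrite ltnn add0r; split=> // x.
  rewrite iterS tE der_sum.
  under eq_bigr => k _ do rewrite derM -iterS.
  rewrite big_split /=; under [RHS]eq_bigr => k _ do rewrite mulrDl.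
  rewrite big_split /=; congr (_ + _).
    rewrite [RHS]big_ord_recr /= ltnn mul0r addr0; apply: eq_bigr => k _.
    by rewrite -ltnS ltn_ord.
  by rewrite [RHS]big_ord_recl /= mul0r add0r.
pose T : 'M[U]_r := \matrix_(i, k) if (k <= i)%N then t i k else 0.
have -> : wronskian (fun j => mu * y j) = T *m wronskian y.
  apply/matrixP => i j; rewrite [LHS]mxE (tE i).2 [RHS]mxE.
  rewrite (big_ord_widen r (fun k => t i k * iter k der (y j))) // big_mkcond /=.
  apply: eq_bigr => k _; rewrite [T i k]mxE [wronskian y k j]mxE ltnS.
  by case: ifP; rewrite ?mul0r.
rewrite det_mulmx det_trig; last first.
  by apply/is_trig_mxP => i j ij; rewrite mxE leqNgt ij.
congr (_ * _); under eq_bigr => i _ do rewrite mxE leqnn (tE i).1.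
by rewrite prodr_const card_ord.
Qed.

(** A transformation known on a generating family [x], possibly with redundancies, is carried to a
    [C]-basis extracted from it. The scalar [mu] is kept apart because it need not belong to [D]. *)
Lemma stable_basis (C D : set U) (T : finType) (x : T -> U) :
  is_subfield C -> is_subfield D -> C `<=` D ->
  exists M (f : 'I_M -> T) (b : 'I_M -> T -> U),
  [/\ lfree C (x \o f), forall i t, C (b i t), forall t, x t = \sum_i b i t * x (f i) &
    forall (y : T -> U) mu (c : T -> T -> U), (forall t t', D (c t t')) ->
      (forall t, y t = mu * \sum_t' x t' * c t' t) ->
      exists S : 'M_M, mxover D S /\
        forall j, y (f j) = mu * \sum_k x (f k) * S k j].
Proof.
move=> sfC sfD CD; have [M [f [B [free CB xE]]]] :=
  extract_basis sfC (fun j : 'I_#|T| => x (enum_val j)).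
have xE' t : x t = \sum_i B i (enum_rank t) * x (enum_val (f i)).
  by rewrite -[in LHS](enum_rankK t) xE.
exists M, (enum_val \o f), (fun i t => B i (enum_rank t)); split=> // y mu c Dc yE.
exists (\matrix_(k, j) \sum_t B k (enum_rank t) * c t (enum_val (f j))); split.
  move=> k j; rewrite mxE; apply: (subfield_sum sfD) => t _; apply: (subfieldM sfD) => //.
  exact: CD.
move=> j; rewrite yE; congr (_ * _).
under eq_bigr => t _ do rewrite xE' mulr_suml.
rewrite exchange_big; apply: eq_bigr => k _; rewrite mxE mulr_sumr.
by apply: eq_bigr => t _ /=; rewrite mulrAC mulrC.
Qed.

End WronskianAction.

(** * The Galois correspondence *)

Lemma dhom_mpoly (U V : diffFieldType) (F : set U) (f : U -> V) N (p : {mpoly U[N]}) :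
  is_dsubfield F -> is_dhom F f -> mpolyover F p ->
  exists2 q : {mpoly V[N]}, forall m, q@_m = f p@_m &
    forall v, (forall i, F (v i)) -> q.@[f \o v] = f p.@[v].
Proof.
move=> dsfF df /(mpolyoverP dsfF.1)[r ->].
have [g gE] := dhom_rmorphism dsfF df; exists (map_mpoly g r).
  by move=> m; rewrite !mcoeff_map_mpoly /= gE.
move=> v Fv; have Fr (y : {mpoly (sf_field dsfF.1)[N]}) :
    F (map_mpoly (sf_inj dsfF.1) y).@[v].
  apply: (mpolyover_eval dsfF.1) => // m.
  by rewrite mcoeff_map_mpoly; exact: sf_inj_over.
elim/mpoly_gen_ind: r => [c|k|y z IHy IHz|y z IHy IHz].
- by rewrite !map_mpolyC !mevalC /= gE.
- by rewrite !map_mpolyX !mevalXU.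
- by rewrite !rmorphD /= (dhomD df) // IHy IHz.
- by rewrite !rmorphM /= (dhomM df) // IHy IHz.
Qed.

Section Correspondence.
Variables (U : diffFieldType) (K L : set U) (I : eqType) (alpha : I -> U).
Variables (n : nat) (a eta : 'I_n -> U).
Hypotheses (dsfK : is_dsubfield K) (L_PV : PV_for K L a eta).
Local Notation C := (constants K).
Local Notation Cb := (alg_closure_in C).
Local Notation bar F := (compositum F Cb).
Local Notation W := (wronskian eta).
Hypothesis alpha_basis : is_basis C Cb alpha.
Local Notation G := (DGal Cb alpha L K).
Local Notation N := (n * n)%N.
Local Notation MP := {mpoly U[N]}.
Hypothesis U_closed : diff_closed U.
Let sfC : is_subfield C := PV_sfC dsfK.
Let dC : forall x, C x -> der x = 0 := @PV_dC U K.
Let sfCb : is_subfield Cb := alg_closure_subfield sfC.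
Let dCb : forall x, Cb x -> der x = 0 := alg_closure_const sfC dC.
Let dsfL : is_dsubfield L := PV_dsubfield L_PV.
Let CL : constants L = C := PV_constants L_PV.
Let KL : K `<=` L := PV_sub L_PV.
Let dsfbL : is_dsubfield (bar L) := dsf_bar dsfK L_PV.
Let CbL : constants (bar L) = Cb := constants_bar sfC dC alpha_basis dsfL CL.
Local Notation hat := (hat L alpha).

Lemma fixed_dsubfield H : H `<=` carrier G -> is_dsubfield (fixed L H).
Proof.
move=> HG; have eq s (Hs : H s) := dhom_equalizer dsfL (dgal_dhom (HG _ Hs)) (_ : is_dhom L id).
have {}eq s : H s -> is_dsubfield [set x | L x /\ s x = id x] by move=> /eq; apply.
have sfL := dsfL.1; split; [split|] => /=.
- by split=> [|s Hs]; [exact: (subfield1 sfL) | have [] := subfield1 (eq s Hs).1].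
- move=> x y [Lx xf] [Ly yf]; split; first exact: (subfieldB sfL).
  by move=> s Hs; have [] := subfieldB (eq s Hs).1 (conj Lx (xf s Hs)) (conj Ly (yf s Hs)).
- move=> x y [Lx xf] [Ly yf]; split; first exact: (subfieldM sfL).
  by move=> s Hs; have [] := subfieldM (eq s Hs).1 (conj Lx (xf s Hs)) (conj Ly (yf s Hs)).
- move=> x [Lx xf]; split; first exact: (subfieldV sfL).
  by move=> s Hs; have [] := subfieldV (eq s Hs).1 (conj Lx (xf s Hs)).
- move=> x [Lx xf]; split; first exact: dsfL.2.
  by move=> s Hs; have [] := (eq s Hs).2 _ (conj Lx (xf s Hs)).
Qed.

Lemma fixed_intermediate H : H `<=` carrier G -> intermediate K L (fixed L H).
Proof.
move=> HG; split; [exact: fixed_dsubfield| |by move=> x []].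
move=> x Kx; split; first exact: KL.
by move=> s /HG Gs; exact: (dgal_fixK Gs).
Qed.

(** The equations are the elements of the span over [L] whose coefficients lie in [C]. As [L]
    contains the entries of [W] and has constants [C], descent shows that these equations suffice
    for [Iso]. *)
Lemma dgal_defined_closed E : intermediate K L E ->
  closed_subgroup C Cb eta G (carrier (DGal Cb alpha L E)).
Proof.
move=> [dsfE KE EL]; split; first exact: (dgal_subgroup dsfK L_PV alpha_basis KE EL).
pose iE := sf_inj dsfE.1.
exists [set q | mpolyover C q /\ Span eta iE L q]; split=> [q []//|].
apply/seteqP; split=> M /=.
  move=> [GM [s Ns sM]]; split=> // q [_ Sq].
  have /(_ q Sq) : forall q, Span eta iE L q -> q.@[entries M] = 0.
    apply: Span_ind; first by rewrite meval0.
      by move=> p1 p2 M1 M2; rewrite mevalD M1 M2 addr0.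
    move=> c p _ p0; have evs := dgal_eval (alpha := alpha) dsfK L_PV KE EL p Ns GM.2 sM.
    rewrite mevalZ -evs p0.
    by have [ds _ _ _] := Ns; rewrite (dhom0 dsfL ds) mulr0.
  by [].
move=> [GM Mq]; split=> //.
have IsoM : Iso eta iE M.
  apply: (Span_descent dsfK L_PV KE (tau := id) _ _ _ dsfL) => //.
  - exact: (PV_wronskian_over L_PV).
  - by move=> _ [x Ex <-]; exact: EL.
  - by move=> q Sq; rewrite CL => Cq; exact: Mq.
have [s Ns sM] := Iso_dgal dsfK L_PV alpha_basis KE EL GM IsoM.
by exists s.
Qed.

Local Notation evWK := (evW eta (dsfE := dsfK)).

Lemma common_denominator (J : eqType) (t : seq J) (l : J -> U) : (forall j, L (l j)) ->
  exists q (p : J -> {mpoly (sf_field dsfK.1)[N]}),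
    evWK q != 0 /\ forall j, j \in t -> l j * evWK q = evWK (p j).
Proof.
move=> Ll; elim: t => [|j t [q [p [q0 lE]]]].
  by exists 1, (fun=> 0); rewrite rmorph1 oner_neq0.
have [p' [q' [q'0 lj]]] := L_frac dsfK L_PV dsfK (@subset_refl _ K) (Ll j).
exists (q * q'), (fun i => if i == j then p' * q else p i * q').
rewrite rmorphM mulf_neq0 //; split=> // i; rewrite inE.
case: eqP => [-> _|_ /= it]; first by rewrite rmorphM /= lj mulrCA divfK // mulrC.
by rewrite rmorphM /= mulrA lE.
Qed.

(* Write the matrix of [g] in [H] as [M' th] with [th] algebraic over [C], and the
   [alpha]-coefficients of [x] as [l j].  A polynomial [F j] takes the value [g (l j) - l j],
   up to a factor, at [th] and the analogous values at the conjugates of [th], which define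
   elements of [H] as well.  Hence the minimal polynomial of [th] divides the sum of the
   [alpha j *: F j], and then every [F j]. *)
Lemma fixed_bar H x : closed_subgroup C Cb eta G H -> bar L x ->
  (forall g, H g -> hat g x = x) -> bar (fixed L H) x.
Proof.
move=> [[HG _ _ _] [S [SC HS]]] bx gx.
have [t [l [ut Ll l0 xE]]] := bar_alpha sfC alpha_basis dsfL CL bx.
have dsfE := fixed_dsubfield HG.
have [_ KE EL] := fixed_intermediate HG.
rewrite xE; apply: (alpha_sum_bar sfC alpha_basis dsfE (inter_constants L_PV KE EL)) => i.
split=> // g Hg; have Gg := HG _ Hg.
have [it|it] := boolP (i \in t); last by rewrite l0 // (dhom0 dsfL (dgal_dhom Gg)).
have [q [p [q0 lE]]] := common_denominator t Ll.
have [GM gW gM] := dgal_mx dsfK L_PV alpha_basis Gg; set M := galmx eta g in GM gW gM.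
pose iC := sf_inj sfC.
have char0 : [pchar sf_field sfC] =i pred0.
  by move=> e; rewrite -(fmorph_pchar iC); exact: diff_pchar0.
have U_root (r : {poly U}) : size r != 1%N -> exists y, root r y by exact: diff_closed_root.
have algM k : algebraicOver iC (entries M k).
  apply/integral_algebraic/alg_closure_inP.
  by case/mxvec_indexP: k => i1 j1; rewrite entriesE; exact: GM.2.
have [th [P [algth ME]]] := primitive_element char0 algM.
have [m [s [[m0 mth] m_dvd conj_s]]] := conjugates char0 U_root algth.
pose M' y : 'M[U]_n := vec_mx (\row_k (map_poly iC (P k)).[y]).
have M'E y k : entries (M' y) k = (map_poly iC (P k)).[y].
  by rewrite /entries vec_mxK mxE.
have Mth : M' th = M.
  apply/matrixP => i1 j1; rewrite -!entriesE M'E ME //.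
have conjP y : y \in s -> forall r : {mpoly (sf_field sfC)[N]},
    ((map_mpoly iC r).@[entries (M' y)] == 0) = ((map_mpoly iC r).@[entries M] == 0).
  move=> ys r; pose rP := mmap (@polyC (sf_field sfC)) P r.
  have rPE z : (map_mpoly iC r).@[entries (M' z)] = (map_poly iC rP).[z].
    apply: (mpoly_rmorph_ext (f := meval _ \o map_mpoly iC)
      (g := horner_eval z \o (map_poly iC \o mmap (@polyC (sf_field sfC)) P))) => [c|k] /=.
      by rewrite map_mpolyC mevalC mmapC map_polyC /= /horner_eval hornerC.
    by rewrite map_mpolyX mevalXU mmapX mmap1U M'E.
  by rewrite -Mth !rPE; exact: conj_s.
have Cbs y : y \in s -> Cb y.
  move=> ys; apply: (alg_closure_root sfC (p := map_poly iC m)).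
  + by rewrite map_poly_eq0.
  + by move=> e; rewrite coef_map; apply: (sub_alg_closure sfC); exact: sf_inj_over.
  + by rewrite conj_s.
have CM' y : y \in s -> mxover Cb (M' y).
  move=> ys i1 j1; rewrite -entriesE M'E horner_coef; apply: (subfield_sum sfCb) => e _.
  apply: (subfieldM sfCb); last by apply: (subfieldX sfCb); exact: Cbs.
  by rewrite coef_map; apply: (sub_alg_closure sfC); exact: sf_inj_over.
have HM' y : y \in s -> exists2 g', H g' & forall j, g' (eta j) = \sum_i M' y i j * eta i.
  move=> ys; suff : matrices_of Cb eta H (M' y) by case.
  rewrite HS; split=> [|r Sr].
    split; last exact: CM'.
    rewrite unitmxE unitfE -det_varmx_eval -(map_det_varmx n iC).
    by rewrite conjP // map_det_varmx det_varmx_eval -unitfE -unitmxE; exact: GM.1.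
  have [r' rE] := mpolyoverP sfC (SC _ Sr).
  apply/eqP; rewrite -/(entries (M' y)) rE conjP // -rE; apply/eqP.
  have : matrices_of Cb eta H M by split=> //; exists g.
  by rewrite HS => -[_]; apply.
pose iK := sf_inj dsfK.1.
pose f j : MP := Sp eta iK (p j) - l j *: Sp eta iK q.
pose F j := mmap (@polyC U) (fun k => map_poly iC (P k)) (f j).
have FE j y : (F j).[y] = (f j).@[entries (M' y)].
  apply/esym; apply: (mpoly_rmorph_ext (f := meval _)
    (g := horner_eval y \o mmap (@polyC U) (fun k => map_poly iC (P k)))) => [c|k] /=.
    by rewrite mevalC mmapC /horner_eval hornerC.
  by rewrite mevalXU mmapX mmap1U M'E.
have fg j g' y : j \in t -> H g' -> mxover Cb (M' y) ->
    (forall i, g' (eta i) = \sum_e M' y e i * eta e) ->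
    (f j).@[entries (M' y)] = (g' (l j) - l j) * g' (evWK q).
  move=> jt Hg' CMy gM'; rewrite /f mevalB mevalZ.
  have ev r := dgal_eval (alpha := alpha) dsfK L_PV (@subset_refl _ K) KL r (HG _ Hg') CMy gM'.
  rewrite -!ev -lE // (dhomM (dgal_dhom (HG _ Hg'))) //; first by rewrite mulrBl.
  exact: (evW_L L_PV KL).
have : map_poly iC m %| \sum_(j <- t) alpha j *: F j.
  apply: m_dvd => y ys; have [g' Hg' gM'] := HM' _ ys.
  rewrite rootE horner_sum; apply/eqP.
  transitivity ((hat g' x - x) * g' (evWK q)); last by rewrite gx // subrr mul0r.
  rewrite [in RHS]xE (dgal_hat_alpha dsfK L_PV alpha_basis _ (HG _ Hg') Ll).
  rewrite /alpha_sum -sumrB mulr_suml; apply: eq_big_seq => j jt.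
  by rewrite hornerZ FE (fg _ g' _ _ _ (CM' _ ys)) //= -mulrBl mulrA [alpha j * _]mulrC.
have WL := PV_wronskian_over L_PV.
have inL y : L y -> y \in sf_pred dsfL.1 by move=> Ly; exact/asboolP.
have fL j : mpolyover L (f j).
  have SL r : mpolyover L (Sp eta iK r).
    apply: (Sp_over (tau := id)) => //; first exact: dsfL.1.
    by move=> _ [y Ky <-]; exact: KL.
  move=> e; rewrite mcoeffB mcoeffZ; apply: (subfieldB dsfL.1); first exact: SL.
  by apply: (subfieldM dsfL.1) => //; exact: SL.
have FL j e : L (F j)`_e.
  suff /polyOverP/(_ e)/asboolP : F j \is a polyOver (sf_pred dsfL.1) by [].
  apply: rpred_sum => e' _; apply: rpredM; first by rewrite polyOverC; exact/inL/fL.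
  apply: rpred_prod => k _; apply: rpredX; apply/polyOverP => e2.
  by rewrite coef_map; apply: inL; have [] := sf_inj_over (sfF := sfC) (P k)`_e2; move=> /KL.
have mL e : L (map_poly iC m)`_e.
  by rewrite coef_map; have [/KL] := sf_inj_over (sfF := sfC) m`_e.
(* [m] and the [F j] have coefficients in [L], so the remainders of the [F j] do too; the vanishing
   of their combination along [alpha] makes each of them zero by [alpha_free]. *)
move=> mF; have Fm : forall j, j \in t -> F j %% map_poly iC m = 0.
  move=> j jt; apply/polyP => e; rewrite coef0.
  apply: (alpha_free sfC dC alpha_basis dsfL CL (s := t)
    (l := fun j => (F j %% map_poly iC m)`_e)) => // [j'|].
    have [F' FE'] := poly_overP dsfL.1 (FL j'); have [m' mE'] := poly_overP dsfL.1 mL.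
    by rewrite FE' mE' -map_modp coef_map; exact: sf_inj_over.
  have := congr1 (fun r : {poly U} => r`_e) (modp_eq0 mF); rewrite coef0 => E0.
  rewrite -[RHS]E0 (big_morph (fun r => r %% map_poly iC m) (modpD _) (mod0p _)).
  rewrite coef_sum; apply: eq_bigr => j' _.
  by rewrite modpZl coefZ mulrC.
have : (F i).[th] = 0.
  rewrite (divp_eq (F i) (map_poly iC m)) Fm // addr0 hornerM (rootP mth) mulr0 //.
rewrite FE (fg _ g) // ?Mth; [|exact: GM.2|exact: gM].
move/eqP; rewrite mulf_eq0 (dhom_eq0 dsfL (dgal_dhom Gg)) ?(negPf q0) ?orbF.
  by rewrite subr_eq0 => /eqP.
exact: (evW_L L_PV KL).
Qed.

Lemma dgal_hat_one x : bar L x -> hat (gone G) x = x.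
Proof.
move=> bx; have G1 := dgal_one alpha L_PV KL.
rewrite -(dgal_hat_unique dsfK L_PV alpha_basis G1 (g := id) _ _ _ bx) //.
by move=> y Ly; rewrite /= restrE.
Qed.

Lemma dgal_fix_bar E s : intermediate K L E -> carrier (DGal Cb alpha L E) s ->
  forall x, bar E x -> hat s x = x.
Proof.
move=> [dsfE KE EL] Ns; have Gs := dgal_sub (alpha := alpha) KE Ns.
have [_ _ sE _] := Ns.
have eq := dhom_equalizer dsfbL (dgal_hat dsfK L_PV alpha_basis Gs) (_ : is_dhom (bar L) id).
have {}eq := (eq (And4 erefl (fun _ _ _ _ => erefl) (fun _ _ _ _ => erefl) (fun _ _ => erefl))).
suff H : bar E `<=` [set x | bar L x /\ hat s x = id x] by move=> x /H[].
move=> x; apply; split; first exact: eq.1.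
move=> {}x [Ex|Cx].
  split; first exact: (sub_bar (EL _ Ex)).
  by rewrite (dgal_hatE dsfK L_PV alpha_basis Gs) ?sE //; exact: EL.
by split; [exact: (cb_sub_bar Cx) | exact: (dgal_hat_Cb dsfK L_PV alpha_basis Gs)].
Qed.

Lemma fixed_dgal E : intermediate K L E -> fixed L (carrier (DGal Cb alpha L E)) = E.
Proof.
move=> [dsfE KE EL]; apply/seteqP; split=> x; last first.
  by move=> Ex; split=> [|s [_ _ sE _]]; [exact: EL | exact: sE].
move=> [Lx xf]; apply: contrapT => nEx.
have [s Ns] := dgal_moves dsfK L_PV alpha_basis U_closed dsfE KE EL Lx nEx.
by apply; exact: xf.
Qed.

Lemma dgal_fixed H : closed_subgroup C Cb eta G H ->
  carrier (DGal Cb alpha L (fixed L H)) = H.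
Proof.
move=> clH; have [[HG H1 HM HV] [S [SC HS]]] := clH.
have interE := fixed_intermediate HG; have [dsfE KE EL] := interE.
apply/seteqP; split=> s; last first.
  by move=> Hs; have [ds sb sK sr] := HG _ Hs; split=> // x [_]; apply.
move=> Ns; have Gs := dgal_sub (alpha := alpha) KE Ns.
have [GM sW sM] := dgal_mx dsfK L_PV alpha_basis Gs; set M := galmx eta s in GM sW sM.
have Wu := PV_wronskian_unit L_PV.
have WL := PV_wronskian_over L_PV.
have hatW g : carrier G g -> map_mx (hat g) W = map_mx g W.
  move=> Gg; apply/matrixP => i j; rewrite [LHS]mxE [RHS]mxE.
  exact: (dgal_hatE dsfK L_PV alpha_basis Gg).
have WbL : mxover (bar L) W by move=> i j; exact: (sub_bar (WL i j)).
have gWbL g : carrier G g -> mxover (bar L) (map_mx g W).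
  by move=> Gg i j; rewrite [map_mx g W i j]mxE; exact: (dgal_bar Gg).
suff : matrices_of Cb eta H M.
  case=> _ [h Hh hM]; rewrite (_ : s = h) //.
  apply: (dgal_mx_eq L_PV Gs (HG _ Hh)) => j.
  by rewrite sM hM.
rewrite HS; split=> // q Sq.
(* [T q] is [q(W^-1 X)]: an equation on the matrix of [h] becomes an equation on the matrix [h W] of
   values, to which morphisms can be applied. *)
pose T : {rmorphism {mpoly U[N]} -> {mpoly U[N]}} :=
  mmap (@mpolyC N U) (entries (map_mx (@mpolyC N U) (invmx W) *m varmx n U)).
have TE A p : (T p).@[entries A] = p.@[entries (invmx W *m A)].
  apply: (mpoly_rmorph_ext (f := meval (entries A) \o T) (g := meval _)) => [c|k] /=.
    by rewrite mmapC !mevalC.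
  rewrite mmapX mmap1U mevalXU; case/mxvec_indexP: k => i j; rewrite !entriesE.
  rewrite [(_ *m varmx n U) i j]mxE [RHS]mxE rmorph_sum; apply: eq_bigr => l _.
  rewrite [map_mx _ _ i l]mxE /= mevalM mevalC.
  by rewrite -[varmx n U l j]entriesE entries_varmx mevalXU entriesE.
have sfbL := dsfbL.1.
have T_over p : mpolyover (bar L) p -> mpolyover (bar L) (T p).
  move=> bp; apply: (mpolyover_sum sfbL) => m _; apply: (mpolyoverM sfbL).
    exact: (mpolyoverC sfbL).
  apply: (big_ind (mpolyover (bar L))).
  - by rewrite -mpolyC1; apply: (mpolyoverC sfbL); exact: (subfield1 sfbL).
  - by move=> *; exact: (mpolyoverM sfbL).
  move=> k _; elim: (m k) => [|e IH].
    by rewrite expr0 -mpolyC1; apply: (mpolyoverC sfbL); exact: (subfield1 sfbL).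
  rewrite exprS; apply: (mpolyoverM sfbL) => //.
  case/mxvec_indexP: k {IH} => i j; rewrite entriesE mxE.
  apply: (mpolyover_sum sfbL) => l _; rewrite [map_mx _ _ i l]mxE; apply: (mpolyoverM sfbL).
    apply: (mpolyoverC sfbL); apply: (mxover_inv sfbL) => //.
  by rewrite -entriesE entries_varmx; exact: (mpolyoverX sfbL).
pose V : set ('X_{1..N} -> U) := [set v | exists2 P : MP, v = (fun m => P@_m) &
  mpolyover (bar L) P /\ forall h, H h -> P.@[entries (map_mx h W)] = 0].
pose Z : set ('X_{1..N} -> U) :=
  [set v | exists2 P : MP, v = (fun m => P@_m) & P.@[entries (map_mx s W)] = 0].
pose Delta : set (U -> U) := [set d | exists2 h, H h & d = fun x => hat h x - x].
have hd h (Hh : H h) := dgal_hat dsfK L_PV alpha_basis (HG _ Hh).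
have : Z (fun m => (T q)@_m); last first.
  case=> P PE P0; have -> : M = invmx W *m map_mx s W by rewrite sW mulKmx.
  rewrite -TE (_ : T q = P) //.
  by apply/mpolyP => m; exact: (congr1 (@^~ m) PE).
apply: (descent sfbL (Delta := Delta) (V := V) _ _ _ _ _ _ (s := msupp (T q))).
- move=> _ [h Hh ->]; split; first by rewrite (dhom0 dsfbL (hd h Hh)) subrr.
  by rewrite (dhom1 (hd h Hh)) subrr.
- by move=> _ m [P -> [bP _]]; exact: bP.
- move=> _ _ c [P1 -> [bP1 P10]] [P2 -> [bP2 P20]] bc; exists (P1 + c *: P2).
    by apply: funext => m; rewrite mcoeffD mcoeffZ.
  split; first by apply: (mpolyoverD sfbL) => //; exact: (mpolyoverZ sfbL).
  by move=> h Hh; rewrite mevalD mevalZ P10 // P20 // mulr0 addr0.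
- move=> _ _ [g Hg ->] [P -> [bP P0]].
  have Gg := HG _ Hg.
  have [Q QE Qev] := dhom_mpoly dsfbL (hd g Hg) bP.
  exists (Q - P); first by apply: funext => m; rewrite mcoeffB QE.
  split.
    move=> m; rewrite mcoeffB QE; apply: (subfieldB sfbL); last exact: bP.
    by apply: (dgal_hat_bar dsfK L_PV alpha_basis Gg); exists (P@_m).
  (* With [k] the product of the inverse of [g] and [h], again in [H], one has [h W = g (k W)].
     Hence [Q], obtained from [P] by applying [hat g] to the coefficients, takes at [h W] the value
     [hat g] of [P(k W) = 0]. *)
  move=> h Hh; rewrite mevalB P0 // subr0; have Gh := HG _ Hh.
  have [t [Ht gt tg]] := HV _ Hg; have Gt := HG _ Ht.
  have Hk := HM _ _ Ht Hh; set k := gmul G t h in Hk; have Gk := HG _ Hk.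
  have -> : map_mx h W = map_mx (hat g) (map_mx k W).
    apply/matrixP => i j; rewrite [LHS]mxE [RHS]mxE [map_mx k W i j]mxE.
    rewrite /k (gmulE dsfK L_PV alpha_basis Gt Gh (WL i j)).
    rewrite -(dgal_hat_mul dsfK L_PV alpha_basis Gg Gt); last exact: (dgal_bar Gh).
    by rewrite gt dgal_hat_one //; exact: (dgal_bar Gh).
  have -> : entries (map_mx (hat g) (map_mx k W)) = hat g \o entries (map_mx k W).
    by apply: funext; case/mxvec_indexP=> i j; rewrite /= !entriesE [LHS]mxE.
  rewrite Qev; first by rewrite P0 // (dhom0 dsfbL (hd g Hg)).
  by case/mxvec_indexP=> i j; rewrite entriesE; exact: gWbL.
- by exists 0; [apply: funext => m; rewrite mcoeff0 | rewrite meval0].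
- move=> _ _ c bc [P1 -> P10] [P2 -> [bP2 P20]] d0; exists (P1 + c *: P2).
    by apply: funext => m; rewrite mcoeffD mcoeffZ.
  (* The coefficients of [P2] are fixed by [H], so by [fixed_bar] they lie in the compositum of the
     fixed field and [Cb], where [hat s] is the identity. So [P2(s W)] is [hat s] of [P2(W)], which
     is zero because the identity belongs to [H]. *)
  rewrite mevalD P10 add0r mevalZ.
  have EP2 m : bar (fixed L H) (P2@_m).
    apply: (fixed_bar clH) => // h Hh; apply/eqP; rewrite -subr_eq0; apply/eqP.
    by apply: (d0 (fun x => hat h x - x)); exists h.
  have ds := dgal_hat dsfK L_PV alpha_basis Gs.
  have [Q QE Qev] := dhom_mpoly dsfbL ds bP2.
  have -> : P2 = Q.
    by apply/mpolyP => m; rewrite QE (dgal_fix_bar interE Ns).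
  have -> : entries (map_mx s W) = hat s \o entries W.
    apply: funext; case/mxvec_indexP=> i j; rewrite /= !entriesE [LHS]mxE.
    by rewrite (dgal_hatE dsfK L_PV alpha_basis Gs).
  rewrite Qev; last by case/mxvec_indexP=> i j; rewrite entriesE.
  have -> : entries W = entries (map_mx (gone G) W).
    apply: funext; case/mxvec_indexP=> i j; rewrite !entriesE [RHS]mxE.
    by rewrite /= restrE.
  by rewrite P20 // (dhom0 dsfbL ds) mulr0.
- by move=> m; rewrite mcoeff_msupp.
exists (T q) => //; split.
  apply: T_over => m; apply: (sub_bar (KL _)).
  by have [] := SC _ Sq m.
move=> h Hh; rewrite TE.
have [GMh hW hM] := dgal_mx dsfK L_PV alpha_basis (HG _ Hh).
rewrite hW mulKmx //.
have : matrices_of Cb eta H (galmx eta h) by split=> //; exists h.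
by rewrite HS => -[_]; apply.
Qed.

Local Notation mul := (gmul G).

Lemma dgal_mulG s t : carrier G s -> carrier G t -> carrier G (mul s t).
Proof. exact: (dgal_mul dsfK L_PV alpha_basis (@subset_refl _ K) KL). Qed.

Lemma dgal_mulA r s t : carrier G r -> carrier G s -> carrier G t ->
  mul (mul r s) t = mul r (mul s t).
Proof.
move=> Gr Gs Gt; apply: (dgal_eq (dgal_mulG (dgal_mulG Gr Gs) Gt)
  (dgal_mulG Gr (dgal_mulG Gs Gt))) => x Lx.
have mulE := gmulE dsfK L_PV alpha_basis.
rewrite !mulE ?(dgal_hat_mul dsfK L_PV alpha_basis) //; do ?exact: dgal_mulG.
exact: (dgal_bar Gt Lx).
Qed.

Lemma dgal_mul1 s : carrier G s -> mul (gone G) s = s.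
Proof.
have G1 : carrier G (gone G) := dgal_one alpha L_PV KL.
move=> Gs; apply: (dgal_eq (dgal_mulG G1 Gs) Gs) => x Lx.
rewrite (gmulE dsfK L_PV alpha_basis G1 Gs Lx).
by rewrite (dgal_hat_one) //; exact: (dgal_bar Gs Lx).
Qed.

Lemma dgal_1mul s : carrier G s -> mul s (gone G) = s.
Proof.
have G1 : carrier G (gone G) := dgal_one alpha L_PV KL.
move=> Gs; apply: (dgal_eq (dgal_mulG Gs G1) Gs) => x Lx.
rewrite (gmulE dsfK L_PV alpha_basis Gs G1 Lx) /= restrE //.
exact: (dgal_hatE dsfK L_PV alpha_basis).
Qed.

(** * Stable intermediate fields: normality and the quotient group *)

Section OneIntermediate.
Variables (E : set U) (interE : intermediate K L E).
Local Notation N := (carrier (DGal Cb alpha L E)).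
Let dsfE : is_dsubfield E. Proof. by case: interE. Qed.
Let KE : K `<=` E. Proof. by case: interE. Qed.
Let EL : E `<=` L. Proof. by case: interE. Qed.
Let CE : constants E = C := inter_constants L_PV KE EL.
Let NG s : N s -> carrier G s := @dgal_sub _ _ _ _ _ _ KE s.

(** By [galmx_eta] applied to a fundamental set [eps] of [E], [s] sends each [eps j] to a
    combination of the [eps i] over [Cb], hence into [bar E]; [K] and [eps] generate [E]. *)
Lemma dgal_PV_bar : picard_vessiot K E ->
  forall s x, carrier G s -> E x -> bar E (s x).
Proof.
move=> [r [b [eps E_PV]]] s x Gs.
have [ds sb sK _] := Gs; have dsE := dhom_sub EL ds.
have EbL : E `<=` bar L by move=> y /EL; exact: sub_bar.
have sEb : s @` E `<=` bar L by move=> _ [y Ey <-]; apply: sb; exists y => //; exact: EL.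
have Mo := galmx_over dsfK E_PV dsfbL CbL EbL dsE sK sEb.
have sM := galmx_eta E_PV s.
have dbE : is_dsubfield (bar E) := bar_dsubfield sfC dC dsfE CE.
suff : E `<=` s @^-1` bar E `&` E by move=> H /H[].
have [_ _ _ EE _] := E_PV; rewrite [X in X `<=` _]EE; apply: smallest_sub; last first.
  move=> y [Ky|[j _ <-]].
    by split; [rewrite /= sK //; exact: (sub_bar (KE Ky)) | exact: KE].
  have Eeps i : E (eps i) := PV_eta E_PV i.
  split=> //; rewrite /= sM; apply: (subfield_sum dbE.1) => i _.
  apply: (subfieldM dbE.1); first exact: (cb_sub_bar (Mo i j)).
  exact: (sub_bar (Eeps i)).
have sfE := dsfE.1; split; [split|] => /=.
- by split; [rewrite (dhom1 dsE); exact: (subfield1 dbE.1) | exact: (subfield1 sfE)].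
- move=> y z [by_ Ey] [bz Ez]; split; last exact: (subfieldB sfE).
  by rewrite (dhomB dsfE dsE) //; exact: (subfieldB dbE.1).
- move=> y z [by_ Ey] [bz Ez]; split; last exact: (subfieldM sfE).
  by rewrite (dhomM dsE) //; exact: (subfieldM dbE.1).
- move=> y [by_ Ey]; split; last exact: (subfieldV sfE).
  by rewrite (dhomV dsfE dsE) //; exact: (subfieldV dbE.1).
- move=> y [by_ Ey]; split; last exact: dsfE.2.
  by rewrite (dhom_der dsE) //; exact: dbE.2.
Qed.

Section Stable.
Hypothesis E_stable : forall s x, carrier G s -> E x -> bar E (s x).

(** For [x] in [E], the image [t x] lies in [bar E], where [hat v] is the identity; so the conjugate
    sends [x] to the image of [t x] under [hat s], which is [x]. *)
Lemma dgal_conj s t v : carrier G s -> carrier G t -> N v ->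
  mul s t = gone G -> N (mul (mul s v) t).
Proof.
move=> Gs Gt Nv st; have Gv := NG Nv.
have [dc cb cK cr] := dgal_mulG (dgal_mulG Gs Gv) Gt; split=> // x Ex.
rewrite (gmulE dsfK L_PV alpha_basis (dgal_mulG Gs Gv) Gt (EL Ex)).
rewrite (dgal_hat_mul dsfK L_PV alpha_basis Gs Gv); last exact: (dgal_bar Gt (EL Ex)).
rewrite (dgal_fix_bar interE Nv); last exact: E_stable.
rewrite -(gmulE dsfK L_PV alpha_basis Gs Gt (EL Ex)) st /= restrE //.
exact: EL.
Qed.

Lemma dgal_normal : is_normal G N.
Proof.
split=> [|s Gs]; first exact: (dgal_subgroup dsfK L_PV alpha_basis KE EL).
have [t [Gt st ts _ _]] := dgal_inv dsfK L_PV alpha_basis (@subset_refl _ K) KL Gs.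
apply/seteqP; split=> _ [v Nv <-]; have Gv := NG Nv.
- exists (mul (mul s v) t); first exact: dgal_conj.
  by rewrite (dgal_mulA (dgal_mulG Gs Gv) Gt Gs) ts dgal_1mul //; exact: dgal_mulG.
- exists (mul (mul t v) s); first exact: dgal_conj.
  rewrite (dgal_mulA Gt Gv Gs) -(dgal_mulA Gs Gt (dgal_mulG Gv Gs)) st dgal_mul1 //.
  exact: dgal_mulG.
Qed.

Local Notation GE := (DGal Cb alpha E K).

Lemma restr_carrier s : carrier G s -> carrier GE (restr E s).
Proof.
move=> Gs; have [ds _ sK _] := Gs; split.
- exact: (dhom_restr dsfE (dhom_sub EL ds)).
- by move=> _ [x Ex <-]; rewrite restrE //; exact: E_stable.
- by move=> x Kx; rewrite restrE ?sK //; exact: KE.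
- by apply: eq_restr => x Ex; rewrite restrE.
Qed.

(** The two group laws use two different maps, [hat] over [L] and [hat] over [E]. They agree on
    [bar E] by uniqueness of the extension, and [t x] lies in [bar E]. *)
Lemma restr_ghom : is_ghom G GE (restr E).
Proof.
split=> [|s t Gs Gt]; first exact: restr_carrier.
have [dt _ tK _] := restr_carrier Gt; have [ds _ sK _] := restr_carrier Gs.
have fixC f : (forall x, K x -> f x = x) -> forall c, C c -> f c = c by move=> fK c [/fK].
have dhs := dgal_hat dsfK L_PV alpha_basis Gs.
have bEL : bar E `<=` bar L := bar_sub sfC dsfL CL EL.
apply: eq_restr => x Ex; rewrite (gmulE dsfK L_PV alpha_basis Gs Gt (EL Ex)) /=.
rewrite (hatE sfC dC alpha_basis dsfE CE dt (fixC _ tK)) // restrE //.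
apply: (hat_unique sfC dC alpha_basis dsfE CE ds (fixC _ sK)); last exact: E_stable.
- exact: dhom_sub bEL dhs.
- by move=> y Ey; rewrite restrE // (dgal_hatE dsfK L_PV alpha_basis Gs) //; exact: EL.
- by move=> c Cc; exact: (dgal_hat_Cb dsfK L_PV alpha_basis Gs Cc).
Qed.

Let coset s := left_coset G N s.

Lemma coset_restr s t : carrier G s -> coset s t -> carrier G t /\ restr E t = restr E s.
Proof.
move=> Gs [v Nv <-]; have Gv := NG Nv; split; first exact: dgal_mulG.
apply: eq_restr => x Ex; rewrite (gmulE dsfK L_PV alpha_basis Gs Gv (EL Ex)).
have [_ _ vE _] := Nv; rewrite (vE x Ex).
exact: (dgal_hatE dsfK L_PV alpha_basis Gs (EL Ex)).
Qed.

Lemma coset_refl s : carrier G s -> coset s s.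
Proof. by move=> Gs; exists (gone G); [exact: (dgal_one alpha L_PV EL) | exact: dgal_1mul]. Qed.

Lemma restr_coset s t : carrier G s -> carrier G t -> restr E s = restr E t ->
  coset s `<=` coset t.
Proof.
move=> Gs Gt st _ [v Nv <-]; have Gv := NG Nv.
have [r [Gr tr rt _ hr]] := dgal_inv dsfK L_PV alpha_basis (@subset_refl _ K) KL Gt.
have Gsv := dgal_mulG Gs Gv; exists (mul r (mul s v)); last first.
  by rewrite -(dgal_mulA Gt Gr Gsv) tr dgal_mul1.
have [dc cb cK cr] := dgal_mulG Gr Gsv; split=> // x Ex; have Lx := EL Ex.
rewrite (gmulE dsfK L_PV alpha_basis Gr Gsv Lx) (gmulE dsfK L_PV alpha_basis Gs Gv Lx).
have [_ _ vE _] := Nv; rewrite (vE x Ex) (dgal_hatE dsfK L_PV alpha_basis Gs Lx).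
rewrite -(restrE s Ex) st restrE // -(dgal_hatE dsfK L_PV alpha_basis Gt Lx) hr //.
exact: (sub_bar Lx).
Qed.

Lemma quotient_iso : exists phi : set (U -> U) -> (U -> U),
  (forall s, carrier G s -> phi (coset s) = restr E s) /\
  is_giso (quotient_group G N) GE phi.
Proof.
(* An arbitrary element of the coset is restricted; cosets are nonempty, so the default map is never
   chosen on them. *)
pose phi (A : set (U -> U)) := restr E (xget (fun=> 0) A).
have phiE A s : A s -> (forall t, A t -> restr E t = restr E s) -> phi A = restr E s.
  by move=> As sA; rewrite /phi; case: xgetP => [t _ At|/(_ s) //]; exact: sA.
have phi_coset s : carrier G s -> phi (coset s) = restr E s.
  by move=> Gs; apply: phiE (coset_refl Gs) _ => t /(coset_restr Gs)[].
exists phi; split=> //; split; [split|split].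
- by move=> _ [s Gs <-]; rewrite phi_coset //; exact: restr_carrier.
- move=> _ _ [s Gs <-] [t Gt <-]; rewrite !phi_coset // -(restr_ghom.2 _ _ Gs Gt).
  apply: phiE => [|_ [s' ss' [t' tt' <-]]].
    by exists s; [exact: coset_refl | exists t => //; exact: coset_refl].
  have [Gs' s'E] := coset_restr Gs ss'; have [Gt' t'E] := coset_restr Gt tt'.
  by rewrite !restr_ghom.2 // s'E t'E.
- by move=> _ [s Gs <-]; rewrite /= phi_coset //; exact: restr_carrier.
- move=> A B; rewrite !inE => -[s Gs <-] [t Gt <-]; rewrite !phi_coset // => st.
  by apply/seteqP; split; exact: restr_coset.
(* Surjectivity is the extension of an embedding of [E] into [bar E] to [L]. *)
- move=> tau Gtau; have [_ _ _ tauE] := Gtau.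
  have [s Gs sE] := dgal_extend dsfK L_PV alpha_basis U_closed dsfE KE EL Gtau.
  exists (coset s); first by exists s.
  by rewrite phi_coset // tauE; exact: eq_restr.
Qed.

End Stable.
End OneIntermediate.

(** * An equation for an intermediate field with normal group *)

Lemma monomials d : exists D (u : 'I_D -> U),
  [/\ forall j, L (u j),
    forall s, carrier G s -> exists R : 'M_D, mxover Cb R /\
      forall j, s (u j) = \sum_k u k * R k j &
    forall p, (msize p <= d)%N -> exists c : 'I_D -> U,
      (forall j, K (c j)) /\ evWK p = \sum_j c j * u j].
Proof.
pose T : finType := 'X_{1..N < d}; pose D := #|T|.
pose m (j : 'I_D) : 'X_{1..N} := bmnm (enum_val j).
have sumT (F : 'X_{1..N} -> U) : \sum_(x : T) F (bmnm x) = \sum_j F (m j).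
  by rewrite (reindex _ (onW_bij _ (enum_val_bij T))).
pose u j := mmap1 (entries W) (m j).
have uE j : u j = evWK 'X_[m j] by rewrite /evW mmapX.
exists D, u; split=> [j|s Gs|p sp].
- by rewrite uE; exact: (evW_L L_PV KL).
- have [GM sW sM] := dgal_mx dsfK L_PV alpha_basis Gs; set M := galmx eta s in GM sW sM.
  have [CM _] : mxover Cb M /\ True by split=> //; exact: GM.2.
  have su j : s (u j) = mmap1 (entries (W *m M)) (m j).
    rewrite uE (dgal_eval dsfK L_PV (@subset_refl _ K) KL _ Gs CM sM).
    by rewrite Sp_eval mmapX.
  have /choice[c cE] : forall j, exists c : 'I_D -> U,
      (forall i, Cb (c i)) /\ s (u j) = \sum_i u i * c i.
    move=> j; have [q [Cq sq qE]] := monomial_mul dsfK W (m j) CM.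
    exists (fun i => q@_(m i)); split=> //; rewrite su -qE /meval (mmapE d) //.
      rewrite (sumT (fun m => q@_m * mmap1 (entries W) m)).
      by apply: eq_bigr => i _; rewrite mulrC.
    by apply: leq_trans sq _; exact: bmdeg.
  exists (\matrix_(k, j) c j k); split=> [k j|j]; first by rewrite mxE; have [] := cE j.
  by rewrite (cE j).2; apply: eq_bigr => i _; rewrite mxE.
- exists (fun j => sf_inj dsfK.1 p@_(m j)); split=> [j|]; first exact: sf_inj_over.
  by rewrite /evW (mmapE d) // (sumT (fun m => sf_inj dsfK.1 p@_m * mmap1 (entries W) m)).
Qed.

Section NormalSubgroup.
Variables (E : set U) (interE : intermediate K L E).
Local Notation NE := (carrier (DGal Cb alpha L E)).
Let dsfE : is_dsubfield E. Proof. by case: interE. Qed.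
Let KE : K `<=` E. Proof. by case: interE. Qed.
Let EL : E `<=` L. Proof. by case: interE. Qed.
Let CE : constants E = C := inter_constants L_PV KE EL.
Let dsfbE : is_dsubfield (bar E) := bar_dsubfield sfC dC dsfE CE.
Let CK : C `<=` K. Proof. by move=> x []. Qed.
Let CCb : C `<=` Cb := sub_alg_closure sfC.

(** For [v] in [NE], normality gives [v s = s v'] with [v'] in [NE], so [hat v] fixes [s x]. Being
    fixed by [NE] in [bar L], the element [s x] lies in [bar E] by [fixed_bar] and [fixed_dgal]. *)
Lemma normal_stable : is_normal G NE ->
  forall s x, carrier G s -> E x -> bar E (s x).
Proof.
move=> [_ NN] s x Gs Ex; have Lx := EL Ex.
have clN := dgal_defined_closed interE.
have := fixed_bar clN (dgal_bar Gs Lx).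
rewrite (fixed_dgal interE); apply=> v Nv.
have Gv := dgal_sub KE Nv.
have : right_coset G NE s (mul v s) by exists v.
rewrite -NN // => -[v' Nv' vs]; have Gv' := dgal_sub KE Nv'.
rewrite -(gmulE dsfK L_PV alpha_basis Gv Gs Lx) -vs.
rewrite (gmulE dsfK L_PV alpha_basis Gs Gv' Lx).
have [_ _ v'E _] := Nv'; rewrite (v'E x Ex).
exact: (dgal_hatE dsfK L_PV alpha_basis Gs Lx).
Qed.

Lemma intermediate_fg : exists t, (forall y, y \in t -> E y) /\ E `<=` adjoin K t.
Proof.
apply: (fg_subfield (s := [seq W ij.1 ij.2 | ij : 'I_n * 'I_n]) dsfK.1 dsfE.1 KE).
apply: subset_trans EL _; apply: (PV_sub_subfield dsfK L_PV).
- exact: adjoin_subfield.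
- exact: sub_adjoin.
- by move=> i j; apply: mem_adjoin; apply/mapP; exists (i, j); rewrite ?mem_enum.
Qed.

Hypothesis E_stable : forall s x, carrier G s -> E x -> bar E (s x).

Lemma hat_stable s x : carrier G s -> bar E x -> bar E (hat s x).
Proof.
move=> Gs /(bar_alpha sfC alpha_basis dsfE CE)[t [l [_ El _ ->]]].
have Ll i : L (l i) by exact: EL.
rewrite (dgal_hat_alpha dsfK L_PV alpha_basis t Gs Ll); apply: (subfield_sum dsfbE.1) => i _.
apply: (subfieldM dsfbE.1); first exact: E_stable.
by apply: cb_sub_bar; have [] := alpha_basis.
Qed.

Lemma semi_invariants : exists M (w : 'I_M -> U),
  [/\ (forall j, E (w j)) /\ lfree C w,
    exists c : 'I_M -> U, (forall j, C (c j)) /\ 1 = \sum_j c j * w j,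
    forall s, carrier G s -> exists mu (S : 'M_M), mxover Cb S /\
      forall j, s (w j) = mu * \sum_k w k * S k j &
    forall F, is_subfield F -> K `<=` F -> (forall j, F (w j)) -> E `<=` F].
Proof.
have [e [Ee EKe]] := intermediate_fg.
(* One degree bound for the numerators and denominators of all generators of [E], so that a single
   finite space of monomials contains them. *)
have [d eP] : exists d, forall x, x \in e -> exists p q,
    [/\ evWK q != 0, x = evWK p / evWK q, (msize p <= d)%N & (msize q <= d)%N].
  elim: e Ee {EKe} => [|x e IH] Ee; first by exists 0%N.
  have [y ey|d dE] := IH; first by apply: Ee; rewrite inE ey orbT.
  have [p [q [q0 xE]]] := L_frac dsfK L_PV dsfK (@subset_refl _ K) (EL (Ee x (mem_head _ _))).
  exists (maxn d (maxn (msize p) (msize q))) => y; rewrite inE => /orP[/eqP ->|/dE].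
    by exists p, q; split=> //; rewrite !leq_max leqnn ?orbT.
  by move=> [p' [q' [q'0 yE sp sq]]]; exists p', q'; rewrite !leq_max sp sq.
have [D [u [Lu su uK]]] := monomials d.
have [r [f [B [free BE uE]]]] := extract_basis dsfE.1 u.
pose v : 'rV_r := \row_i u (f i).
have uB : \row_j u j = v *m B.
  by apply/rowP => j; rewrite !mxE uE; apply: eq_bigr => i _; rewrite mxE mulrC.
have Lv : mxover L v by move=> i j; rewrite mxE.
have BL : mxover L B by move=> i j; exact: EL.
have v0E : v 0 = u \o f by apply: funext => i; rewrite mxE.
have freeE : lfree E (v 0) by rewrite v0E.
have freeb : lfree (bar E) (v 0).
  by apply: (lfree_bar sfC dC alpha_basis dsfE CE dsfL CL EL) => // i; rewrite v0E; exact: Lu.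
have Bf : colsub f B = 1%:M.
  apply: (lfree_mx_inj dsfE.1 freeE); first by move=> i j; rewrite mxE.
    by move=> i j; rewrite mxE; exact: (subfield_nat dsfE.1).
  by rewrite mulmx_colsub -uB mulmx1; apply/rowP => i; rewrite !mxE.
(* In the basis [v], the vector [s(u)] is both [s(v) s(B) = v N' s(B)] and [u R = v B R]; freeness
   over [bar E] allows [v] to be cancelled. *)
have act s : carrier G s -> exists N' (R : 'M_D), [/\ mxover (bar E) N', mxover Cb R,
    map_mx s v = v *m N' & N' *m map_mx s B = B *m R].
  move=> Gs; have [R [CR sR]] := su s Gs; have ds := dgal_dhom Gs.
  have RbE : mxover (bar E) R by move=> i j; exact: cb_sub_bar (CR i j).
  have BbE : mxover (bar E) B by move=> i j; exact: sub_bar (BE i j).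
  have suR : map_mx s (\row_j u j) = v *m (B *m R).
    rewrite mulmxA -uB; apply/rowP => j; rewrite !mxE sR.
    by apply: eq_bigr => k _; rewrite mxE.
  have sv : map_mx s v = v *m colsub f (B *m R).
    by rewrite mulmx_colsub -suR; apply/rowP => j; rewrite !mxE.
  have NbE : mxover (bar E) (colsub f (B *m R)).
    by move=> i j; rewrite mxE; exact: (mxover_mul dsfbE.1).
  exists (colsub f (B *m R)), R; split=> //.
  apply: (lfree_mx_inj dsfbE.1 freeb).
  - apply: (mxover_mul dsfbE.1) => // i j; rewrite mxE; exact: E_stable.
  - exact: (mxover_mul dsfbE.1).
  - by rewrite mulmxA -sv -(dhom_mulmx dsfL ds) // -uB suR.
(* The inverse of [N'] is [hat s] of the matrix attached to the inverse of [s]. *)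
have act_unit s N' : carrier G s -> mxover (bar E) N' -> map_mx s v = v *m N' -> N' \in unitmx.
  move=> Gs NbE sv.
  have [t [Gt st ts hst hts]] := dgal_inv dsfK L_PV alpha_basis (@subset_refl _ K) KL Gs.
  have [Nt [_ [NtE _ tv _]]] := act t Gt.
  have dhs := dgal_hat dsfK L_PV alpha_basis Gs.
  have bL x : L x -> bar L x by move=> Lx; exact: sub_bar Lx.
  have bEL : bar E `<=` bar L := bar_sub sfC dsfL CL EL.
  have hNt : mxover (bar E) (map_mx (hat s) Nt).
    by move=> i j; rewrite mxE; exact: hat_stable.
  suff /mulmx1_unit[] : N' *m map_mx (hat s) Nt = 1%:M by [].
  apply: (lfree_mx_inj dsfbE.1 freeb); first exact: (mxover_mul dsfbE.1).
    by move=> i j; rewrite mxE; exact: (subfield_nat dsfbE.1).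
  rewrite mulmx1 mulmxA -sv.
  have -> : map_mx s v = map_mx (hat s) v.
    apply/matrixP => i j; rewrite [LHS]mxE [RHS]mxE.
    by rewrite (dgal_hatE dsfK L_PV alpha_basis Gs).
  rewrite -(dhom_mulmx dsfbL dhs); first last.
  - by move=> i j; exact: bEL.
  - by move=> i j; exact: bL.
  rewrite -tv; apply/matrixP => i j; rewrite [LHS]mxE [map_mx t v i j]mxE.
  by rewrite -(dgal_hatE dsfK L_PV alpha_basis Gt (Lv i j)) hst //; exact: bL.
pose pi (h : {ffun 'I_r -> 'I_D}) := \det (colsub h B).
have Epi h : E (pi h) by apply: (mxover_det dsfE.1) => i j; rewrite mxE.
(* Taking minors in [N' s(B) = B R] gives the action on the [pi g], with the factor [mu] equal to
   the inverse of [\det N']. *)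
have spi s : carrier G s -> exists mu (c : {ffun 'I_r -> 'I_D} -> {ffun 'I_r -> 'I_D} -> U),
    (forall h g, Cb (c h g)) /\ forall g, s (pi g) = mu * \sum_h pi h * c h g.
  move=> Gs; have [N' [R [NbE CR sv sB]]] := act s Gs.
  have Nu := act_unit s N' Gs NbE sv; have ds := dgal_dhom Gs.
  exists (\det N')^-1, (fun h g => \prod_j R (h j) (g j)); split=> [h g|g].
    exact: (subfield_prod sfCb).
  apply: (mulfI (x := \det N')); first by rewrite -unitfE -unitmxE.
  rewrite mulrA divff ?mul1r; last by rewrite -unitfE -unitmxE.
  rewrite (dhom_det dsfL ds); last by move=> i j; rewrite mxE; exact: BL.
  have -> : map_mx s (colsub g B) = colsub g (map_mx s B).
    by apply/matrixP => i j; rewrite !mxE.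
  rewrite -det_mulmx mulmx_colsub sB -mulmx_colsub det_mulmx_expand.
  by apply: eq_bigr => h _; congr (_ * _); apply: eq_bigr => j _; rewrite mxE.
have pi1 : pi [ffun i => f i] = 1.
  rewrite /pi -(det1 U r) -Bf; congr (\det _).
  by apply/matrixP => i j; rewrite !mxE ffunE.
(* The columns of [B] selected by [f] form the identity; replacing the column [i] of this block by
   the column [j] of [B] leaves a matrix with determinant [B i j]. *)
have piB i j : B i j = pi [ffun k => if k == i then j else f k].
  rewrite /pi (det_replace_col (i := i)) => [|l k ki]; first by rewrite mxE ffunE eqxx.
  have /matrixP/(_ l k) := Bf.
  by rewrite !mxE ffunE (negPf ki).
have [M [g [b [wfree Cb' piE wS]]]] := stable_basis pi sfC sfCb CCb.
exists M, (pi \o g); split.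
- by split=> // j; exact: Epi.
- by exists (fun i => b i [ffun i => f i]); split=> //; rewrite -[LHS]pi1 piE.
- move=> s Gs; have [mu [c [Cc sc]]] := spi s Gs.
  have [S [CS SE]] := wS (s \o pi) mu c Cc sc.
  by exists mu, S; split.
move=> F sfF KF Fw; have Fpi h : F (pi h).
  rewrite piE; apply: (subfield_sum sfF) => i _; apply: (subfieldM sfF); last exact: (Fw i).
  exact: (KF _ (CK (Cb' i h))).
apply: subset_trans EKe _; apply: adjoin_min => // x ex.
have [p [q [q0 xE sp sq]]] := eP x ex.
have [cp [Kp pE]] := uK p sp; have [cq [Kq qE]] := uK q sq.
have ev_v c : \sum_j c j * u j = \sum_i (\sum_j c j * B i j) * u (f i).
  under eq_bigr => j _ do rewrite uE mulr_sumr.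
  rewrite exchange_big; apply: eq_bigr => i _; rewrite mulr_suml.
  by apply: eq_bigr => j _; rewrite mulrA.
have EB c i : (forall j, K (c j)) -> E (\sum_j c j * B i j).
  by move=> Kc; apply: (subfield_sum dsfE.1) => j _; apply: (subfieldM dsfE.1) => //; exact: KE.
have FB c i : (forall j, K (c j)) -> F (\sum_j c j * B i j).
  move=> Kc; apply: (subfield_sum sfF) => j _; apply: (subfieldM sfF); first exact: KF.
  by rewrite piB.
have Ex : E x by exact: Ee.
(* The equality [evW p = x * evW q], written in the [E]-basis, may be compared coordinatewise
   because [x] is in [E]; a nonzero coordinate of [evW q] then gives [x] as a quotient of
   combinations of entries of [B]. *)
have coef i : \sum_j cp j * B i j - x * \sum_j cq j * B i j = 0.
  apply: (free (fun i => \sum_j cp j * B i j - x * \sum_j cq j * B i j)) => [k|].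
    apply: (subfieldB dsfE.1); first exact: EB.
    by apply: (subfieldM dsfE.1) => //; exact: EB.
  under eq_bigr => k _ do rewrite mulrBl -mulrA.
  by rewrite sumrB -mulr_sumr -!ev_v -pE -qE xE divfK // subrr.
have [i qi0] : exists i, \sum_j cq j * B i j != 0.
  apply/not_existsP => all0; move: q0; rewrite qE ev_v big1 ?eqxx // => i _.
  by have /negP := all0 i; rewrite negbK => /eqP ->; rewrite mul0r.
move/eqP: (coef i); rewrite subr_eq0 => /eqP xi.
have -> : x = (\sum_j cp j * B i j) / (\sum_j cq j * B i j) by rewrite xi mulfK.
by apply: (subfield_div sfF); exact: FB.
Qed.

(* The factor [mu] by which [s] rescales the [w j] appears to the power [M] in the
   products below as well as in the wronskian determinant. *)
Lemma invariants : exists P (z : 'I_P -> U),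
  [/\ (0 < P)%N, (forall j, E (z j)) /\ lfree C z,
    forall s, carrier G s -> exists S : 'M_P, mxover Cb S /\
      forall j, s (z j) = \sum_k z k * S k j &
    forall F, is_subfield F -> K `<=` F -> (forall j, F (z j)) -> E `<=` F].
Proof.
have [M [w [[Ew wfree] [c [Cc c1]] sw wgen]]] := semi_invariants.
pose Wr := \det (wronskian w).
have freeE : lfree (constants E) w by rewrite CE.
have Wr0 : Wr != 0 by rewrite -unitfE -unitmxE; exact: (wronskian_unit dsfE).
have EWr : E Wr by apply: (mxover_det dsfE.1); exact: (wronskian_over dsfE).
have w0 j : w j != 0.
  apply/eqP => wj; suff : (1 : U) = 0 by apply/eqP/oner_neq0.
  have := wfree (fun k => (k == j)%:R) (fun k => subfield_nat sfC _) _ j.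
  rewrite eqxx; apply; rewrite (bigD1 j) //= eqxx mul1r wj add0r.
  by rewrite big1 // => k /negPf ->; rewrite mul0r.
have M0 : (0 < M)%N.
  rewrite lt0n; apply/negP => /eqP M0; move/eqP: c1; rewrite big1 ?oner_eq0 // => i _.
  by have := ltn_ord i; rewrite [X in (_ < X)%N]M0.
pose l0 := Ordinal M0.
pose y (g : {ffun 'I_M -> 'I_M}) := (\prod_i w (g i)) / Wr.
have y0 g : y g != 0 by rewrite mulf_neq0 ?invr_eq0 //; apply/prodf_neq0.
have Ey g : E (y g).
  by apply: (subfield_div dsfE.1) => //; apply: (subfield_prod dsfE.1) => i _; exact: Ew.
have sy s : carrier G s -> exists c : {ffun 'I_M -> 'I_M} -> {ffun 'I_M -> 'I_M} -> U,
    (forall h g, Cb (c h g)) /\ forall g, s (y g) = 1 * \sum_h y h * c h g.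
  move=> Gs; have [mu [S [CS sS]]] := sw s Gs; have ds := dhom_sub EL (dgal_dhom Gs).
  have sWr : s Wr = mu ^+ M * (Wr * \det S).
    rewrite (dhom_det dsfE ds); last exact: (wronskian_over dsfE).
    rewrite (dhom_wronskian dsfE ds Ew) (_ : s \o w = fun j => mu * \sum_k w k * S k j).
      rewrite det_wronskian_scale wronskian_comb ?det_mulmx // => k j.
      exact: dCb.
    exact: funext.
  have : s Wr != 0 by rewrite (dhom_eq0 dsfE ds).
  rewrite sWr !mulf_eq0 !negb_or => /and3P[muM0 _ S0].
  exists (fun h g => (\det S)^-1 * \prod_i S (h i) (g i)); split=> [h g|g].
    apply: (subfieldM sfCb); last exact: (subfield_prod sfCb).
    by apply: (subfieldV sfCb); exact: (mxover_det sfCb).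
  have EP : E (\prod_i w (g i)) by apply: (subfield_prod dsfE.1) => i _; exact: Ew.
  rewrite /y (dhomM ds) //; last exact: (subfieldV dsfE.1).
  rewrite (dhomV dsfE ds) // sWr (dhom_prod dsfE ds); last by move=> i; exact: Ew.
  under eq_bigr => i _ do rewrite sS.
  rewrite big_split /= prodr_const card_ord.
  rewrite (bigA_distr_bigA (fun i k => w k * S k (g i))) mul1r /=.
  under eq_bigr => h _ do rewrite big_split /=.
  rewrite mulr_sumr mulr_suml; apply: eq_bigr => h _; field.
  by rewrite S0 Wr0 muM0.
have [P [f [b [zfree Cb' yE zS]]]] := stable_basis y sfC sfCb CCb.
exists P, (y \o f); split.
- case: (P) f b {zfree Cb' zS} yE => // f b /(_ [ffun=> l0]) yE.
  by move: (y0 [ffun=> l0]); rewrite yE big_ord0 eqxx.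
- by split=> // j; exact: Ey.
- move=> s Gs; have [c' [Cc' sc]] := sy s Gs.
  have [S [CS SE]] := zS (s \o y) 1 c' Cc' sc.
  by exists S; split=> // j; rewrite -[LHS]/((s \o y) (f j)) SE mul1r.
move=> F sfF KF Fz; apply: wgen => // j.
have Fy g : F (y g).
  rewrite yE; apply: (subfield_sum sfF) => i _; apply: (subfieldM sfF); last exact: (Fz i).
  exact: (KF _ (CK (Cb' i g))).
(* The two products differ only in the factor of index [l0], so their quotient is [w k / w l]. From
   these ratios and [1 = \sum_j c j * w j] the inverse of each [w j] is recovered. *)
have Fratio k l : F (w k / w l).
  have -> : w k / w l = y [ffun i => if i == l0 then k else l] / y [ffun=> l].
    rewrite /y (bigD1 l0) //= [X in _ = _ / (X / _)](bigD1 l0) //= !ffunE eqxx.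
    rewrite (eq_bigr (fun=> w l)) => [|i /negPf il]; last by rewrite ffunE il.
    rewrite [X in _ = _ / (_ * X / _)](eq_bigr (fun=> w l)) => [|i _]; last by rewrite ffunE.
    set p := \prod_(i | _) w l; have p0 : p != 0 by apply/prodf_neq0.
    by field; rewrite Wr0 w0 p0.
  exact: (subfield_div sfF).
rewrite -[w j]invrK; apply: (subfieldV sfF).
rewrite -[_^-1]mul1r c1 mulr_suml; apply: (subfield_sum sfF) => k _.
rewrite -mulrA; apply: (subfieldM sfF); last exact: Fratio.
exact: (KF _ (CK (Cc k))).
Qed.

(** The equation of order [P] solved by the [z j] has as coefficients, up to sign, the row
    [A = top *m invmx Wz]. A morphism [s] multiplies [top] and [Wz] on the right by the same
    constant matrix, so it fixes [A]; the fixed field of the whole group being [K], the equation is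
    defined over [K]. *)
Lemma stable_PV : picard_vessiot K E.
Proof.
have [P [z [P0 [Ez zfree] sz zgen]]] := invariants.
have freeE : lfree (constants E) z by rewrite CE.
have Wu := wronskian_unit dsfE Ez freeE; set Wz := wronskian z in Wu.
have EWz : mxover E Wz by exact: (wronskian_over dsfE).
pose top : 'rV_P := \row_j iter P der (z j).
have Etop : mxover E top by move=> i j; rewrite mxE; exact: (dsubfield_iter dsfE).
pose A := top *m invmx Wz.
have EA : mxover E A by apply: (mxover_mul dsfE.1) => //; exact: (mxover_inv dsfE.1).
have AW : A *m Wz = top by rewrite mulmxKV.
have KA i : K (A 0 i).
  have interK : intermediate K L K by split.
  rewrite -(fixed_dgal interK); split; first exact: EL.
  move=> s Gs; have ds := dhom_sub EL (dgal_dhom Gs).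
  have [S [CS sS]] := sz s Gs.
  have dS k j : der (S k j) = 0 by exact: dCb.
  have szE : s \o z = fun j => \sum_k z k * S k j by exact: funext.
  have sWz : map_mx s Wz = Wz *m S by rewrite (dhom_wronskian dsfE ds Ez) szE wronskian_comb.
  have stop : map_mx s top = top *m S.
    apply/rowP => j; rewrite [LHS]mxE [top 0 j]mxE (dhom_iter dsfE ds) // sS iter_der_comb //.
    by rewrite [RHS]mxE; apply: eq_bigr => k _; rewrite [top 0 k]mxE.
  have sWu : Wz *m S \in unitmx by rewrite -sWz; exact: (dhom_unitmx dsfE ds).
  have : map_mx s A = A.
    apply: (can_inj (mulmxK sWu)).
    by rewrite -{1}sWz -(dhom_mulmx dsfE ds EA EWz) AW stop -AW mulmxA.
  by move/matrixP/(_ 0 i); rewrite mxE.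
exists P, (fun i => - A 0 i), z; split.
- by split=> // i; apply: (subfieldN dsfK.1).
- move=> j; split; first exact: Ez.
  have /matrixP/(_ 0 j) := AW; rewrite [RHS]mxE => <-.
  by rewrite mxE -big_split big1 //= => i _; rewrite [Wz i j]mxE mulNr subrr.
- exact: freeE.
- apply/seteqP; split.
    apply: zgen; first exact: (dgenerated_dsubfield _ _).1.
      by move=> x Kx; apply: sub_gen_smallest; left.
    by move=> j; apply: sub_gen_smallest; right; exists j.
  by apply: smallest_sub => // x [/KE //|[j _ <-]].
- exact: CE.
Qed.

End NormalSubgroup.

End Correspondence.

Theorem theorem5 (U : diffFieldType) (K L : set U)
    (I : eqType) (alpha : I -> U) (n : nat) (a eta : 'I_n -> U)
    (K_dsubfield : is_dsubfield K)
    (U_closure : diff_closure K)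
    (alpha_basis : is_basis (constants K) (alg_closure_in (constants K)) alpha)
    (L_PV : PV_for K L a eta) :
  let C := constants K in
  let Cb := alg_closure_in C in
  let gal := DGal Cb alpha in
  let closed_subgroups := closed_subgroup C Cb eta (gal L K) in
  [/\ set_bij closed_subgroups (intermediate K L) (fixed L),
      set_bij (intermediate K L) closed_subgroups
        (fun E => carrier (gal L E)),
      (forall H, closed_subgroups H -> carrier (gal L (fixed L H)) = H) /\
      (forall E, intermediate K L E -> fixed L (carrier (gal L E)) = E),
      (forall H1 H2, closed_subgroups H1 -> closed_subgroups H2 ->
         H1 `<=` H2 -> fixed L H2 `<=` fixed L H1) &
      (forall E1 E2, intermediate K L E1 -> intermediate K L E2 ->
         E1 `<=` E2 -> carrier (gal L E2) `<=` carrier (gal L E1))]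
  /\
  (forall E, intermediate K L E ->
     let N := carrier (gal L E) in
     (picard_vessiot K E <-> is_normal (gal L K) N) /\
     (picard_vessiot K E ->
        is_ghom (gal L K) (gal E K) (restr E) /\
        exists phi : set (U -> U) -> (U -> U),
          (forall s, carrier (gal L K) s ->
             phi (left_coset (gal L K) N s) = restr E s) /\
          is_giso (quotient_group (gal L K) N) (gal E K) phi)).
Proof.
move=> C Cb gal closed_subgroups.
have U_closed := U_closure.1; have dsfK := K_dsubfield.
have closedN E : intermediate K L E -> closed_subgroups (carrier (gal L E)).
  exact: (dgal_defined_closed dsfK L_PV alpha_basis).
have fixedN E : intermediate K L E -> fixed L (carrier (gal L E)) = E.
  exact: (fixed_dgal dsfK L_PV alpha_basis U_closed).
have interH H : closed_subgroups H -> intermediate K L (fixed L H).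
  by move=> [[HG _ _ _] _]; exact: (fixed_intermediate L_PV HG).
have galH H : closed_subgroups H -> carrier (gal L (fixed L H)) = H.
  exact: (dgal_fixed dsfK L_PV alpha_basis U_closed).
split; first split.
- split=> [H /interH //|H1 H2|E interE].
    rewrite !inE => cl1 cl2 H12.
    by rewrite -(galH _ cl1) -(galH _ cl2) H12.
  by exists (carrier (gal L E)); [exact: closedN | exact: fixedN].
- split=> [E /closedN //|E1 E2|H clH].
    rewrite !inE => int1 int2 E12.
    by rewrite -(fixedN _ int1) -(fixedN _ int2) E12.
  by exists (fixed L H); [exact: interH | exact: galH].
- by split.
- by move=> H1 H2 _ _ H12 x [Lx xH2]; split=> // s /H12; exact: xH2.
- by move=> E1 E2 _ _ E12 s [ds sb sE sr]; split=> // x /E12; exact: sE.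
move=> E interE N; have stable := dgal_PV_bar dsfK L_PV alpha_basis interE.
split; [split=> [/stable E_stable|normN]|move=> /stable E_stable; split].
- exact: (dgal_normal dsfK L_PV alpha_basis interE E_stable).
- have E_stable := normal_stable dsfK L_PV alpha_basis U_closed interE normN.
  exact: (stable_PV dsfK L_PV alpha_basis U_closed interE E_stable).
- exact: (restr_ghom dsfK L_PV alpha_basis interE E_stable).
- exact: (quotient_iso dsfK L_PV alpha_basis U_closed interE E_stable).
Qed.
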